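(* Let $m\ge2$ be an integer and let $\beta\in\mathbb{R}$ satisfy $\beta\ne l(l-m+1)$ for all $l\in\mathbb{Z}$. Then the germ $(M^m_\beta,0)$ admits a divergent formal infinitesimal automorphism $$L^m_\beta=-\frac{\chi'(w)\,\tau(w)^m}{\chi(w)\,\tau'(w)}\,z\frac{\partial}{\partial z}+\frac{\tau(w)^m}{\tau'(w)}\frac{\partial}{\partial w},$$ vanishing to order $m$ at $0$, where $$\chi(w)=\frac1{f_\beta(w)},\qquad \tau(w)=w\Big(1+\frac{1-m}{2i}w^{m-1}\ln\frac{g_\beta(w)}{w^{m-1}f_\beta(w)}\Big)^{\frac1{1-m}}.$$ The real formal flow $F_t(z,w)$ generated by $L^m_\beta$ consists of divergent formal automorphisms of $(M^m_\beta,0)$ for all $t\in\mathbb{R}\setminus C$, where $C$ is a cyclic subgroup of $(\mathbb{R},+)$.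
   Context: Coordinates in $\mathbb{C}^2$ are $(z,w)$. Let $\mathcal{E}^m_\beta$ be the ODE $z''=\big(\frac{2i}{w^m}-\frac mw\big)z'+\frac{\beta}{w^2}z$ for $z=z(w)$. Series $f_\beta,g_\beta$: the formal power series $f_\beta(w)=1+O(w)$, $g_\beta(w)=w^{m-1}+O(w^m)$ such that $f_\beta(w)$ and $g_\beta(w)\,w^{1-m}\exp\!\big(\frac{2i}{1-m}w^{1-m}\big)$ are formal solutions of $\mathcal{E}^m_\beta$. Then $\chi=1+O(w)$, $\tau=w+O(w^{m+1})$ are well-defined formal power series (branches with $\ln 1=0$, $1^{1/(1-m)}=1$). Hypersurface $M^m_\beta$: there is a unique function $\psi(x,y)=x+\sum_{k\ge2}\psi_k(y)x^k$, holomorphic near $0\in\mathbb{C}^2$, such that all curves $w=\bar\eta\,e^{i\bar\eta^{m-1}\psi(z\bar\xi,\bar\eta)}$ ($\xi,\eta$ small parameters, $\eta\ne0$), considered as graphs $w=w(z)$, satisfy the inverse ODE $w''=-\big(\frac{2i}{w^m}-\frac mw\big)(w')^2-\frac{\beta}{w^2}(w')^3z$. The equation $w=\bar w\,e^{i\bar w^{m-1}\psi(z\bar z,\bar w)}$ defines a germ at $0$ of a smooth real-analytic hypersurface, which is $M^m_\beta$. For $M=\{\theta(Z,\bar Z)=0\}$, a formal vector field $L$ is a formal infinitesimal automorphism of $(M,0)$ if $(L+\bar L)\theta$ is a formal power series multiple of $\theta$. A formal automorphism of $(M,0)$ is a formal invertible mapping $F:(\mathbb{C}^2,0)\to(\mathbb{C}^2,0)$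 with $\theta(F(Z),\bar F(\bar Z))=\lambda(Z,\bar Z)\theta(Z,\bar Z)$, $\lambda$ a formal power series with nonzero constant term. Divergent means that at least one component series diverges. The formal flow of a formal vector field $L$ with $L(0)=0$ is the unique one-parameter group $F_t$ of formal invertible mappings, with all finite jets holomorphic in $t$, such that $\frac{d}{dt}F_t|_{t=0}=L$; the real flow is its restriction to $t\in\mathbb{R}$. *)

(* Defs.v *)
From HB Require Import structures.
From mathcomp Require Import all_boot all_order all_algebra.
From mathcomp Require Import complex.
From mathcomp Require Import all_classical all_reals all_analysis.

Set Implicit Arguments.
Unset Strict Implicit.
Unset Printing Implicit Defensive.

Import Order.TTheory GRing.Theory Num.Theory.
Import numFieldNormedType.Exports.

Local Open Scope classical_set_scope.
Local Open Scope ring_scope.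

Notation mexp n := {ffun 'I_n -> nat}.

Definition mdeg n (a : mexp n) : nat := (\sum_i a i)%N.

Definition mexp0 n : mexp n := [ffun=> 0%N].
Definition mexp1 n (i : 'I_n) : mexp n := [ffun j => (j == i) : nat].
Definition mexpD n (a b : mexp n) : mexp n := [ffun i => (a i + b i)%N].
Definition mexpB n (a b : mexp n) : mexp n := [ffun i => (a i - b i)%N].

Definition below n (a : mexp n) : seq (mexp n) :=
  [seq [ffun i => val (b i)] | b : {dffun forall i : 'I_n, 'I_(a i).+1}].

Lemma mem_below n (a b : mexp n) : (b \in below a) = [forall i, b i <= a i]%N.
Proof.
apply/mapP/forallP => [[c _ ->] i|ba]; first by rewrite ffunE -ltnS ltn_ord.
exists (finfun (fun i => Ordinal (ba i : b i < (a i).+1)%N)).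
  by rewrite mem_enum.
by apply/ffunP => i; rewrite !ffunE.
Qed.

Lemma below_uniq n (a : mexp n) : uniq (below a).
Proof.
rewrite map_inj_uniq ?enum_uniq // => b c /ffunP bc.
by apply/ffunP => i; apply/val_inj; have := bc i; rewrite !ffunE.
Qed.

Definition splits n (a : mexp n) : seq (mexp n * mexp n) :=
  [seq (b, mexpB a b) | b <- below a].

Lemma mem_splits n (a : mexp n) s : (s \in splits a) = (mexpD s.1 s.2 == a).
Proof.
apply/mapP/eqP => [[b]|<-].
  rewrite mem_below => /forallP ba ->.
  by apply/ffunP => i; rewrite !ffunE /= subnKC.
exists s.1; first by rewrite mem_below; apply/forallP => i; rewrite ffunE leq_addr.
case: s => b c /=; congr (_, _).
by apply/ffunP => i; rewrite !ffunE addKn.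
Qed.

Lemma splits_uniq n (a : mexp n) : uniq (splits a).
Proof. by rewrite map_inj_uniq ?below_uniq // => b c []. Qed.

Lemma mexpDC n : commutative (@mexpD n).
Proof. by move=> a b; apply/ffunP => i; rewrite !ffunE addnC. Qed.

Lemma mexpDA n : associative (@mexpD n).
Proof. by move=> a b c; apply/ffunP => i; rewrite !ffunE addnA. Qed.

Lemma mexp0D n : left_id (mexp0 n) (@mexpD n).
Proof. by move=> a; apply/ffunP => i; rewrite !ffunE. Qed.

Record fps (K : nmodType) (n : nat) := Fps { fcoef :> mexp n -> K }.

HB.instance Definition _ K n := [isNew for @fcoef K n].
HB.instance Definition _ K n := [Choice of fps K n by <:].

Lemma fpsP (K : nmodType) n (p q : fps K n) : p =1 q -> p = q.
Proof. by case: p q => [p] [q] /= /funext ->. Qed.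

Section Zmodule.
Variables (K : zmodType) (n : nat).
Implicit Types p q : fps K n.

Definition fps0 : fps K n := Fps (fun=> 0).
Definition fpsD p q : fps K n := Fps (fun a => p a + q a).
Definition fpsN p : fps K n := Fps (fun a => - p a).

Fact fpsDA : associative fpsD.
Proof. by move=> p q r; apply/fpsP => a /=; rewrite addrA. Qed.
Fact fpsDC : commutative fpsD.
Proof. by move=> p q; apply/fpsP => a /=; rewrite addrC. Qed.
Fact fps0D : left_id fps0 fpsD.
Proof. by move=> p; apply/fpsP => a /=; rewrite add0r. Qed.
Fact fpsND : left_inverse fps0 fpsN fpsD.
Proof. by move=> p; apply/fpsP => a /=; rewrite addNr. Qed.

HB.instance Definition _ :=
  GRing.isZmodule.Build (fps K n) fpsDA fpsDC fps0D fpsND.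

End Zmodule.

Definition fpsC (K : nmodType) n (c : K) : fps K n :=
  Fps (fun a => if a == mexp0 n then c else 0).

Section Ring.
Variables (K : comNzRingType) (n : nat).
Implicit Types p q r : fps K n.

Definition fpsM p q : fps K n :=
  Fps (fun a => \sum_(s <- splits a) p s.1 * q s.2).

Fact fpsMC : commutative fpsM.
Proof.
move=> p q; apply/fpsP => a /=.
have sw : perm_eq (splits a) [seq (s.2, s.1) | s <- splits a].
  apply: uniq_perm; rewrite ?splits_uniq //.
    by rewrite map_inj_uniq ?splits_uniq // => -[b c] [b' c'] [-> ->].
  move=> [b c]; rewrite mem_splits /=; apply/idP/mapP => [bc|].
    by exists (c, b); rewrite ?mem_splits //= mexpDC.
  by move=> [[b' c'] + [-> ->]]; rewrite mem_splits /= mexpDC.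
by rewrite (perm_big _ sw) big_map /=; apply: eq_bigr => s _; rewrite mulrC.
Qed.

Fact fpsMA : associative fpsM.
Proof.
move=> p q r; apply/fpsP => a /=.
pose l := [seq (s.1, t.1, t.2) | s <- splits a, t <- splits s.2].
pose l' := [seq (t.1, t.2, s.2) | s <- splits a, t <- splits s.1].
have ll' : perm_eq l l'.
  apply: uniq_perm.
  - apply: allpairs_uniq_dep; rewrite ?splits_uniq //.
      by move=> s _; rewrite splits_uniq.
    move=> s s' /allpairsPdep[x [y [_ yx ->]]] /allpairsPdep[x' [y' [_ yx' ->]]] /=.
    move: yx yx'; rewrite !mem_splits => /eqP yx /eqP yx'.
    case: x y x' y' yx yx' => [x1 x2] [y1 y2] [x1' x2'] [y1' y2'] /= <- <-.
    by move=> [-> -> ->].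
  - apply: allpairs_uniq_dep; rewrite ?splits_uniq //.
      by move=> s _; rewrite splits_uniq.
    move=> s s' /allpairsPdep[x [y [_ yx ->]]] /allpairsPdep[x' [y' [_ yx' ->]]] /=.
    move: yx yx'; rewrite !mem_splits => /eqP yx /eqP yx'.
    case: x y x' y' yx yx' => [x1 x2] [y1 y2] [x1' x2'] [y1' y2'] /= <- <-.
    by move=> [-> -> ->].
  - move=> [[b c] d]; apply/allpairsPdep/allpairsPdep.
      move=> [[x u] [[y z]]] [+ + [-> -> ->]]; rewrite !mem_splits /=.
      move=> /eqP <- /eqP <-; exists (mexpD x y, z), (x, y).
      by rewrite !mem_splits /= mexpDA.
    move=> [[u x] [[y z]]] [+ + [-> -> ->]]; rewrite !mem_splits /=.
    move=> /eqP <- /eqP <-; exists (y, mexpD z x), (z, x).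
    by rewrite !mem_splits /= mexpDA.
transitivity (\sum_(x <- l) p x.1.1 * q x.1.2 * r x.2).
  rewrite big_allpairs_dep /=; apply: eq_bigr => s _.
  by rewrite mulr_sumr; apply: eq_bigr => t _; rewrite mulrA.
rewrite (perm_big _ ll') big_allpairs_dep /=; apply: eq_bigr => s _.
by rewrite mulr_suml.
Qed.

Fact fps1M : left_id (fpsC n 1) fpsM.
Proof.
move=> p; apply/fpsP => a /=.
rewrite (bigD1_seq (mexp0 n, a)) ?splits_uniq ?mem_splits /= ?mexp0D ?eqxx //.
rewrite mul1r big_seq_cond big1 ?addr0 // => -[b c] /andP[]; rewrite mem_splits /=.
case: (eqVneq b (mexp0 n)) => [->|_ _ _]; last by rewrite mul0r.
by rewrite mexp0D => /eqP ->; rewrite eqxx.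
Qed.

Fact fpsMDl : left_distributive fpsM +%R.
Proof.
move=> p q r; apply/fpsP => a /=; rewrite -big_split /=.
by apply: eq_bigr => s _; rewrite mulrDl.
Qed.

Fact fps1_neq0 : fpsC n 1 != 0 :> fps K n.
Proof.
by apply/eqP => /(congr1 (fun p : fps K n => p (mexp0 n))) /eqP;
  rewrite /= eqxx oner_eq0.
Qed.

HB.instance Definition _ := GRing.Zmodule_isComNzRing.Build (fps K n)
  fpsMA fpsMC fps1M fpsMDl fps1_neq0.

End Ring.

Definition fpsX (K : nzSemiRingType) n (i : 'I_n) : fps K n :=
  Fps (fun a => (a == mexp1 i)%:R).

Definition fps_deriv (K : pzSemiRingType) n (i : 'I_n) (p : fps K n) : fps K n :=
  Fps (fun a => (a i).+1%:R * p (mexpD a (mexp1 i))).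

Definition fps_map (K : nmodType) n (u : K -> K) (p : fps K n) : fps K n :=
  Fps (fun a => u (p a)).

(* [p (h_0, ..., h_(n-1))], for [h i] without constant term: only monomials of
   degree at most [mdeg a] contribute to the coefficient at [a]. *)
Definition fps_subst (K : comNzRingType) n k (h : 'I_n -> fps K k)
    (p : fps K n) : fps K k :=
  Fps (fun a => \sum_(b <- below [ffun=> mdeg a])
                  p b * (\prod_i h i ^+ b i) a).

(* [\sum_k c k * h ^ k], for [h] without constant term. *)
Definition fps_comp (K : comNzRingType) n (c : nat -> K) (h : fps K n)
    : fps K n :=
  Fps (fun a => \sum_(k < (mdeg a).+1) c k * (h ^+ k) a).

Section Functions.
Variables (K : fieldType) (n : nat).
Implicit Types p : fps K n.

(* For [p 0 != 0]. *)
Definition fps_inv p : fps K n :=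
  fpsC n (p (mexp0 n))^-1 *
  fps_comp (fun=> 1) (1 - fpsC n (p (mexp0 n))^-1 * p).

(* For [p 0 = 0]. *)
Definition fps_exp p : fps K n := fps_comp (fun k => (k`!%:R)^-1) p.

(* For [p 0 = 1]; the branch with [ln 1 = 0]. *)
Definition fps_ln p : fps K n :=
  fps_comp (fun k => if k is j.+1 then (-1) ^+ j / k%:R else 0) (p - 1).

(* For [p 0 = 1]; the branch of [p ^ s] with [1 ^ s = 1] (binomial series). *)
Definition fps_pow (s : K) p : fps K n :=
  fps_comp (fun k => (\prod_(j < k) (s - j%:R)) / k`!%:R) (p - 1).

End Functions.

Section OneVariable.
Variable K : nmodType.

Definition ucoef (p : fps K 1) (k : nat) : K := p [ffun=> k].

(* [p / w ^ d], for [p] divisible by [w ^ d]. *)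
Definition fps_shift d (p : fps K 1) : fps K 1 :=
  Fps (fun a => ucoef p (a ord0 + d)).

Definition laurent (p : fps K 1) (k : int) : K :=
  if k is Posz j then ucoef p j else 0.

End OneVariable.

Section Convergence.
Variable R : realType.

Definition convergent n (p : fps R[i] n) : Prop :=
  exists r : R, 0 < r /\
    summable [set: mexp n]
      (fun a => (Normc.normc (p a) * r ^+ mdeg a)%:E).

Definition fps_eval n (p : fps R[i] n) (x : 'I_n -> R[i]) : R[i] :=
  lim ((fun N : nat =>
          \sum_(b <- below [ffun=> N]) p b * \prod_i x i ^+ b i : R[i]^o) @ \oo).

Definition expC (z : R[i]) : R[i] :=
  (expR (complex.Re z) * cos (complex.Im z)
    +i* (expR (complex.Re z) * sin (complex.Im z)))%C.

End Convergence.

Section FormalGeometry.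
Variables (R : realType) (n : nat).

(* A vector field [\sum_i L i * d/dZ_i], or a mapping with components [F i]. *)
Definition formal_field := 'I_n -> fps R[i] n.
Definition formal_map := 'I_n -> fps R[i] n.

(* Series in [(Z, Zbar)] have [n + n] variables, [Z_i] being the variable
   [lshift n i] and [Zbar_i] the variable [rshift n i]. *)
Definition in_Z (p : fps R[i] n) : fps R[i] (n + n) :=
  fps_subst (fun i => fpsX _ (lshift n i)) p.
Definition conj_in_Zbar (p : fps R[i] n) : fps R[i] (n + n) :=
  fps_subst (fun i => fpsX _ (rshift n i)) (fps_map (@conjc R) p).

Definition infinitesimal_automorphism (theta : fps R[i] (n + n))
    (L : formal_field) : Prop :=
  exists lam : fps R[i] (n + n),
    \sum_i (in_Z (L i) * fps_deriv (lshift n i) theta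
            + conj_in_Zbar (L i) * fps_deriv (rshift n i) theta)
    = lam * theta.

Definition invertible (F : formal_map) : Prop :=
  (forall i, F i (mexp0 n) = 0) /\
  exists G : formal_map,
    [/\ forall i, G i (mexp0 n) = 0,
        forall i, fps_subst G (F i) = fpsX _ i
      & forall i, fps_subst F (G i) = fpsX _ i].

Definition formal_automorphism (theta : fps R[i] (n + n)) (F : formal_map)
    : Prop :=
  invertible F /\
  exists lam : fps R[i] (n + n), lam (mexp0 (n + n)) <> 0 /\
    fps_subst (fun j => match fintype.split j with
                        | inl i => in_Z (F i)
                        | inr i => conj_in_Zbar (F i)
                        end) theta
    = lam * theta.

Definition divergent (F : 'I_n -> fps R[i] n) : Prop :=
  exists i, ~ convergent (F i).

Definition vanishing_order (L : formal_field) (d : nat) : Prop :=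
  (forall i a, (mdeg a < d)%N -> L i a = 0) /\
  (exists i a, mdeg a = d /\ L i a <> 0).

Definition formal_flow (L : formal_field) (F : R[i] -> formal_map) : Prop :=
  [/\ forall t, invertible (F t),
      forall s t i, F (s + t) i = fps_subst (F t) (F s i),
      forall i a t,
        derivable ((fun u => F u i a) : R[i]^o -> R[i]^o) t 1
    & forall i a,
        derive1 ((fun u => F u i a) : R[i]^o -> R[i]^o) 0 = L i a].

End FormalGeometry.

Arguments infinitesimal_automorphism {R n}.
Arguments formal_automorphism {R n}.
Arguments formal_flow {R n}.

Section Hypersurface.
Variables (R : realType) (m : nat) (beta : R).

Local Notation C := R[i].
Local Notation I := ('i%C : R[i]).

(* Laurent series are given by their coefficients [int -> C]. *)
Definition laurent_mon (c : C) (d : int) (a : int -> C) : int -> C :=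
  fun k => c * a (k - d).

(* The derivative of [h * exp (c * w ^ d)], divided by [exp (c * w ^ d)]. *)
Definition laurent_deriv_exp (c : C) (d : int) (h : int -> C) : int -> C :=
  fun k => (k + 1)%:~R * h (k + 1) + laurent_mon (c * d%:~R) (d - 1) h k.

(* [h * exp (c * w ^ d)] is a formal solution of
   z'' = (2i / w^m - m / w) z' + beta / w^2 z. *)
Definition formal_solution (c : C) (d : int) (h : int -> C) : Prop :=
  let D := laurent_deriv_exp c d in
  forall k, D (D h) k = laurent_mon (2 * I) (- m%:Z) (D h) k
                        - laurent_mon m%:R (- 1) (D h) k
                        + laurent_mon beta%:C%C (- 2) h k.

Definition is_f (f : fps C 1) : Prop :=
  ucoef f 0 = 1 /\ formal_solution 0 0 (laurent f).

Definition is_g (g : fps C 1) : Prop :=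
  [/\ forall k, (k < m.-1)%N -> ucoef g k = 0,
      ucoef g m.-1 = 1
    & formal_solution (2 * I / (1 - m%:R)) (1 - m%:Z)
        (laurent_mon 1 (1 - m%:Z) (laurent g))].

Definition chi (f : fps C 1) : fps C 1 := fps_inv f.

Definition tau (f g : fps C 1) : fps C 1 :=
  let w := fpsX _ ord0 in
  w * fps_pow (1 - m%:R)^-1
        (1 + fpsC 1 ((1 - m%:R) / (2 * I)) * w ^+ m.-1
             * fps_ln (fps_shift m.-1 g * fps_inv f)).

Definition pair_of T (x y : T) (i : 'I_2) : T := if i == ord0 then x else y.

(* Coordinates of C^2: [z] is variable 0, [w] is variable 1. *)
Definition Lfield (f g : fps C 1) : formal_field R 2 :=
  let D := fps_deriv (ord0 : 'I_1) in
  let X := chi f in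
  let T := tau f g in
  let at_w := fps_subst (fun _ : 'I_1 => fpsX C (lift ord0 ord0 : 'I_2)) in
  pair_of
    (at_w (- (D X * T ^+ m * fps_inv (X * D T))) * fpsX C (ord0 : 'I_2))
    (at_w (T ^+ m * fps_inv (D T))).

(* The curve [w(z)] with parameters [xi], [eta]. *)
Definition curve (psi : fps C 2) (xi eta z : C) : C :=
  let y := (eta^*)%C in
  y * expC (I * y ^+ m.-1 * fps_eval psi (pair_of (z * (xi^*)%C) y)).

(* [psi(x,y)]: [x] is variable 0, [y] is variable 1. *)
Definition is_psi (psi : fps C 2) : Prop :=
  [/\ convergent psi,
      forall a : mexp 2, a ord0 = 0%N -> psi a = 0,
      forall a : mexp 2, a ord0 = 1%N -> psi a = (a == mexp1 ord0)%:R
    & exists rho : R, 0 < rho /\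
      forall xi eta z : C, eta != 0 ->
        Normc.normc xi < rho -> Normc.normc eta < rho ->
        Normc.normc z < rho ->
        let w : C^o -> C^o := curve psi xi eta in
        derive1n 2 w z =
          - (2 * I / w z ^+ m - m%:R / w z) * derive1 w z ^+ 2
          - beta%:C%C / w z ^+ 2 * derive1 w z ^+ 3 * z].

(* [w - wbar * exp (i * wbar^(m-1) * psi (z * zbar, wbar))]. This series is
   not real, but it generates the ideal of the real hypersurface, which is
   all that the notions above depend on. *)
Definition theta (psi : fps C 2) : fps C (2 + 2) :=
  let z := fpsX C (lshift 2 (ord0 : 'I_2)) in
  let w := fpsX C (lshift 2 (lift ord0 ord0 : 'I_2)) in
  let zb := fpsX C (rshift 2 (ord0 : 'I_2)) in
  let wb := fpsX C (rshift 2 (lift ord0 ord0 : 'I_2)) in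
  w - wb * fps_exp (fpsC _ I * wb ^+ m.-1
                    * fps_subst (pair_of (z * zb) wb) psi).

End Hypersurface.

(* Main.v *)
Require Import Defs.
From HB Require Import structures.
From mathcomp Require Import all_boot all_order all_algebra.
From mathcomp Require Import complex.
From mathcomp Require Import all_classical all_reals all_analysis.
From mathcomp Require Import ring lra zify.
Set Implicit Arguments.
Unset Strict Implicit.
Unset Printing Implicit Defensive.
Import Order.TTheory GRing.Theory Num.Theory.
Local Open Scope ring_scope.

(** Put [m = s + 1]. Multiplied by [w^m], the linear equation becomes [linear_ode] with [c = 2i].
    Removing the exponential factor from the second solution changes [c] into [-c]; as [beta] is
    real, uniqueness of the power series solution identifies [g / w^(m-1)] with the conjugate series
    [fb] of [f] ([is_g_conj]). The Wronskian of the pair has an explicit integral, the logarithm and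
    the root in [tau] cancel, and the field is [L = z U d/dz + V d/dw] with [U = w^m f' fb] and
    [V = w^m f fb] ([LfieldE]).

    Infinitesimal automorphism: the hypersurface is a graph [w = Q(z, zb, wb)], and [Q], as a
    function of [z], solves the inverse equation for all values of the parameters [zb], [wb]. The
    restriction of [(L + conj L) theta] to the graph ([defect]) solves the linearized equation at
    [Q]: its part coming from [L] does because [L] is a point symmetry of the linear equation, the
    remaining part because parameter derivatives of a family of solutions do. Value and slope of the
    defect vanish at [z = 0], so the defect vanishes ([defect_eq0]) and [theta] divides
    [(L + conj L) theta]. The equation for [Q] is a formal equation for [psi]; it is extracted from
    the pointwise one through asymptotic expansions along rays into the origin ([is_psi_ode]).

    Flow: for real [t] the pullback [y] of [theta] under the flow satisfies [y' = mu y] with [mu] in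
    the maximal ideal. On the graph all its coefficients stay zero, by induction on the degree, so
    [theta] divides [y] ([flow_formal_automorphism]).

    Divergence: [f] has only powers of [w^s], with coefficients [a_j] obeying a two-term recursion.
    The assumption on [beta] makes every [a_j] nonzero, and [a_(k-i) / a_k = i^i T(i,k)] with
    [T(i,k)] asymptotic to [(2 / (s k))^i] (the base [i] being the imaginary unit). If [L]
    converged, then [P f' = Q f] with convergent [P], [Q] and [P(0) = 1]; the coefficient of
    [w^(s k)], divided by [s k a_k], tends to [P(0)], a contradiction
    ([no_convergent_log_derivative]). If [F_t = (Z, W)] converged, the first integral [z / f(w)]
    would give [f(W) = rho f] on [z = 0], with [W = w (1 + t w^s + ...)] and [rho(0) = 1]. The same
    limit sums to the exponential series and yields [exp(2 i t) = 1]; its real part [cos (2 t) = 1]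
    ([cos_eq1_of_convergent]) puts [t] in the cyclic group generated by [pi]. Both limits are
    dominated by an exponential series ([tannery]). *)

(** * Exponent vectors and total degree *)

Section Exponents.
Variable n : nat.
Implicit Types a b c : mexp n.

Lemma mdegD a b : mdeg (mexpD a b) = (mdeg a + mdeg b)%N.
Proof. by rewrite /mdeg -big_split; apply: eq_bigr => i _; rewrite ffunE. Qed.

Lemma mdeg_eq0 a : (mdeg a == 0%N) = (a == mexp0 n).
Proof.
apply/eqP/eqP => [/eqP|->]; last by rewrite /mdeg big1 // => i _; rewrite ffunE.
rewrite /mdeg sum_nat_eq0 => /forallP a0; apply/ffunP => i.
by rewrite ffunE; apply/eqP: (a0 i).
Qed.

Lemma mdeg0 : mdeg (mexp0 n) = 0%N.
Proof. by apply/eqP; rewrite mdeg_eq0. Qed.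

Lemma mdeg1 i : mdeg (mexp1 i : mexp n) = 1%N.
Proof.
rewrite /mdeg (bigD1 i) //= big1 ?ffunE ?eqxx ?addn0 // => j ji.
by rewrite ffunE (negbTE ji).
Qed.

Lemma leq_mdeg a i : (a i <= mdeg a)%N.
Proof. by rewrite /mdeg (bigD1 i) //= leq_addr. Qed.

Lemma mem_box N a : (mdeg a <= N)%N -> a \in below [ffun=> N].
Proof.
move=> aN; rewrite mem_below; apply/forallP => i; rewrite ffunE.
exact: leq_trans (leq_mdeg a i) aN.
Qed.

Lemma splits_mdeg a s : s \in splits a -> (mdeg s.1 + mdeg s.2)%N = mdeg a.
Proof. by rewrite mem_splits => /eqP <-; rewrite mdegD. Qed.

Lemma mexpDK a b : mexpB (mexpD a b) a = b.
Proof. by apply/ffunP => i; rewrite !ffunE addKn. Qed.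

Lemma mexpD0 a : mexpD a (mexp0 n) = a.
Proof. by rewrite mexpDC mexp0D. Qed.

HB.instance Definition _ := Monoid.isComLaw.Build (mexp n) (mexp0 n) (@mexpD n)
  (@mexpDA n) (@mexpDC n) (@mexp0D n).

Lemma big_mexp1 a :
  \big[@mexpD n/mexp0 n]_i iter (a i) (mexpD (mexp1 i)) (mexp0 n) = a.
Proof.
have coef (r : seq 'I_n) (F : 'I_n -> mexp n) j :
    (\big[@mexpD n/mexp0 n]_(i <- r) F i) j = (\sum_(i <- r) F i j)%N.
  by elim/big_rec2: _ => [|i y x _ <-]; rewrite ffunE.
have it i k j : (iter k (mexpD (mexp1 i)) (mexp0 n)) j = (k * (j == i))%N.
  by elim: k => [|k IH]; rewrite ffunE // IH ffunE mulSn.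
apply/ffunP => j; rewrite coef (bigD1 j) //= it eqxx muln1 big1 ?addn0 // => i ij.
by rewrite it eq_sym (negbTE ij) muln0.
Qed.

End Exponents.

(** * The filtration by powers of the maximal ideal, and truncation *)

Section Ideals.
Variables (K : comNzRingType) (n : nat).
Implicit Types (p q r : fps K n) (a b : mexp n).

(** Membership in the [N]-th power of the maximal ideal; every formal limit below is taken in this
    topology. *)
Definition vanish N p := forall a, (mdeg a < N)%N -> p a = 0.

Lemma fpsDE p q a : (p + q) a = p a + q a. Proof. by []. Qed.
Lemma fpsNE p a : (- p) a = - p a. Proof. by []. Qed.
Lemma fpsBE p q a : (p - q) a = p a - q a. Proof. by []. Qed.
Lemma fps0E a : (0 : fps K n) a = 0. Proof. by []. Qed.
Lemma fps1E a : (1 : fps K n) a = (a == mexp0 n)%:R.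
Proof. by rewrite /= /fpsC /=; case: eqP. Qed.
Lemma fpsME p q a : (p * q) a = \sum_(s <- splits a) p s.1 * q s.2.
Proof. by []. Qed.

Lemma fps_sumE I (r : seq I) (P : pred I) (F : I -> fps K n) a :
  (\sum_(i <- r | P i) F i) a = \sum_(i <- r | P i) F i a.
Proof. by elim/big_rec2: _ => // i y x _ <-. Qed.

Lemma vanish_const p : vanish 1 p <-> p (mexp0 n) = 0.
Proof.
split=> [|p0 a]; first by apply; rewrite mdeg0.
by rewrite ltnS leqn0 mdeg_eq0 => /eqP ->.
Qed.

Lemma vanishW N M p : (M <= N)%N -> vanish N p -> vanish M p.
Proof. by move=> MN pN a aM; apply/pN/(leq_trans aM). Qed.

Lemma vanishD N p q : vanish N p -> vanish N q -> vanish N (p + q).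
Proof. by move=> pN qN a aN; rewrite fpsDE pN ?qN ?addr0. Qed.

Lemma vanishN N p : vanish N p -> vanish N (- p).
Proof. by move=> pN a aN; rewrite fpsNE pN ?oppr0. Qed.

Lemma vanishB N p q : vanish N p -> vanish N q -> vanish N (p - q).
Proof. by move=> pN qN; apply/vanishD/vanishN. Qed.

Lemma vanish_sum N I (r : seq I) (P : pred I) (F : I -> fps K n) :
  (forall i, P i -> vanish N (F i)) -> vanish N (\sum_(i <- r | P i) F i).
Proof. by move=> FN; elim/big_rec: _ => // i x Pi; apply/vanishD/FN. Qed.

Lemma vanishM N M p q : vanish N p -> vanish M q -> vanish (N + M) (p * q).
Proof.
move=> pN qM a aNM; rewrite fpsME big_seq big1 // => -[b c] /splits_mdeg /= bc.
have [bN|Nb] := ltnP (mdeg b) N; first by rewrite pN ?mul0r.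
by rewrite [q c]qM ?mulr0 //; move: aNM; rewrite -bc; lia.
Qed.

Lemma vanishMl N p q : vanish N q -> vanish N (p * q).
Proof. by move=> qN; rewrite -[N]add0n; apply: vanishM. Qed.

Lemma vanishMr N p q : vanish N p -> vanish N (p * q).
Proof. by rewrite mulrC; apply: vanishMl. Qed.

Lemma vanishX N k p : vanish N p -> vanish (k * N) (p ^+ k).
Proof.
move=> pN; elim: k => [|k IH]; first by rewrite mul0n => a.
by rewrite exprS mulSn; apply: vanishM.
Qed.

Lemma vanish_prod I (N : I -> nat) (F : I -> fps K n) (r : seq I) :
  (forall i, vanish (N i) (F i)) ->
  vanish (\sum_(i <- r) N i) (\prod_(i <- r) F i).
Proof.
move=> FN; elim: r => [|i r IH]; first by rewrite !big_nil => a.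
by rewrite !big_cons; apply: vanishM.
Qed.

Lemma vanish_eq p q : (forall N, vanish N (p - q)) -> p = q.
Proof.
move=> pq; apply/fpsP => a; apply/eqP; rewrite -subr_eq0 -fpsBE.
by rewrite (pq (mdeg a).+1).
Qed.

Lemma vanish_trans N p q r : vanish N (p - q) -> vanish N (q - r) -> vanish N (p - r).
Proof. by move=> pq /(vanishD pq); rewrite addrA subrK. Qed.

Lemma vanish_mul_congr N p p' q q' :
  vanish N (p - p') -> vanish N (q - q') -> vanish N (p * q - p' * q').
Proof.
move=> pp qq; have -> : p * q - p' * q' = (p - p') * q + p' * (q - q') by ring.
by apply: vanishD; [apply: vanishMr|apply: vanishMl].
Qed.

Lemma fpsCM_coef c p a : (fpsC n c * p) a = c * p a.
Proof.
rewrite fpsME (bigD1_seq (mexp0 n, a)) ?splits_uniq ?mem_splits /= ?mexp0D ?eqxx //.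
rewrite big_seq_cond big1 ?addr0 // => -[b d] /andP[]; rewrite mem_splits /=.
case: (eqVneq b (mexp0 n)) => [->|_ _ _]; last by rewrite mul0r.
by rewrite mexp0D => /eqP ->; rewrite eqxx.
Qed.

Lemma fpsC_additive c d : fpsC n (c + d) = fpsC n c + fpsC n d :> fps K n.
Proof. by apply/fpsP => a /=; case: ifP; rewrite ?addr0. Qed.

Lemma fpsC_mul c d : fpsC n (c * d) = fpsC n c * fpsC n d :> fps K n.
Proof. by apply/fpsP => a; rewrite fpsCM_coef /=; case: ifP; rewrite ?mulr0. Qed.

Lemma fpsC0 : fpsC n 0 = 0 :> fps K n.
Proof. by apply/fpsP => a /=; case: ifP. Qed.

Lemma fpsC1 : fpsC n 1 = 1 :> fps K n. Proof. by []. Qed.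

Lemma fpsC_opp c : fpsC n (- c) = - fpsC n c :> fps K n.
Proof. by apply/fpsP => a /=; case: ifP; rewrite ?oppr0. Qed.

Lemma fpsC_nat k : fpsC n k%:R = k%:R :> fps K n.
Proof.
elim: k => [|k IH]; first exact: fpsC0.
by rewrite -[k.+1]addn1 !natrD fpsC_additive IH.
Qed.

Lemma fps_const_mul p q : (p * q) (mexp0 n) = p (mexp0 n) * q (mexp0 n).
Proof.
rewrite fpsME (bigD1_seq (mexp0 n, mexp0 n)) ?splits_uniq ?mem_splits /= ?mexp0D //.
rewrite big_seq_cond big1 ?addr0 // => -[b d] /andP[] /splits_mdeg /=.
rewrite mdeg0 => /eqP; rewrite addn_eq0 !mdeg_eq0 => /andP[/eqP -> /eqP ->].
by rewrite eqxx.
Qed.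

Lemma fps_const_exp p k : (p ^+ k) (mexp0 n) = p (mexp0 n) ^+ k.
Proof.
elim: k => [|k IH]; first by rewrite !expr0 /= eqxx.
by rewrite !exprS fps_const_mul IH.
Qed.

Definition fps_mono a : fps K n := Fps (fun b => (b == a)%:R).

Lemma fps_monoM_coef a p b :
  (fps_mono a * p) b = if [forall i, a i <= b i]%N then p (mexpB b a) else 0.
Proof.
rewrite fpsME; case: ifPn => ab.
  have abE : mexpD a (mexpB b a) = b.
    by apply/ffunP => i; rewrite !ffunE subnKC //; apply/forallP: i.
  rewrite (bigD1_seq (a, mexpB b a)) ?splits_uniq ?mem_splits /= ?abE //.
  rewrite eqxx mul1r big_seq_cond big1 ?addr0 // => -[c d] /andP[].
  rewrite mem_splits /=; case: (eqVneq c a) => [-> /eqP <-|_ _ _].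
    by rewrite mexpDK eqxx.
  by rewrite mul0r.
rewrite big_seq big1 // => -[c d]; rewrite mem_splits /= => /eqP cd.
case: (eqVneq c a) => [ca|_]; last by rewrite mul0r.
case/negP: ab; apply/forallP => i; rewrite -cd ca ffunE; exact: leq_addr.
Qed.

Lemma fps_monoD a b : fps_mono (mexpD a b) = fps_mono a * fps_mono b.
Proof.
apply/fpsP => c; rewrite fps_monoM_coef /=; case: ifPn => ac.
  congr (_%:R); congr nat_of_bool; apply/eqP/eqP => [->|<-]; rewrite ?mexpDK //.
  by apply/ffunP => i; rewrite !ffunE subnKC //; apply/forallP: i.
case: eqP => // cE; case/negP: ac; apply/forallP => i; rewrite cE ffunE.
exact: leq_addr.
Qed.

Lemma fps_mono0 : fps_mono (mexp0 n) = 1.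
Proof. by apply/fpsP => a; rewrite fps1E. Qed.

Lemma fps_mono1 i : fps_mono (mexp1 i) = fpsX K i. Proof. by []. Qed.

Lemma fps_monoE a : fps_mono a = \prod_i fpsX K i ^+ a i.
Proof.
rewrite -[in LHS](big_mexp1 a).
rewrite (big_morph fps_mono fps_monoD fps_mono0); apply: eq_bigr => i _.
elim: (a i) => [|k IH]; first by rewrite expr0 fps_mono0.
by rewrite /= fps_monoD IH exprS.
Qed.

Definition fps_trunc N p : fps K n :=
  \sum_(b <- below [ffun=> N]) fpsC n (p b) * fps_mono b.

Lemma fps_trunc_vanish N p : vanish N.+1 (p - fps_trunc N p).
Proof.
move=> a aN; rewrite fpsBE fps_sumE; apply/eqP; rewrite subr_eq0; apply/eqP.
under eq_bigr do rewrite fpsCM_coef; rewrite (bigD1_seq a) ?below_uniq ?mem_box //=.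
rewrite eqxx mulr1 big1 ?addr0 // => b ba.
by rewrite eq_sym (negbTE ba) mulr0.
Qed.

(** Constants and variables generate the polynomials, and truncations approximate every series.
    Identities between continuous operators thus need checking on generators only. *)
Lemma fps_ind (P : fps K n -> Prop) :
  (forall c, P (fpsC n c)) -> (forall i, P (fpsX K i)) ->
  (forall p q, P p -> P q -> P (p + q)) -> (forall p q, P p -> P q -> P (p * q)) ->
  (forall p, (forall N, exists q, P q /\ vanish N (p - q)) -> P p) ->
  forall p, P p.
Proof.
move=> PC PX PD PM Plim p; apply: Plim => N; exists (fps_trunc N p).
split; last by apply: (vanishW (leqnSn N)); apply: fps_trunc_vanish.
rewrite /fps_trunc; apply: (big_ind P) => [||b _]; first by rewrite -fpsC0.
  exact: PD.
apply: (PM) => //; rewrite fps_monoE; apply: (big_ind P) => // [|i _].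
  exact: PC.
elim: (b i) => [|k IH]; first exact: PC.
by rewrite exprS; apply: PM.
Qed.

Lemma vanish_fpsX i : vanish 1 (fpsX K i).
Proof.
apply/vanish_const => /=; case: eqP => // /(congr1 (@mdeg n)).
by rewrite mdeg0 mdeg1.
Qed.

End Ideals.

(** * Substitution as a continuous algebra morphism *)

Section Substitution.
Variables (K : comNzRingType) (n k : nat) (h : 'I_n -> fps K k).
Hypothesis h0 : forall i, h i (mexp0 k) = 0.
Implicit Types (p q : fps K n).

Let hpow (b : mexp n) := \prod_i h i ^+ b i.

Lemma vanish_hpow b : vanish (mdeg b) (hpow b).
Proof.
rewrite /hpow /mdeg; apply: vanish_prod => i; rewrite -[X in vanish X _]muln1.
by apply: vanishX; apply/vanish_const.
Qed.

(** Since no [h i] has a constant term, exponents of degree above [mdeg a] contribute nothing. The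
    summation box may therefore be enlarged, which makes it independent of [a]. *)
Lemma fps_substE p a N : (mdeg a <= N)%N ->
  fps_subst h p a = \sum_(b <- below [ffun=> N]) p b * hpow b a.
Proof.
move=> aN; rewrite [RHS](bigID (fun b => b \in below [ffun=> mdeg a])) /=.
rewrite [X in _ + X]big1 => [|b ba]; last first.
  rewrite vanish_hpow ?mulr0 // ltnNge; apply: contra ba; exact: mem_box.
rewrite addr0 -[in RHS]big_filter; apply: perm_big; apply: uniq_perm.
- exact: below_uniq.
- by rewrite filter_uniq ?below_uniq.
move=> b; rewrite mem_filter; case: (boolP (b \in _)) => //= ba; symmetry.
rewrite mem_below; apply/forallP => i; rewrite ffunE; apply: leq_trans aN.
by move: ba; rewrite mem_below => /forallP/(_ i); rewrite ffunE.
Qed.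

Lemma fps_subst_vanish N p : vanish N p -> vanish N (fps_subst h p).
Proof.
move=> pN a aN; rewrite /= big1 // => b _.
have [bN|Nb] := ltnP (mdeg b) N; first by rewrite pN ?mul0r.
by rewrite vanish_hpow ?mulr0 // (leq_trans aN).
Qed.

Lemma fps_substD p q : fps_subst h (p + q) = fps_subst h p + fps_subst h q.
Proof.
by apply/fpsP => a; rewrite fpsDE !(fps_substE _ (leqnn _)) -big_split; apply: eq_bigr => b _; rewrite fpsDE mulrDl.
Qed.

Lemma fps_subst0 : fps_subst h 0 = 0.
Proof. by apply/fpsP => a; rewrite /= big1 // => b _; rewrite mul0r. Qed.

Lemma fps_substN p : fps_subst h (- p) = - fps_subst h p.
Proof. by apply/eqP; rewrite -subr_eq0 opprK -fps_substD addNr fps_subst0. Qed.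

Lemma fps_substB p q : fps_subst h (p - q) = fps_subst h p - fps_subst h q.
Proof. by rewrite fps_substD fps_substN. Qed.

Lemma fps_subst_sum I (r : seq I) (P : pred I) (F : I -> fps K n) :
  fps_subst h (\sum_(i <- r | P i) F i) = \sum_(i <- r | P i) fps_subst h (F i).
Proof. exact: (big_morph _ fps_substD fps_subst0). Qed.

Lemma fps_subst_mono c b :
  fps_subst h (fpsC n c * fps_mono K b) = fpsC k c * hpow b.
Proof.
apply/fpsP => a; rewrite fpsCM_coef (@fps_substE _ _ (mdeg a + mdeg b)) ?leq_addr //.
under eq_bigr => d _ do rewrite fpsCM_coef.
rewrite (bigD1_seq b) ?below_uniq ?mem_box ?leq_addl //= eqxx mulr1.
by rewrite big1 ?addr0 // => d db; rewrite (negbTE db) mulr0 mul0r.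
Qed.

(** Both sides are continuous, so modulo each power of the maximal ideal the factors may be
    truncated; what remains is multiplicativity on monomials. *)
Lemma fps_substM p q : fps_subst h (p * q) = fps_subst h p * fps_subst h q.
Proof.
apply: vanish_eq => N.
have cp (r : fps K n) : vanish N (r - fps_trunc N r).
  by apply: (vanishW (leqnSn N)); apply: fps_trunc_vanish.
pose T := @fps_trunc K n N.
apply: (@vanish_trans _ _ _ _ (fps_subst h (T p * T q))).
  rewrite -fps_substB; apply: fps_subst_vanish.
  by apply: vanish_mul_congr; apply: cp.
apply: (@vanish_trans _ _ _ _ (fps_subst h (T p) * fps_subst h (T q))); last first.
  rewrite -opprB; apply: vanishN; apply: vanish_mul_congr;
    by rewrite -fps_substB; apply: fps_subst_vanish; apply: cp.
suff -> : fps_subst h (T p * T q) = fps_subst h (T p) * fps_subst h (T q).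
  by rewrite subrr.
rewrite /T /fps_trunc mulr_suml !fps_subst_sum mulr_suml; apply: eq_bigr => b _.
rewrite mulr_sumr !fps_subst_sum mulr_sumr; apply: eq_bigr => d _.
rewrite mulrACA -fpsC_mul -fps_monoD !fps_subst_mono mulrACA -fpsC_mul.
congr (_ * _); rewrite /hpow -big_split; apply: eq_bigr => i _.
by rewrite ffunE exprD.
Qed.

Lemma fps_substC c : fps_subst h (fpsC n c) = fpsC k c.
Proof.
rewrite -[fpsC n c]mulr1 -fps_mono0 fps_subst_mono /hpow big1 ?mulr1 // => i _.
by rewrite ffunE.
Qed.

Lemma fps_subst1 : fps_subst h 1 = 1. Proof. exact: fps_substC. Qed.

Lemma fps_substXn p j : fps_subst h (p ^+ j) = fps_subst h p ^+ j.
Proof.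
elim: j => [|j IH]; first by rewrite !expr0 fps_subst1.
by rewrite !exprS fps_substM IH.
Qed.

Lemma fps_substX i : fps_subst h (fpsX K i) = h i.
Proof.
rewrite -[fpsX K i]mul1r -fps_mono1 -fpsC1 fps_subst_mono fpsC1 mul1r /hpow.
rewrite (bigD1 i) //= big1 ?ffunE ?eqxx ?mulr1 // => j ji.
by rewrite ffunE (negbTE ji).
Qed.

Lemma fps_subst_const p : fps_subst h p (mexp0 k) = p (mexp0 n).
Proof.
rewrite -[p in LHS](subrK (fpsC n (p (mexp0 n)))) fps_substD fps_substC fpsDE.
have /vanish_const -> : vanish 1 (fps_subst h (p - fpsC n (p (mexp0 n)))).
  by apply: fps_subst_vanish; apply/vanish_const; rewrite fpsBE /= eqxx subrr.
by rewrite add0r /= eqxx.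
Qed.

(** The universal property through which composites of substitutions are recognized, as in
    [fps_substA]. *)
Lemma fps_subst_uniq (phi : fps K n -> fps K k) :
  (forall c, phi (fpsC n c) = fpsC k c) -> (forall i, phi (fpsX K i) = h i) ->
  (forall p q, phi (p + q) = phi p + phi q) ->
  (forall p q, phi (p * q) = phi p * phi q) ->
  (forall N p, vanish N p -> vanish N (phi p)) -> forall p, phi p = fps_subst h p.
Proof.
move=> phiC phiX phiD phiM phiv; apply: fps_ind.
- by move=> c; rewrite phiC fps_substC.
- by move=> i; rewrite phiX fps_substX.
- by move=> p q pE qE; rewrite phiD fps_substD pE qE.
- by move=> p q pE qE; rewrite phiM fps_substM pE qE.
move=> p pl; apply: vanish_eq => N; have [q [qE pq]] := pl N.
apply: (@vanish_trans _ _ _ _ (phi q)).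
  rewrite -(subrK q p) phiD addrK; exact: phiv.
by rewrite qE -fps_substB; apply: fps_subst_vanish; rewrite -opprB; apply: vanishN.
Qed.

End Substitution.

Lemma eq_fps_subst (K : comNzRingType) n k (h h' : 'I_n -> fps K k) p :
  h =1 h' -> fps_subst h p = fps_subst h' p.
Proof.
move=> hh; apply/fpsP => a /=; apply: eq_bigr => b _.
by congr (_ * fcoef _ _); apply: eq_bigr => i _; rewrite hh.
Qed.

Lemma fps_substA (K : comNzRingType) n k l (h : 'I_n -> fps K k)
    (u : 'I_k -> fps K l) p :
  (forall i, h i (mexp0 k) = 0) -> (forall i, u i (mexp0 l) = 0) ->
  fps_subst u (fps_subst h p) = fps_subst (fun i => fps_subst u (h i)) p.
Proof.
move=> h0 u0; apply: (@fps_subst_uniq K n l _ _ (fun p => fps_subst u (fps_subst h p))).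
- by move=> i; rewrite fps_subst_const.
- by move=> c; rewrite !fps_substC.
- by move=> i; rewrite fps_substX.
- by move=> q r; rewrite !fps_substD.
- by move=> q r; rewrite !fps_substM.
by move=> N q qN; do 2!apply: fps_subst_vanish => //.
Qed.

Lemma fpsX_const (K : comNzRingType) n (i : 'I_n) : fpsX K i (mexp0 n) = 0.
Proof. by apply/vanish_const/vanish_fpsX. Qed.

Lemma fps_subst_id (K : comNzRingType) n (p : fps K n) :
  fps_subst (fun i => fpsX K i) p = p.
Proof.
symmetry; apply: (@fps_subst_uniq K n n _ _ id) => // i; exact: fpsX_const.
Qed.

(** * Formal partial derivatives and the chain rule *)

Section Derivation.
Variables (K : comNzRingType) (n : nat).
Implicit Types (p q : fps K n) (i j : 'I_n).

Lemma fps_derivE i p a : fps_deriv i p a = (a i).+1%:R * p (mexpD a (mexp1 i)).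
Proof. by []. Qed.

Lemma fps_derivD i p q : fps_deriv i (p + q) = fps_deriv i p + fps_deriv i q.
Proof. by apply/fpsP => a; rewrite fpsDE !fps_derivE fpsDE mulrDr. Qed.

Lemma fps_derivN i p : fps_deriv i (- p) = - fps_deriv i p.
Proof. by apply/fpsP => a; rewrite fpsNE !fps_derivE fpsNE mulrN. Qed.

Lemma fps_derivB i p q : fps_deriv i (p - q) = fps_deriv i p - fps_deriv i q.
Proof. by rewrite fps_derivD fps_derivN. Qed.

Lemma fps_derivC i (c : K) : fps_deriv i (fpsC n c) = 0.
Proof.
apply/fpsP => a; rewrite fps_derivE /=; case: eqP => [/(congr1 (@mdeg n))|_].
  by rewrite mdegD mdeg1 mdeg0 addn1.
by rewrite mulr0.
Qed.

Lemma fps_derivX i j : fps_deriv i (fpsX K j) = (i == j)%:R :> fps K n.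
Proof.
apply/fpsP => a; rewrite fps_derivE /= -fpsC_nat /=.
case: (eqVneq a (mexp0 n)) => [->|a0].
  rewrite mexp0D ffunE mul1r; congr (_%:R); congr nat_of_bool.
  apply/eqP/eqP => [/ffunP/(_ j)|->] //; rewrite !ffunE eqxx.
  by case: eqP => // ->.
case: eqP; rewrite ?mulr0 // => /(congr1 (@mdeg n)); rewrite mdegD !mdeg1 => /eqP.
by rewrite addn1 eqSS mdeg_eq0 (negbTE a0).
Qed.

Lemma fps_deriv_vanish N i p : vanish N.+1 p -> vanish N (fps_deriv i p).
Proof. by move=> pN a aN; rewrite fps_derivE pN ?mulr0 // mdegD mdeg1 addn1. Qed.

Lemma fps_derivCl i (c : K) p : fps_deriv i (fpsC n c * p) = fpsC n c * fps_deriv i p.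
Proof.
by apply/fpsP => a; rewrite fpsCM_coef !fps_derivE fpsCM_coef mulrCA.
Qed.

Lemma fpsXM_coef i p a :
  (fpsX K i * p) a = if (0 < a i)%N then p (mexpB a (mexp1 i)) else 0.
Proof.
rewrite -fps_mono1 fps_monoM_coef; congr (if _ then _ else _).
apply/forallP/idP => [/(_ i)|ai j]; first by rewrite ffunE eqxx.
by rewrite ffunE; case: eqP => // ->.
Qed.

Lemma fps_derivXl i j p :
  fps_deriv i (fpsX K j * p) = (i == j)%:R * p + fpsX K j * fps_deriv i p.
Proof.
apply/fpsP => a; rewrite fpsDE -fpsC_nat fpsCM_coef fps_derivE !fpsXM_coef.
rewrite !ffunE; case: (eqVneq i j) => [<-|ij].
  rewrite addn1 ltn0Sn mul1r mexpDC mexpDK; case: ltnP => [a0|].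
    rewrite fps_derivE !ffunE eqxx subn1 prednK // mulrSr mulrDl mul1r addrC.
    congr (_ + _); congr (_ * fcoef p _); apply/ffunP => l; rewrite !ffunE.
    by case: eqP => [->|_]; rewrite ?subn0 ?addn0 // subn1 addn1 prednK.
  by rewrite leqn0 => /eqP ->; rewrite mul1r addr0.
rewrite addn0 mul0r add0r; case: ifP => [aj|]; last by rewrite mulr0.
rewrite fps_derivE !ffunE (negbTE ij) subn0; congr (_ * fcoef p _).
apply/ffunP => l; rewrite !ffunE; case: (eqVneq l j) => [->|]; last by rewrite !subn0.
by rewrite eq_sym (negbTE ij) !addn0.
Qed.

Lemma fps_derivM i p q :
  fps_deriv i (p * q) = fps_deriv i p * q + p * fps_deriv i q.
Proof.
elim/fps_ind: p q => [c|j|p r IHp IHr|p r IHp IHr|p IHp] q.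
- by rewrite fps_derivCl fps_derivC mul0r add0r.
- by rewrite fps_derivXl fps_derivX.
- by rewrite mulrDl !fps_derivD IHp IHr; ring.
- by rewrite -mulrA !IHp IHr; ring.
apply: vanish_eq => N; have [r [IHr pr]] := IHp N.+1.
have -> : p = (p - r) + r by rewrite subrK.
move: {IHp p}(p - r) pr => p pN; rewrite mulrDl !fps_derivD IHr.
set A := (X in vanish N X).
have -> : A = fps_deriv i (p * q) - fps_deriv i p * q - p * fps_deriv i q.
  by rewrite /A; ring.
apply: vanishB; last by apply: vanishMr; apply: vanishW pN; apply: leqnSn.
apply: vanishB; first exact/fps_deriv_vanish/vanishMr.
exact/vanishMr/fps_deriv_vanish.
Qed.

Lemma fps_deriv0 i : fps_deriv i (0 : fps K n) = 0.
Proof. by rewrite -[X in fps_deriv i X](fpsC0 K n) fps_derivC. Qed.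

Lemma fps_deriv1 i : fps_deriv i (1 : fps K n) = 0.
Proof. exact: fps_derivC. Qed.

Lemma fps_derivXn i p k :
  fps_deriv i (p ^+ k.+1) = k.+1%:R * p ^+ k * fps_deriv i p.
Proof.
elim: k => [|k IH]; first by rewrite expr1 expr0 !mul1r.
by rewrite exprS fps_derivM IH [p ^+ k.+1]exprS -[k.+2]addn1 natrD; ring.
Qed.

Lemma fps_deriv_comm i j p : fps_deriv i (fps_deriv j p) = fps_deriv j (fps_deriv i p).
Proof.
apply/fpsP => a; rewrite !fps_derivE !ffunE.
rewrite -!mexpDA [mexpD (mexp1 i) _]mexpDC.
by case: (eqVneq i j) => [->|ij] //; rewrite !addn0 mulrCA.
Qed.

End Derivation.

Lemma fps_deriv_subst (K : comNzRingType) n k (h : 'I_n -> fps K k) p j :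
  (forall i, h i (mexp0 k) = 0) ->
  fps_deriv j (fps_subst h p) = \sum_i fps_subst h (fps_deriv i p) * fps_deriv j (h i).
Proof.
move=> h0; elim/fps_ind: p => [c|l|p q IHp IHq|p q IHp IHq|p IHp].
- rewrite fps_substC // fps_derivC big1 // => i _.
  by rewrite fps_derivC fps_subst0 // mul0r.
- rewrite fps_substX // (bigD1 l) //= fps_derivX eqxx fps_subst1 // mul1r.
  rewrite big1 ?addr0 // => i il.
  by rewrite fps_derivX (negbTE il) fps_subst0 // mul0r.
- rewrite fps_substD // fps_derivD IHp IHq -big_split; apply: eq_bigr => i _.
  by rewrite fps_derivD fps_substD // mulrDl.
- rewrite fps_substM // fps_derivM IHp IHq mulr_suml mulr_sumr -big_split.
  apply: eq_bigr => i _; rewrite fps_derivM fps_substD // !fps_substM //=; ring.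
apply: vanish_eq => N; have [q [IHq pq]] := IHp N.+1.
have -> : p = (p - q) + q by rewrite subrK.
move: {IHp p}(p - q) pq => p pN; rewrite fps_substD // fps_derivD IHq.
have E i : true -> fps_subst h (fps_deriv i (p + q)) * fps_deriv j (h i) =
    fps_subst h (fps_deriv i p) * fps_deriv j (h i)
    + fps_subst h (fps_deriv i q) * fps_deriv j (h i).
  by rewrite fps_derivD fps_substD // mulrDl.
rewrite (eq_bigr _ E) big_split /= opprD addrACA subrr addr0.
apply: vanishB; first exact/fps_deriv_vanish/fps_subst_vanish.
by apply: vanish_sum => i _; apply/vanishMr/fps_subst_vanish/fps_deriv_vanish.
Qed.

(** * Coefficients of series in one variable *)

Section OneVariable.
Variable K : comNzRingType.
Implicit Types (p q : fps K 1) (c : nat -> K).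

Local Notation w := (fpsX K (ord0 : 'I_1)).
Local Notation D := (fps_deriv (ord0 : 'I_1)).

Lemma mexp_ord1 (a : mexp 1) : a = [ffun=> a ord0].
Proof. by apply/ffunP => i; rewrite ffunE ord1. Qed.

Lemma mdeg_ord1 (a : mexp 1) : mdeg a = a ord0.
Proof. by rewrite /mdeg big_ord1. Qed.

Lemma ucoefE p a : p a = ucoef p (a ord0).
Proof. by rewrite /ucoef -mexp_ord1. Qed.

Lemma ucoef_inj p q : ucoef p =1 ucoef q -> p = q.
Proof. by move=> pq; apply/fpsP => a; rewrite !ucoefE. Qed.

Lemma ucoef_const p : ucoef p 0 = p (mexp0 1).
Proof. by []. Qed.

Lemma vanish_ucoef N p : vanish N p <-> forall k, (k < N)%N -> ucoef p k = 0.
Proof.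
split=> pN a aN; last by rewrite ucoefE pN // -mdeg_ord1.
by apply: pN; rewrite mdeg_ord1 ffunE.
Qed.

Lemma ucoefD p q k : ucoef (p + q) k = ucoef p k + ucoef q k. Proof. by []. Qed.
Lemma ucoefN p k : ucoef (- p) k = - ucoef p k. Proof. by []. Qed.
Lemma ucoefC (c : K) k : ucoef (fpsC 1 c) k = if k == 0%N then c else 0.
Proof.
rewrite /ucoef /=; congr (if _ then _ else _); apply/eqP/eqP => [/ffunP/(_ ord0)|->] //.
by rewrite !ffunE.
Qed.
Lemma ucoefCM (c : K) p k : ucoef (fpsC 1 c * p) k = c * ucoef p k.
Proof. exact: fpsCM_coef. Qed.
Lemma ucoef_sum I (r : seq I) (P : pred I) (F : I -> fps K 1) k :
  ucoef (\sum_(i <- r | P i) F i) k = \sum_(i <- r | P i) ucoef (F i) k.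
Proof. exact: fps_sumE. Qed.

Lemma ucoef_deriv p k : ucoef (D p) k = k.+1%:R * ucoef p k.+1.
Proof.
rewrite {1}/ucoef fps_derivE ucoefE !ffunE; congr (_ * ucoef p _).
by rewrite addn1.
Qed.

Lemma ucoefXM p k : ucoef (w * p) k = if k is j.+1 then ucoef p j else 0.
Proof.
rewrite {1}/ucoef fpsXM_coef ffunE; case: k => [|k] //=.
by rewrite ucoefE !ffunE subn1.
Qed.

Lemma ucoefXnM d p k : ucoef (w ^+ d * p) k = if (d <= k)%N then ucoef p (k - d) else 0.
Proof.
elim: d k => [|d IH] k; first by rewrite expr0 mul1r subn0.
by rewrite exprS -mulrA ucoefXM; case: k => // k; rewrite IH.
Qed.

Lemma ucoefM p q k : ucoef (p * q) k = \sum_(i < k.+1) ucoef p i * ucoef q (k - i).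
Proof.
rewrite /ucoef fpsME.
pose F i : mexp 1 * mexp 1 := ([ffun=> i], [ffun=> (k - i)%N]).
have E : perm_eq (splits ([ffun=> k] : mexp 1)) [seq F (i : 'I_k.+1) | i : 'I_k.+1].
  apply: uniq_perm; first exact: splits_uniq.
    rewrite map_inj_uniq ?enum_uniq // => i j [/ffunP/(_ ord0)].
    by rewrite !ffunE => /val_inj.
  move=> [b d]; rewrite mem_splits /=; apply/eqP/mapP => [bd|[i _ [-> ->]]].
    have bdE : (b ord0 + d ord0)%N = k by move/ffunP/(_ ord0): bd; rewrite !ffunE.
    have bk : (b ord0 < k.+1)%N by rewrite -bdE ltnS leq_addr.
    exists (Ordinal bk); rewrite ?mem_enum // /F /= -bdE addKn.
    by rewrite -!mexp_ord1.
  by apply/ffunP => l; rewrite !ffunE subnKC // -ltnS.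
by rewrite (perm_big _ E) big_map big_enum.
Qed.

Definition useries c : fps K 1 := Fps (fun a => c (a ord0)).

Lemma ucoef_useries c k : ucoef (useries c) k = c k.
Proof. by rewrite /ucoef /= ffunE. Qed.

Lemma deriv_useries c : D (useries c) = useries (fun k => k.+1%:R * c k.+1).
Proof. by apply: ucoef_inj => k; rewrite ucoef_deriv !ucoef_useries. Qed.

Lemma useries_shift c :
  useries c = fpsC 1 (c 0%N) + w * useries (fun k => c k.+1).
Proof.
apply: ucoef_inj => -[|k]; rewrite ucoefD ucoefXM ucoefC !ucoef_useries.
  by rewrite addr0.
by rewrite add0r.
Qed.

(** Functional calculus becomes a substitution, so the chain rule and associativity apply to it. *)
Lemma fps_compE n c (h : fps K n) : fps_comp c h = fps_subst (fun=> h) (useries c).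
Proof.
apply/fpsP => a; rewrite /=; set N := mdeg a.
pose F i : mexp 1 := [ffun=> i].
have E : perm_eq (below ([ffun=> N] : mexp 1)) [seq F (i : 'I_N.+1) | i : 'I_N.+1].
  apply: uniq_perm; first exact: below_uniq.
    rewrite map_inj_uniq ?enum_uniq // => i j /ffunP/(_ ord0).
    by rewrite !ffunE => /val_inj.
  move=> b; rewrite mem_below; apply/forallP/mapP => [bN|[i _ ->] l]; last first.
    by rewrite !ffunE -ltnS.
  have bk : (b ord0 < N.+1)%N by rewrite ltnS; have := bN ord0; rewrite ffunE.
  by exists (Ordinal bk); rewrite ?mem_enum // [LHS]mexp_ord1.
rewrite (perm_big _ E) big_map big_enum /=; apply: eq_bigr => i _.
by rewrite big_ord1 ffunE.
Qed.

End OneVariable.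

(** * Inverse, exponential, logarithm and powers of a series *)

Section Composition.
Variables (K : comNzRingType) (n : nat).
Implicit Types (c d : nat -> K) (h : fps K n).

Lemma eq_fps_comp c d h : c =1 d -> fps_comp c h = fps_comp d h.
Proof. by move=> cd; apply/fpsP => a /=; apply: eq_bigr => i _; rewrite cd. Qed.

Lemma fps_compD c d h : fps_comp (fun k => c k + d k) h = fps_comp c h + fps_comp d h.
Proof.
by apply/fpsP => a /=; rewrite -big_split; apply: eq_bigr => i _; rewrite mulrDl.
Qed.

Lemma fps_compZ b c h : fps_comp (fun k => b * c k) h = fpsC n b * fps_comp c h.
Proof.
apply/fpsP => a; rewrite fpsCM_coef /= mulr_sumr.
by apply: eq_bigr => i _; rewrite mulrA.
Qed.

Lemma fps_comp_shift c h : h (mexp0 n) = 0 ->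
  fps_comp c h = fpsC n (c 0%N) + h * fps_comp (fun k => c k.+1) h.
Proof.
move=> h0; rewrite !fps_compE useries_shift fps_substD // fps_substM // fps_substC //.
by rewrite fps_substX.
Qed.

Lemma fps_comp_const c h : h (mexp0 n) = 0 -> fps_comp c h (mexp0 n) = c 0%N.
Proof. by move=> h0; rewrite fps_compE fps_subst_const //= ffunE. Qed.

Lemma fps_deriv_comp c h j : h (mexp0 n) = 0 ->
  fps_deriv j (fps_comp c h)
  = fps_comp (fun k => k.+1%:R * c k.+1) h * fps_deriv j h.
Proof.
move=> h0; rewrite !fps_compE fps_deriv_subst // big_ord1; congr (fps_subst _ _ * _).
exact: deriv_useries.
Qed.

Lemma fps_subst_comp m c h (u : 'I_n -> fps K m) :
  h (mexp0 n) = 0 -> (forall i, u i (mexp0 m) = 0) ->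
  fps_subst u (fps_comp c h) = fps_comp c (fps_subst u h).
Proof. by move=> h0 u0; rewrite !fps_compE fps_substA. Qed.

End Composition.

Section Functions.
Variables (K : numFieldType) (n : nat).
Implicit Types (p q : fps K n).

(** With [h = 1 - p / p(0)], the definition is the geometric series that inverts [1 - h]. *)
Lemma fps_mulV p : p (mexp0 n) != 0 -> p * fps_inv p = 1.
Proof.
move=> p0; set c := p (mexp0 n); rewrite /fps_inv -/c; set h := 1 - _.
have h0 : h (mexp0 n) = 0.
  by rewrite /h fpsBE fpsCM_coef fps1E eqxx mulVf ?subrr.
have g : (1 - h) * fps_comp (fun=> 1) h = 1.
  by rewrite mulrBl mul1r {1}(fps_comp_shift _ h0) fpsC1 addrK.
rewrite mulrCA mulrA -[RHS]g; congr (_ * _).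
by rewrite /h opprB addrC subrK.
Qed.

Lemma fps_inv_const p : p (mexp0 n) = 1 -> fps_inv p (mexp0 n) = 1.
Proof.
move=> p0; have := @fps_mulV p; rewrite p0 oner_eq0 => /(_ isT).
move/(congr1 (fun q : fps K n => q (mexp0 n))); rewrite fps_const_mul p0 mul1r => ->.
by rewrite fps1E eqxx.
Qed.

Lemma fps_exp_const p : p (mexp0 n) = 0 -> fps_exp p (mexp0 n) = 1.
Proof. by move=> p0; rewrite /fps_exp fps_comp_const // invr1. Qed.

Lemma fps_deriv_exp p j : p (mexp0 n) = 0 ->
  fps_deriv j (fps_exp p) = fps_exp p * fps_deriv j p.
Proof.
move=> p0; rewrite /fps_exp fps_deriv_comp //; congr (_ * _); apply: eq_fps_comp => k.
rewrite factS natrM invfM mulrA mulfV ?mul1r //.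
Qed.

(** The differentiated logarithm series is the alternating geometric series in [p - 1], which is
    inverse to [p]. *)
Lemma fps_deriv_ln p j : p (mexp0 n) = 1 ->
  p * fps_deriv j (fps_ln p) = fps_deriv j p.
Proof.
move=> p1; have p0 : (p - 1) (mexp0 n) = 0 by rewrite fpsBE fps1E p1 eqxx subrr.
rewrite /fps_ln fps_deriv_comp // fps_derivB fps_deriv1 subr0 mulrA.
set q := fps_comp _ _.
have qE : q = fps_comp (fun k => (-1) ^+ k) (p - 1).
  apply: eq_fps_comp => k; rewrite mulrCA mulfV ?mulr1 //.
suff -> : p * q = 1 by rewrite mul1r.
have q1 : q = 1 - (p - 1) * q.
  rewrite {1}qE (fps_comp_shift _ p0) expr0 fpsC1; congr (_ + _).
  rewrite -mulrN qE; congr (_ * _); rewrite -[RHS]mulN1r -fpsC1 -fpsC_opp -fps_compZ.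
  by apply: eq_fps_comp => k; rewrite exprS.
have -> : p * q = (p - 1) * q + q by ring.
by rewrite {2}q1; ring.
Qed.

Lemma fps_pow_const s p : p (mexp0 n) = 1 -> fps_pow s p (mexp0 n) = 1.
Proof.
move=> p1; rewrite /fps_pow fps_comp_const ?big_ord0 ?divr1 //.
by rewrite fpsBE fps1E p1 eqxx subrr.
Qed.

(** The binomial coefficients satisfy [(k+1) c_(k+1) = (s-k) c_k], which is the equation
    [(1+x) y' = s y] read coefficientwise. *)
Lemma fps_deriv_pow s p j : p (mexp0 n) = 1 ->
  p * fps_deriv j (fps_pow s p) = fpsC n s * fps_pow s p * fps_deriv j p.
Proof.
move=> p1; have p0 : (p - 1) (mexp0 n) = 0 by rewrite fpsBE fps1E p1 eqxx subrr.
rewrite /fps_pow fps_deriv_comp // fps_derivB fps_deriv1 subr0 mulrA.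
congr (_ * _); set c := fun k => _ / _; set d := fun k => _ * c _.
have dE k : d k = c k * (s - k%:R).
  rewrite /d /c big_ord_recr /= factS natrM.
  have k0 : k.+1%:R != 0 :> K by rewrite pnatr_eq0.
  have f0 : k`!%:R != 0 :> K by rewrite pnatr_eq0 -lt0n fact_gt0.
  by move: k.+1%:R k0 k`!%:R f0 (\prod_(j < k) _) => x x0 y y0 P; field; rewrite x0 y0.
have -> : p * fps_comp d (p - 1) = fps_comp d (p - 1) + (p - 1) * fps_comp d (p - 1).
  by ring.
rewrite -fps_compZ.
have E : fps_comp d (p - 1)
    = fps_comp (fun k => s * c k) (p - 1) + fps_comp (fun k => - k%:R * c k) (p - 1).
  by rewrite -fps_compD; apply: eq_fps_comp => k; rewrite dE; ring.
rewrite {1}E -addrA -[RHS]addr0; congr (_ + _).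
rewrite (fps_comp_shift (fun k => - k%:R * c k) p0) oppr0 mul0r fpsC0 add0r.
rewrite -mulrDr -!fps_compD -[RHS](mulr0 (p - 1)); congr (_ * _).
apply/fpsP => a /=; rewrite big1 // => k _.
by rewrite /d; ring.
Qed.

End Functions.

(** * Ring morphisms acting on coefficients; later, complex conjugation *)

Section CoefficientMorphism.
Variables (K : comNzRingType) (u : {rmorphism K -> K}) (n : nat).
Implicit Types (p q : fps K n).

Lemma fps_mapD p q : fps_map u (p + q) = fps_map u p + fps_map u q.
Proof. by apply/fpsP => a; rewrite /= rmorphD. Qed.

Lemma fps_mapN p : fps_map u (- p) = - fps_map u p.
Proof. by apply/fpsP => a; rewrite /= rmorphN. Qed.

Lemma fps_mapB p q : fps_map u (p - q) = fps_map u p - fps_map u q.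
Proof. by rewrite fps_mapD fps_mapN. Qed.

Lemma fps_mapC c : fps_map u (fpsC n c) = fpsC n (u c).
Proof. by apply/fpsP => a /=; case: eqP; rewrite ?rmorph0. Qed.

Lemma fps_mapM p q : fps_map u (p * q) = fps_map u p * fps_map u q.
Proof.
apply/fpsP => a; rewrite /= rmorph_sum; apply: eq_bigr => s _.
by rewrite rmorphM.
Qed.

Lemma fps_mapX (i : 'I_n) : fps_map u (fpsX K i) = fpsX K i.
Proof. by apply/fpsP => a; rewrite /= rmorph_nat. Qed.

Lemma fps_mapXn p k : fps_map u (p ^+ k) = fps_map u p ^+ k.
Proof.
elim: k => [|k IH]; first by rewrite !expr0 -fpsC1 fps_mapC rmorph1.
by rewrite !exprS fps_mapM IH.
Qed.

Lemma fps_map_deriv i p : fps_map u (fps_deriv i p) = fps_deriv i (fps_map u p).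
Proof. by apply/fpsP => a; rewrite /= rmorphM rmorph_nat. Qed.

Lemma fps_map_prod I (r : seq I) (F : I -> fps K n) :
  fps_map u (\prod_(i <- r) F i) = \prod_(i <- r) fps_map u (F i).
Proof.
elim: r => [|i r IH]; last by rewrite !big_cons fps_mapM IH.
by rewrite !big_nil -fpsC1 fps_mapC rmorph1.
Qed.

End CoefficientMorphism.

Lemma fps_map_subst (K : comNzRingType) (u : {rmorphism K -> K}) n k
    (h : 'I_n -> fps K k) p :
  fps_map u (fps_subst h p) = fps_subst (fun i => fps_map u (h i)) (fps_map u p).
Proof.
apply/fpsP => a; rewrite /= rmorph_sum; apply: eq_bigr => b _; rewrite rmorphM.
congr (_ * _); rewrite -[u _]/(fps_map u _ a) fps_map_prod.
by congr (fcoef _ a); apply: eq_bigr => i _; rewrite fps_mapXn.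
Qed.

(** * Laurent coefficients *)

Section Laurent.
Variable K : comNzRingType.
Implicit Types (p q : fps K 1).
Local Notation w := (fpsX K (ord0 : 'I_1)).
Local Notation D := (fps_deriv (ord0 : 'I_1)).

Lemma laurentN p (k : int) : k < 0 -> laurent p k = 0.
Proof. by case: k. Qed.

Lemma laurent_nat p (k : nat) : laurent p k = ucoef p k. Proof. by []. Qed.

Lemma laurent_deriv p (k : int) : laurent (D p) k = (k + 1)%:~R * laurent p (k + 1).
Proof.
case: k => [k|k]; first by rewrite laurent_nat ucoef_deriv -PoszD addn1.
have -> : laurent (D p) (Negz k) = 0 by []. by case: k => [|k]; [rewrite mul0r|exact: (esym (mulr0 _))].
Qed.

Lemma laurentXnM p d (k : int) : laurent (w ^+ d * p) k = laurent p (k - d%:Z).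
Proof.
case: k => [k|k]; last by rewrite !laurentN //; lia.
rewrite laurent_nat ucoefXnM; case: leqP => dk; first by rewrite subzn.
by rewrite laurentN //; lia.
Qed.

Lemma laurentD p q k : laurent (p + q) k = laurent p k + laurent q k.
Proof. by case: k => k //=; rewrite addr0. Qed.
Lemma laurentN_ p k : laurent (- p) k = - laurent p k.
Proof. by case: k => k //=; rewrite oppr0. Qed.
Lemma laurentCM c p k : laurent (fpsC 1 c * p) k = c * laurent p k.
Proof. by case: k => k; rewrite /= ?mulr0 // -ucoefCM. Qed.

Lemma laurent_inj p q : laurent p =1 laurent q -> p = q.
Proof. by move=> pq; apply: ucoef_inj => k; apply: (pq (Posz k)). Qed.

End Laurent.

Section Char0.
Variable K : numFieldType.
Local Notation D := (fps_deriv (ord0 : 'I_1)).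

Lemma fps_deriv_eq0 (p : fps K 1) : D p = 0 -> p = fpsC 1 (ucoef p 0).
Proof.
move=> p'; apply: ucoef_inj => -[|k]; rewrite ucoefC //=.
have /eqP : ucoef (D p) k = 0 by rewrite p'.
by rewrite ucoef_deriv mulf_eq0 pnatr_eq0 => /eqP.
Qed.

End Char0.

(* [w^m p'' = (c - m w^(m-1)) p' + b w^(m-2) p] with [m = s + 1]. *)
Definition linear_ode (K : comNzRingType) (s : nat) (b c : K) (p : fps K 1) :=
  let w := fpsX K (ord0 : 'I_1) in
  let D := fps_deriv (ord0 : 'I_1) in
  w ^+ s.+1 * D (D p)
  = (fpsC 1 c - s.+1%:R * w ^+ s) * D p + fpsC 1 b * w ^+ s.-1 * p.

(** * Power series solutions of the linear equation *)

Section LinearOde.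
Variables (K : numFieldType) (s : nat) (b c : K).
Hypotheses (s_gt0 : (0 < s)%N) (c0 : c != 0).
Local Notation w := (fpsX K (ord0 : 'I_1)).
Local Notation D := (fps_deriv (ord0 : 'I_1)).

(** Dividing by [w ^+ s.+1] is a shift of Laurent indices, so the equation becomes one relation
    valid at every integer, without boundary cases. *)
Lemma linear_odeP p : linear_ode s b c p <->
  forall k : int, laurent (D (D p)) k = c * laurent (D p) (k + s.+1%:Z)
    - s.+1%:R * laurent (D p) (k + 1) + b * laurent p (k + 2).
Proof.
have E k : laurent ((fpsC 1 c - s.+1%:R * w ^+ s) * D p + fpsC 1 b * w ^+ s.-1 * p) k
    = c * laurent (D p) k - s.+1%:R * laurent (D p) (k - s%:Z)
      + b * laurent p (k - s.-1%:Z).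
  rewrite laurentD mulrBl laurentD laurentN_ laurentCM -!mulrA laurentCM -fpsC_nat.
  by rewrite laurentCM !laurentXnM.
split=> [/(congr1 (@laurent _)) pE k|pE].
  have := congr1 (fun f => f (k + s.+1%:Z)) pE; rewrite laurentXnM addrK => ->.
  rewrite E; congr (_ - _ * laurent _ _ + _ * laurent _ _); first by lia.
  by lia.
apply: laurent_inj => k; rewrite E laurentXnM pE.
by congr (_ * laurent _ _ - _ * laurent _ _ + _ * laurent _ _); lia.
Qed.

(** This two-term recursion of step [s] gives uniqueness, the support in multiples of [s], and later
    the factorial growth of the coefficients. *)
Lemma linear_ode_rec p (k : nat) : linear_ode s b c p ->
  c * (k + s)%:R * ucoef p (k + s) = (k%:R * (k + s)%:R - b) * ucoef p k.
Proof.
move=> /linear_odeP/(_ (k%:Z - 2)); rewrite !laurent_deriv subrK.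
have -> : k%:Z - 2 + s.+1%:Z + 1 = (k + s)%:Z by lia.
have -> : k%:Z - 2 + 1 + 1 = k%:Z by lia.
rewrite !laurent_nat => E.
have -> : (k%:R * (k + s)%:R - b) * ucoef p k
    = (k%:Z - 2 + 1)%:~R * (k%:~R * ucoef p k) - (b * ucoef p k)
      + s.+1%:R * (k%:~R * ucoef p k).
  rewrite [k%:Z - _ + _](_ : _ = k%:Z - 1); last by lia.
  by rewrite rmorphB /= -!pmulrn natrD -[s.+1]addn1 natrD; ring.
by rewrite E -!pmulrn; ring.
Qed.

Lemma linear_ode_low p k : linear_ode s b c p -> (0 < k < s)%N -> ucoef p k = 0.
Proof.
move=> /linear_odeP/(_ (k%:Z - s%:Z - 2)); rewrite !laurent_deriv => E /andP[k0 ks].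
have := E; rewrite ![laurent p (k%:Z - s%:Z - 2 + _)]laurentN; try lia.
rewrite ![laurent p (k%:Z - s%:Z - 2 + 1 + 1)]laurentN; try lia.
have -> : k%:Z - s%:Z - 2 + s.+1%:Z + 1 = k%:Z by lia.
rewrite laurent_nat !mulr0 subr0 addr0 => /esym/eqP.
rewrite mulf_eq0 (negbTE c0) /= mulf_eq0 intr_eq0 => /orP[|/eqP //].
by move: k0; case: (k).
Qed.

Lemma linear_ode_supp p k : linear_ode s b c p -> ~~ (s %| k)%N -> ucoef p k = 0.
Proof.
move=> pE; elim/ltn_ind: k => k IH sk; have [ks|ks] := ltnP k s.
  by apply: linear_ode_low => //; rewrite ks andbT lt0n; apply: contra sk => /eqP ->.
have IHk : ucoef p (k - s) = 0.
  by apply: IH; [lia|apply: contra sk => sk; rewrite -(subnK ks) dvdn_add].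
have := linear_ode_rec (k - s) pE; rewrite subnK // IHk.
rewrite mulr0 => /eqP; rewrite !mulf_eq0 (negbTE c0) pnatr_eq0 => /orP[|/eqP //].
by rewrite orFb; lia.
Qed.

Lemma linear_ode_uniq p q : linear_ode s b c p -> linear_ode s b c q ->
  ucoef p 0 = ucoef q 0 -> p = q.
Proof.
move=> pE qE pq0; apply: ucoef_inj; elim/ltn_ind=> k IH.
have [ks|ks] := ltnP k s.
  by case: k IH ks => [|k] _ ks //; rewrite !linear_ode_low.
have IHk : ucoef p (k - s) = ucoef q (k - s) by apply: IH; lia.
have := linear_ode_rec (k - s) pE; have := linear_ode_rec (k - s) qE.
rewrite subnK // IHk => <-; apply: mulfI; rewrite mulf_neq0 // pnatr_eq0; lia.
Qed.

End LinearOde.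

(** * The Wronskian of the two solutions and the closed form of the field *)

Section Wronskian.
Variables (K : numFieldType) (s : nat) (b c : K) (p q : fps K 1).
Local Notation w := (fpsX K (ord0 : 'I_1)).
Local Notation D := (fps_deriv (ord0 : 'I_1)).
Hypotheses (pE : linear_ode s b c p) (qE : linear_ode s b (- c) q).
Hypotheses (p0 : ucoef p 0 = 1) (q0 : ucoef q 0 = 1).

Lemma deriv_wXn k : D (w ^+ k.+1) = k.+1%:R * w ^+ k.
Proof. by rewrite fps_derivXn fps_derivX eqxx mulr1. Qed.

(** The equations of [p] and [q] differ in the sign of [c], so [w^(s+1) (q' p - p' q) + c p q] has
    derivative zero; its constant term is [c]. *)
Lemma wronskian :
  w ^+ s.+1 * (D q * p - D p * q) = fpsC 1 c * (1 - p * q).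
Proof.
set W := w ^+ s.+1 * (D q * p - D p * q) + fpsC 1 c * (p * q).
have dW : D W = 0.
  rewrite /W fps_derivD fps_derivCl !fps_derivM fps_derivB !fps_derivM deriv_wXn.
  have -> : w ^+ s.+1 * (D (D q) * p + D q * D p - (D (D p) * q + D p * D q))
      = (w ^+ s.+1 * D (D q)) * p - (w ^+ s.+1 * D (D p)) * q by ring.
  by rewrite pE qE fpsC_opp; ring.
have := fps_deriv_eq0 dW; rewrite /W ucoefD ucoefXnM ltn0 add0r ucoefCM.
rewrite ucoefM big_ord1 subnn p0 q0 !mulr1 => /eqP; rewrite -subr_eq0 => /eqP E.
by apply/eqP; rewrite -subr_eq0; apply/eqP; rewrite -[RHS]E; ring.
Qed.

End Wronskian.

Section Normalization.
Variables (K : numFieldType) (s : nat) (b c : K) (p q : fps K 1).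
Local Notation w := (fpsX K (ord0 : 'I_1)).
Local Notation D := (fps_deriv (ord0 : 'I_1)).
Hypotheses (s_gt0 : (0 < s)%N) (c0 : c != 0).
Hypotheses (pE : linear_ode s b c p) (qE : linear_ode s b (- c) q).
Hypotheses (p0 : ucoef p 0 = 1) (q0 : ucoef q 0 = 1).

Let s0 : s%:R != 0 :> K. Proof. by rewrite pnatr_eq0 -lt0n. Qed.
Let p1 : p (mexp0 1) = 1. Proof. exact: p0. Qed.
Let q1 : q (mexp0 1) = 1. Proof. exact: q0. Qed.
Let u := q * fps_inv p.
Let u1 : u (mexp0 1) = 1.
Proof. by rewrite fps_const_mul q1 fps_inv_const ?mulr1. Qed.
Let y := 1 + fpsC 1 (- s%:R / c) * w ^+ s * fps_ln u.
Let y1 : y (mexp0 1) = 1.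
Proof.
rewrite fpsDE fps1E eqxx -ucoef_const -mulrA ucoefCM ucoefXnM.
by rewrite leqn0 eqn0Ngt s_gt0 mulr0 addr0.
Qed.
Let Y := fps_pow (- s%:R)^-1 y.
Let Y1 : Y (mexp0 1) = 1. Proof. exact: fps_pow_const. Qed.
Let T := w * Y.

(** [Y] is the power of [y] with exponent [-1/s]; the product has derivative zero and constant term
    1. *)
Lemma pow_inverse : Y ^+ s * y = 1.
Proof.
have dY : y * D Y = fpsC 1 (- s%:R)^-1 * Y * D y by exact: fps_deriv_pow.
have d0 : D (Y ^+ s * y) = 0.
  have dYs k : (0 < k)%N -> D (Y ^+ k) = k%:R * Y ^+ k.-1 * D Y.
    by case: k => // k _; rewrite fps_derivXn.
  have Ys : Y ^+ s = Y * Y ^+ s.-1 by rewrite -exprS prednK.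
  rewrite fps_derivM dYs //.
  have -> : s%:R * Y ^+ s.-1 * D Y * y + Y ^+ s * D y
    = s%:R * Y ^+ s.-1 * (y * D Y) + Y ^+ s * D y by ring.
  rewrite dY -fpsC_nat.
  have -> : fpsC 1 s%:R * Y ^+ s.-1 * (fpsC 1 (- s%:R)^-1 * Y * D y)
      = (fpsC 1 s%:R * fpsC 1 (- s%:R)^-1) * (Y * Y ^+ s.-1 * D y) by ring.
  by rewrite -fpsC_mul invrN mulrN mulfV // fpsC_opp fpsC1 Ys; ring.
rewrite (fps_deriv_eq0 d0) ucoef_const fps_const_mul fps_const_exp Y1 y1.
by rewrite expr1n mul1r.
Qed.

(** The operator [y - w y' / s] kills the term [w^s ln u] except for the derivative of the
    logarithm, and [p q (ln u)' = q' p - p' q] is given by the Wronskian. *)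
Let y_ode : (y + fpsC 1 (- s%:R)^-1 * w * D y) * (p * q) = 1.
Proof.
set l := fps_ln u.
have dl : u * D l = D u by exact: fps_deriv_ln.
have pu : p * u = q by rewrite /u mulrCA fps_mulV ?mulr1 // p1 oner_neq0.
have dpu : D p * u + p * D u = D q by rewrite -fps_derivM pu.
have pqdl : p * q * D l = D q * p - D p * q.
  have -> : p * q * D l = p * p * (u * D l) by rewrite -{1}pu; ring.
  rewrite dl -dpu; have -> : p * p * D u = p * (p * D u) by ring.
  by rewrite -[in RHS]pu; ring.
have wr := wronskian pE qE p0 q0.
have -> : D y = fpsC 1 (- s%:R / c) * (s%:R * w ^+ s.-1 * l + w ^+ s * D l).
  rewrite /y fps_derivD fps_deriv1 add0r -mulrA fps_derivCl fps_derivM.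
  by congr (_ * (_ * _ + _)); rewrite -(prednK s_gt0) deriv_wXn.
have ws : w * w ^+ s.-1 = w ^+ s by rewrite -exprS prednK.
have -> : y + fpsC 1 (- s%:R)^-1 * w * (fpsC 1 (- s%:R / c)
      * (s%:R * w ^+ s.-1 * l + w ^+ s * D l))
    = 1 + (fpsC 1 (- s%:R / c) + fpsC 1 (- s%:R)^-1 * fpsC 1 (- s%:R / c) * s%:R)
          * w ^+ s * l
      + (fpsC 1 (- s%:R)^-1 * fpsC 1 (- s%:R / c)) * (w ^+ s.+1 * D l).
  by rewrite /y -/l exprS -{1 3}ws; ring.
rewrite -fpsC_nat -!fpsC_mul -fpsC_additive.
have -> : - s%:R / c + (- s%:R)^-1 * (- s%:R / c) * s%:R = 0.
  by field; rewrite c0 s0.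
have -> : (- s%:R)^-1 * (- s%:R / c) = c^-1 by field; rewrite c0 s0.
rewrite fpsC0 !mul0r addr0 mulrDl mul1r.
have -> : fpsC 1 c^-1 * (w ^+ s.+1 * D l) * (p * q)
    = fpsC 1 c^-1 * (w ^+ s.+1 * (p * q * D l)) by ring.
by rewrite pqdl wr mulrA -fpsC_mul mulVf // fpsC1; ring.
Qed.

(** In other words, the coordinate [T] brings the field [w^m p q d/dw] to the normal form
    [T^m d/dT], where [m = s + 1]. *)
Lemma deriv_tau : D T * (w ^+ s.+1 * (p * q)) = T ^+ s.+1.
Proof.
have dY : y * D Y = fpsC 1 (- s%:R)^-1 * Y * D y by exact: fps_deriv_pow.
rewrite /T fps_derivM fps_derivX eqxx mul1r exprMn [Y ^+ s.+1]exprS.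
have -> : Y * Y ^+ s = Y * Y ^+ s * ((y + fpsC 1 (- s%:R)^-1 * w * D y) * (p * q)).
  by rewrite y_ode mulr1.
have -> : w ^+ s.+1 * (Y * Y ^+ s * ((y + fpsC 1 (- s%:R)^-1 * w * D y) * (p * q)))
    = w ^+ s.+1 * (p * q) * Y ^+ s * (y * Y + w * (fpsC 1 (- s%:R)^-1 * Y * D y)).
  by ring.
rewrite -dY.
have -> : w ^+ s.+1 * (p * q) * Y ^+ s * (y * Y + w * (y * D Y))
    = (Y ^+ s * y) * ((Y + w * D Y) * (w ^+ s.+1 * (p * q))) by ring.
by rewrite pow_inverse mul1r.
Qed.

Lemma deriv_tau_const : D T (mexp0 1) = 1.
Proof.
rewrite -ucoef_const ucoef_deriv mul1r /T -[X in X * _]expr1 ucoefXnM subnn.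
by rewrite ucoef_const.
Qed.

Lemma Lfield_w : T ^+ s.+1 * fps_inv (D T) = w ^+ s.+1 * (p * q).
Proof.
by rewrite -deriv_tau mulrAC fps_mulV ?mul1r // deriv_tau_const oner_neq0.
Qed.

(** The algebra behind [X'/X = - P'/P]: the first hypothesis differentiates [P X = 1], and [Z]
    inverts [X T']. *)
Lemma ratio_identity (A : comPzRingType) (X X' T' Z P P' Q W : A) :
  P' * X + P * X' = 0 -> X * T' * Z = 1 ->
  - (X' * (T' * (W * (P * Q))) * Z) = W * (P' * Q).
Proof.
move=> /eqP; rewrite addr_eq0 => /eqP dX XT.
transitivity (- (P * X') * (T' * Z) * (W * Q)); first by ring.
rewrite -dX; transitivity ((X * T' * Z) * (W * (P' * Q))); first by ring.
by rewrite XT mul1r.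
Qed.

Lemma Lfield_z : - (D (fps_inv p) * T ^+ s.+1 * fps_inv (fps_inv p * D T))
  = w ^+ s.+1 * (D p * q).
Proof.
set X := fps_inv p.
have pX : p * X = 1 by apply: fps_mulV; rewrite p1 oner_neq0.
have X0 : X (mexp0 1) = 1 by apply: fps_inv_const.
have XT : X * D T * fps_inv (X * D T) = 1.
  by apply: fps_mulV; rewrite fps_const_mul X0 mul1r deriv_tau_const oner_neq0.
have dX : D p * X + p * D X = 0 by rewrite -fps_derivM pX fps_deriv1.
rewrite -deriv_tau; exact: ratio_identity dX XT.
Qed.

End Normalization.

(** * The given formal solutions as solutions of the linear equation *)

Section FormalSolutions.
Variables (R : realType) (s : nat) (beta : R).
Hypothesis s_gt0 : (0 < s)%N.
Local Notation C := R[i].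
Local Notation I := ('i%C : R[i]).
Local Notation w := (fpsX C (ord0 : 'I_1)).
Local Notation D := (fps_deriv (ord0 : 'I_1)).
Implicit Types f g : fps C 1.

Lemma I_neq0 : I != 0.
Proof. by apply/eqP => -[] /eqP; rewrite oner_eq0. Qed.

Lemma conjc_I2 : (2 * I)^*%C = - (2 * I).
Proof. by apply/eqP; rewrite eq_complex /=; apply/andP; split; apply/eqP; ring. Qed.

Lemma I2_neq0 : 2 * I != 0.
Proof. by rewrite mulf_neq0 ?pnatr_eq0 // I_neq0. Qed.

Lemma is_f_ode f : is_f s.+1 beta f -> ucoef f 0 = 1 /\ linear_ode s beta%:C%C (2 * I) f.
Proof.
move=> [f0 fE]; split=> //; apply/(linear_odeP _ s_gt0) => [|k]; first by rewrite ?oppr_eq0 I2_neq0.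
have E h : laurent_deriv_exp 0 0 (laurent h) = laurent (D h).
  apply/funext => j; rewrite /laurent_deriv_exp /laurent_mon !mul0r addr0.
  by rewrite laurent_deriv.
have := fE k; rewrite !E /laurent_mon opprK => ->.
by rewrite opprK.
Qed.

(** Conjugation by the exponential factor replaces [d/dw] by [d/dw + 2i w^(-m)]. When the square is
    expanded, the terms of order zero cancel apart from [beta], and the coefficient [2i] of the
    first derivative becomes [-2i]. *)
Lemma is_g_ode g : is_g s.+1 beta g ->
  let q := fps_shift s g in ucoef q 0 = 1 /\ linear_ode s beta%:C%C (- (2 * I)) q.
Proof.
move=> [g0 g1 gE] q; have qE k : ucoef q k = ucoef g (k + s).
  by rewrite /ucoef /= ffunE.
split; first by rewrite qE.
have hE : laurent_mon 1 (1 - s.+1%:Z) (laurent g) = laurent q.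
  apply/funext => k; rewrite /laurent_mon mul1r.
  have -> : k - (1 - s.+1%:Z) = k + s%:Z by lia.
  case: k => k; first by rewrite -PoszD !laurent_nat qE.
  rewrite [RHS]/=; case E : (Negz k + s%:Z) => [j|j] //.
  by rewrite laurent_nat g0 //=; lia.
have c0 : 1 - s.+1%:R != 0 :> C.
  by rewrite -[s.+1]addn1 natrD opprD addrCA subrr addr0 oppr_eq0 pnatr_eq0 -lt0n.
have E h j : laurent_deriv_exp (2 * I / (1 - s.+1%:R)) (1 - s.+1%:Z) h j
    = (j + 1)%:~R * h (j + 1) + 2 * I * h (j + s.+1%:Z).
  rewrite /laurent_deriv_exp /laurent_mon rmorphB /= -pmulrn mulfVK //.
  by congr (_ + _ * h _); lia.
apply/(linear_odeP _ s_gt0) => [|k]; first by rewrite ?oppr_eq0 I2_neq0.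
have := gE k; rewrite hE {1}E ![laurent_deriv_exp _ _ _ _]E.
rewrite /laurent_mon opprK !E !laurent_deriv => H.
have e1 : k + 1 + s.+1%:Z = k + s.+1%:Z + 1 by lia.
have e2 : k - - s.+1%:Z = k + s.+1%:Z by lia.
have e3 : k - -1 = k + 1 by lia.
have e4 : k - -2 = k + 2 by lia.
have e5 : k + 1 + 1 = k + 2 by lia.
have e6 : (k + 1)%:~R = (k + s.+1%:Z + 1)%:~R - s.+1%:R :> C.
  have -> : k + 1 = (k + s.+1%:Z + 1) - s.+1%:Z by lia.
  by rewrite rmorphB.
rewrite ?e1 ?e2 ?e3 ?e4 ?e5 in H *.
move: H; rewrite e6.
set x := (k + s.+1%:Z + 1)%:~R; set L1 := laurent q (k + s.+1%:Z + 1).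
set L2 := laurent q (k + s.+1%:Z + s.+1%:Z); set L3 := laurent q (k + 2).
set z := (k + 2)%:~R; move=> H.
apply/eqP; rewrite -subr_eq0; move/eqP: H; rewrite -subr_eq0 => /eqP H.
by apply/eqP; rewrite -[RHS]H; ring.
Qed.

Lemma linear_ode_conj f : linear_ode s beta%:C%C (2 * I) f ->
  linear_ode s beta%:C%C (- (2 * I)) (fps_map (@conjc R) f).
Proof.
move=> /(congr1 (fps_map (@conjc R))); rewrite /linear_ode.
rewrite fps_mapM !fps_mapXn fps_mapX !fps_map_deriv => ->.
rewrite fps_mapD !fps_mapM fps_mapB fps_mapM !fps_mapXn fps_mapX fps_map_deriv.
rewrite !fps_mapC -!fpsC_nat fps_mapC rmorph_nat.
congr ((fpsC 1 _ - _) * _ + fpsC 1 _ * _ * _).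
  exact: conjc_I2.
exact: conjc_real.
Qed.

(** As [beta] is real, conjugating the equation of [f] only flips the sign of [2i]; both series then
    solve one equation with constant term 1. *)
Lemma is_g_conj f g : is_f s.+1 beta f -> is_g s.+1 beta g ->
  fps_shift s g = fps_map (@conjc R) f.
Proof.
move=> /is_f_ode[f0 fE] /is_g_ode[q0 qE].
have c0 : - (2 * I) != 0 by rewrite oppr_eq0 I2_neq0.
apply: (linear_ode_uniq s_gt0 c0 qE (linear_ode_conj fE)).
by rewrite q0 /ucoef /= -/(ucoef f 0) f0 conjc1.
Qed.

Definition Ufield f : fps C 1 := w ^+ s.+1 * (D f * fps_map (@conjc R) f).
Definition Vfield f : fps C 1 := w ^+ s.+1 * (f * fps_map (@conjc R) f).

(** The logarithm and the root disappear from the field: what remains is polynomial in [w], [f],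
    [f'] and the conjugate of [f]. *)
Lemma LfieldE f g : is_f s.+1 beta f -> is_g s.+1 beta g ->
  Lfield s.+1 f g =
  pair_of (fps_subst (fun=> fpsX C (lift ord0 ord0 : 'I_2)) (Ufield f) * fpsX C ord0)
          (fps_subst (fun=> fpsX C (lift ord0 ord0 : 'I_2)) (Vfield f)).
Proof.
move=> hf hg; have [f0 fE] := is_f_ode hf; have [q0 qE] := is_g_ode hg.
have s0 : s%:R != 0 :> C by rewrite pnatr_eq0 -lt0n.
rewrite /Lfield /tau /chi; have -> : s.+1.-1 = s by [].
have m1 : 1 - s.+1%:R = - s%:R :> C by rewrite -[s.+1]addn1 natrD; ring.
rewrite m1 (is_g_conj hf hg) in q0 qE *.
pose pf (a b : fps C 1) : formal_field R 2 :=
  pair_of (fps_subst (fun=> fpsX C (lift ord0 ord0 : 'I_2)) a * fpsX C ord0)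
          (fps_subst (fun=> fpsX C (lift ord0 ord0 : 'I_2)) b).
apply: (congr2 pf).
  exact: (Lfield_z s_gt0 I2_neq0 fE qE f0 q0).
exact: (Lfield_w s_gt0 I2_neq0 fE qE f0 q0).
Qed.

End FormalSolutions.

(* [X = Y] as soon as [X - Y] is a combination of expressions known to vanish. *)
Lemma eq_by_sub (A : zmodType) (x y t : A) : t = 0 -> x - y = t -> x = y.
Proof. by move=> -> /eqP; rewrite subr_eq0 => /eqP. Qed.

(** * Determining equations of a point symmetry of the linear equation *)

Section SymmetryConditions.
Variables (K : numFieldType) (s : nat) (b c : K) (p q : fps K 1).
Local Notation w := (fpsX K (ord0 : 'I_1)).
Local Notation D := (fps_deriv (ord0 : 'I_1)).
Hypothesis s_gt0 : (0 < s)%N.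
Hypotheses (pE : linear_ode s b c p) (qE : linear_ode s b (- c) q).
Hypotheses (p0 : ucoef p 0 = 1) (q0 : ucoef q 0 = 1).

(** As [s] is symbolic, all powers are expressed through [B], subject to [w ^+ s = w * B] and
    [w B' = (s-1) B]; the identities below are then within reach of [ring]. *)
Let B := w ^+ s.-1.
Let nn : fps K 1 := s.-1%:R.

Let ws : w ^+ s = w * B. Proof. by rewrite -exprS prednK. Qed.
Let wm : w ^+ s.+1 = w * (w * B). Proof. by rewrite exprS ws. Qed.
Let sE : s%:R = nn + 1 :> fps K 1.
Proof. by rewrite -{1}(prednK s_gt0) -[s.-1.+1]addn1 natrD. Qed.
Let mE : s.+1%:R = nn + 2 :> fps K 1.
Proof. by rewrite -[s.+1]addn1 natrD sE; ring. Qed.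
Let dw : D w = 1. Proof. by rewrite fps_derivX eqxx. Qed.
Let dB : w * D B = nn * B.
Proof.
rewrite /B /nn; case: s.-1 => [|k]; last by rewrite deriv_wXn exprS; ring.
by rewrite expr0 fps_deriv1 mulr0 mul0r.
Qed.

Let p_ode : w * (w * B) * D (D p)
  - ((fpsC 1 c - (nn + 2) * (w * B)) * D p + fpsC 1 b * B * p) = 0.
Proof. by apply/eqP; rewrite subr_eq0 -wm -ws -mE; apply/eqP. Qed.
Let q_ode : w * (w * B) * D (D q)
  - ((- fpsC 1 c - (nn + 2) * (w * B)) * D q + fpsC 1 b * B * q) = 0.
Proof. by apply/eqP; rewrite subr_eq0 -wm -ws -mE -fpsC_opp; apply/eqP. Qed.

Definition symU := w ^+ s.+1 * (D p * q).
Definition symV := w ^+ s.+1 * (p * q).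

Let symU_B : symU = w * (w * B) * (D p * q). Proof. by rewrite /symU wm. Qed.
Let symV_B : symV = w * (w * B) * (p * q). Proof. by rewrite /symV wm. Qed.

Let dwm : D (w * (w * B)) = (nn + 2) * (w * B).
Proof. by rewrite -wm deriv_wXn ws mE. Qed.

Lemma symU_deriv : D symU
  = fpsC 1 c * (D p * q) + fpsC 1 b * B * (p * q) + w * (w * B) * (D p * D q).
Proof.
rewrite symU_B fps_derivM dwm fps_derivM; apply: (eq_by_sub (t := q * 0)).
  by rewrite mulr0.
by rewrite -p_ode; ring.
Qed.

Lemma symV_deriv : D symV
  = (nn + 2) * (w * B) * (p * q) + w * (w * B) * (D p * q + p * D q).
Proof. by rewrite symV_B fps_derivM dwm fps_derivM. Qed.

(** For [z'' = A z' + b z / w^2] with [A = c / w^m - m / w], the field [z U d/dz + V d/dw] is a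
    symmetry when [U'' = A U' + 2 b V' / w^2 - 2 b V / w^3] and [2 U' = V'' + (A V)']. This is the
    first condition times [w^(m+1)]; it follows from the equations of [p] and [q]. *)
Lemma symmetry_b :
  w * (w * (w * B)) * D (D symU)
  = 2 * fpsC 1 b * (w * B) * D symV - 2 * fpsC 1 b * B * symV
    + (fpsC 1 c * w - (nn + 2) * (w * (w * B))) * D symU.
Proof.
rewrite symU_deriv symV_deriv symV_B.
rewrite !fps_derivD !fps_derivM !fps_derivC !mul0r !add0r dw.
set P := p_ode; set S := q_ode; have dB0 : w * D B - nn * B = 0 by rewrite dB subrr.
apply: (eq_by_sub (t := w * (fpsC 1 c * q + w * (w * B) * D q) * 0
   + w * (w * (w * B)) * D p * 0 
   + (fpsC 1 b * (w * (w * B)) * (p * q) + w * (w * (w * (w * B))) * (D p * D q)) * 0)).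
  by rewrite !mulr0 !addr0.
by rewrite -{1}p_ode -{1}q_ode -dB0; ring.
Qed.

(** The condition [2 U' = V'' + (A V)'] times [w^(m+1)]. Here the linear equations enter through
    their Wronskian. *)
Lemma symmetry_a :
  2 * (w * (w * (w * B))) * D symU
  = w * (w * (w * B)) * D (D symV)
    + (fpsC 1 c * w - (nn + 2) * (w * (w * B))) * D symV
    - (nn + 2) * (fpsC 1 c - w * B) * symV.
Proof.
(* [X = 0] is the Wronskian identity multiplied by [w^m] and written in [symU] and [symV]; the claim
   is a combination of [X], [w X'] and the relation for [B']. *)
pose X := w * (w * B) * D symV + fpsC 1 c * symV - (nn + 2) * (w * B) * symV
  - 2 * (w * (w * B)) * symU - fpsC 1 c * (w * (w * B)).
have wr := wronskian pE qE p0 q0.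
have wr0 : w * (w * B) * (D q * p - D p * q) - fpsC 1 c * (1 - p * q) = 0.
  by apply/eqP; rewrite subr_eq0 -wm wr.
have X0 : X = 0.
  apply: (eq_by_sub (t := w * (w * B) * 0)); first by rewrite mulr0.
  by rewrite subr0 /X symV_deriv symV_B symU_B -wr0; ring.
have dn : D nn = 0 by rewrite /nn -fpsC_nat fps_derivC.
rewrite {}/X in X0; move: symV symU nn dn dB X0 => V U n' dn dB' X0.
have := congr1 D X0.
rewrite !(fps_derivB, fps_derivD, fps_derivM, fps_derivC, fps_deriv1, fps_deriv0) dw dn.
move=> dX; apply: (eq_by_sub (t := (n' + 2) * 0 - w * 0
    + (w * w * D V - (n' + 2) * w * V - 2 * (w * w) * U
       - fpsC 1 c * (w * w)) * (w * D B - n' * B))).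
  by rewrite dB'; ring.
by rewrite -{1}X0 -dX; ring.
Qed.

End SymmetryConditions.

(** * The inverse equation and its linearization *)

Section Linearization.
Variables (K : numFieldType) (n s : nat) (b c : K) (j : 'I_n) (Q : fps K n).
Hypotheses (s_gt0 : (0 < s)%N) (Q0 : Q (mexp0 n) = 0).
Local Notation z := (fpsX K j).
Local Notation D := (fps_deriv j).
Implicit Types (x y : fps K n).

Let A := Q ^+ s.-1.
Let nn : fps K n := s.-1%:R.
Let p := D Q.
Let r := D p.
Let cc := fpsC n c.
Let bb := fpsC n b.

(* The equation [w^m w'' + (c - m w^(m-1)) w'^2 + b w^(m-2) w'^3 z = 0], inverse
   to [linear_ode]. *)
Definition inverse_ode :=
  Q * (Q * A) * r + (cc - (nn + 2) * (Q * A)) * p ^+ 2 + bb * A * p ^+ 3 * z = 0.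

(* [Q] times the linearization of [inverse_ode] at [Q]. *)
Definition linearized x :=
  Q * (Q * (Q * A)) * D (D x) + (nn + 2) * (Q * (Q * A)) * r * x
  + 2 * (cc - (nn + 2) * (Q * A)) * Q * p * D x
  - (nn + 2) * (nn + 1) * (Q * A) * p ^+ 2 * x
  + bb * (nn * A * p ^+ 3 * z * x + 3 * (Q * A) * p ^+ 2 * z * D x).

Hypothesis QE : inverse_ode.

Let dn k : fps_deriv k nn = 0.
Proof. by rewrite /nn -fpsC_nat fps_derivC. Qed.

Let dA k : Q * fps_deriv k A = nn * A * fps_deriv k Q.
Proof.
rewrite /A /nn; case: s.-1 => [|l]; last by rewrite fps_derivXn exprS; ring.
by rewrite expr0 fps_deriv1; ring.
Qed.

(** Differentiate the equation along variable [k] and multiply by [Q], which turns the derivative of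
    the power [A] into [(s-1) A] times that of [Q]. The extra term for [k = j] comes from the
    explicit occurrence of [z]. *)
Lemma linearized_deriv k :
  linearized (fps_deriv k Q) + bb * (Q * A) * p ^+ 3 * (k == j)%:R = 0.
Proof.
have pk : fps_deriv k p = D (fps_deriv k Q) by rewrite /p fps_deriv_comm.
have rk : fps_deriv k r = D (D (fps_deriv k Q)) by rewrite /r fps_deriv_comm pk.
have := congr1 (fps_deriv k) QE; rewrite /linearized.
have dAk := dA k.
rewrite !(fps_derivB, fps_derivD, fps_derivM, fps_derivXn, fps_derivC, fps_deriv1).
rewrite dn fps_derivX fps_deriv0 pk rk; move: dAk; set q := fps_deriv k Q => dAk.
set T := (X in X = 0) => T0.
apply: (eq_by_sub (t := Q * T - (r * Q * Q - (nn + 2) * Q * p ^+ 2 + bb * p ^+ 3 * z)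
    * (Q * fps_deriv k A - nn * A * q))).
  by rewrite T0 dAk; ring.
by rewrite /T; ring.
Qed.

Lemma linearizedB x y : linearized (x - y) = linearized x - linearized y.
Proof. by rewrite /linearized !fps_derivB; ring. Qed.

Lemma linearizedM y x : D y = 0 -> linearized (y * x) = y * linearized x.
Proof.
move=> y0; have y1 : D (y * x) = y * D x by rewrite fps_derivM y0 mul0r add0r.
by rewrite /linearized y1 fps_derivM y0; ring.
Qed.

Section Symmetry.
Local Notation w := (fpsX K (ord0 : 'I_1)).
Local Notation D1 := (fps_deriv (ord0 : 'I_1)).
Variables U V : fps K 1.
Let B := w ^+ s.-1.
Let n1 : fps K 1 := s.-1%:R.
Hypothesis Ha : 2 * (w * (w * (w * B))) * D1 U
  = w * (w * (w * B)) * D1 (D1 V)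
    + (fpsC 1 c * w - (n1 + 2) * (w * (w * B))) * D1 V
    - (n1 + 2) * (fpsC 1 c - w * B) * V.
Hypothesis Hb : w * (w * (w * B)) * D1 (D1 U)
  = 2 * fpsC 1 b * (w * B) * D1 V - 2 * fpsC 1 b * B * V
    + (fpsC 1 c * w - (n1 + 2) * (w * (w * B))) * D1 U.

Let phi := fps_subst (fun _ : 'I_1 => Q).
Let phiM (x y : fps K 1) : phi (x * y) = phi x * phi y. Proof. exact: fps_substM. Qed.
Let phiD (x y : fps K 1) : phi (x + y) = phi x + phi y. Proof. exact: fps_substD. Qed.
Let phiB (x y : fps K 1) : phi (x - y) = phi x - phi y. Proof. exact: fps_substB. Qed.
Let phiN (x : fps K 1) : phi (- x) = - phi x. Proof. exact: fps_substN. Qed.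
Let phiC a : phi (fpsC 1 a) = fpsC n a. Proof. exact: fps_substC. Qed.
Let phin k : phi k%:R = k%:R. Proof. by rewrite -!fpsC_nat phiC. Qed.
Let phiw : phi w = Q. Proof. exact: fps_substX. Qed.
Let phiA : phi B = A. Proof. by rewrite /phi fps_substXn // fps_substX. Qed.
Let phin1 : phi n1 = nn. Proof. exact: phin. Qed.
Let dphi (x : fps K 1) : D (phi x) = phi (D1 x) * p.
Proof. by rewrite /phi fps_deriv_subst // big_ord1. Qed.

(** The argument is the characteristic of the field [z U d/dz + V d/dw] along the solution [Q];
    symmetries map solutions to solutions, so it is an infinitesimal variation of [Q]. *)
Lemma linearized_symmetry : linearized (phi V - z * phi U * p) = 0.
Proof.
have := congr1 phi Ha; have := congr1 phi Hb.
rewrite !(phiB, phiD, phiN, phiM, phiC, phin, phiw, phiA, phin1).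
have dz : D z = 1 by rewrite fps_derivX eqxx.
have L := linearized_deriv j; rewrite eqxx mulr1 -/p in L.
have := QE; rewrite /inverse_ode.
have e1 : D (phi V - z * phi U * p)
    = phi (D1 V) * p - phi U * p - z * phi (D1 U) * p * p - z * phi U * r.
  by rewrite fps_derivB !fps_derivM !dphi dz -/r; ring.
have e2 : D (D (phi V - z * phi U * p))
    = phi (D1 (D1 V)) * p ^+ 2 + phi (D1 V) * r - 2 * phi (D1 U) * p ^+ 2
      - 2 * phi U * r - z * phi (D1 (D1 U)) * p ^+ 3
      - 3 * z * phi (D1 U) * p * r - z * phi U * D r.
  rewrite e1 !(fps_derivB, fps_derivM) !dphi dz -/r; ring.
rewrite /linearized e2 e1; move: L; rewrite /linearized -/r.
move: (phi (D1 (D1 V))) (phi (D1 (D1 U))) (phi (D1 V)) (phi (D1 U)) (phi V) (phi U).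
move: (D r) => r3 V2 U2 V1 U1 V0 U0.
set T1 := (X in X = 0) => T10; set T2 := (X in X = 0) => T20.
move=> H1 H2.
(* Multiples of the equation [T2] and of its [z]-derivative [T1] remove the second and third
   derivatives of [Q]; the two determining equations account for the rest. *)
apply: (eq_by_sub (t := (Q * V1 - 2 * Q * U0 - 3 * z * Q * U1 * p + (nn + 2) * V0) * T2
  - z * U0 * T1)).
  by rewrite T10 T20; ring.
rewrite /T1 /T2; move: H1 H2 => /eqP; rewrite -subr_eq0 => /eqP H1 /eqP.
rewrite -subr_eq0 => /eqP H2; apply/eqP; rewrite -subr_eq0; apply/eqP.
move: H1 H2; set T3 := (X in X = 0) => T30; set T4 := (X in X = 0) => T40.
apply: (eq_by_sub (t := - p ^+ 2 * T4 - z * p ^+ 3 * T3)).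
  by rewrite T30 T40; ring.
by rewrite /T3 /T4 -/cc -/bb; ring.
Qed.
End Symmetry.

End Linearization.

(** * Orders in one variable, uniqueness for the linearized equation, division by a graph
    equation *)

Section OneDirection.
Variables (K : numFieldType) (n : nat) (j : 'I_n).
Implicit Types (x y : fps K n).
Local Notation z := (fpsX K j).
Local Notation D := (fps_deriv j).

Definition zvanish N x := forall a : mexp n, (a j < N)%N -> x a = 0.

Lemma zvanishD N x y : zvanish N x -> zvanish N y -> zvanish N (x + y).
Proof. by move=> xN yN a aN; rewrite fpsDE xN ?yN ?addr0. Qed.

Lemma zvanishN N x : zvanish N x -> zvanish N (- x).
Proof. by move=> xN a aN; rewrite fpsNE xN ?oppr0. Qed.

Lemma zvanishM N x y : zvanish N x -> zvanish N (y * x).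
Proof.
move=> xN a aN; rewrite fpsME big_seq big1 // => -[b d]; rewrite mem_splits /=.
move=> /eqP bd; rewrite xN ?mulr0 //; move: aN; rewrite -bd ffunE; lia.
Qed.

Lemma zvanishW N M x : (M <= N)%N -> zvanish N x -> zvanish M x.
Proof. by move=> MN xN a aM; apply/xN/(leq_trans aM). Qed.

Lemma zvanish_deriv N x : zvanish N.+1 x -> zvanish N (D x).
Proof.
by move=> xN a aN; rewrite fps_derivE xN ?mulr0 // !ffunE eqxx addn1.
Qed.

Lemma zvanish_primitive N x : zvanish 1 x -> zvanish N (D x) -> zvanish N.+1 x.
Proof.
move=> x1 xN a aN; have [a0|a0] := posnP (a j); first by rewrite x1 ?a0.
have aE : mexpD (mexpB a (mexp1 j)) (mexp1 j) = a.
  by apply/ffunP => i; rewrite !ffunE; case: eqP => [->|_]; rewrite ?subnK // subn0 addn0.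
have : D x (mexpB a (mexp1 j)) = 0 by apply: xN; rewrite !ffunE eqxx; lia.
rewrite fps_derivE aE => /eqP; rewrite mulf_eq0 pnatr_eq0 => /orP[//|/eqP //].
Qed.

Lemma zvanish_cancelX N k x : k != j -> zvanish N (fpsX K k * x) -> zvanish N x.
Proof.
move=> kj xN a aN; have := xN (mexpD a (mexp1 k)).
rewrite fpsXM_coef !ffunE eqxx addn1 /= mexpDC mexpDK => -> //.
by move: kj; rewrite eq_sym => /negbTE ->; rewrite addn0.
Qed.

Lemma zvanish_cancelXn N k l x : k != j -> zvanish N (fpsX K k ^+ l * x) -> zvanish N x.
Proof.
move=> kj; elim: l => [|l IH]; first by rewrite expr0 mul1r.
by rewrite exprS -mulrA => /(zvanish_cancelX kj).
Qed.

Lemma zvanish_cancel_unit N e e' x : e * e' = 1 -> zvanish N (e * x) -> zvanish N x.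
Proof. by move=> ee /(@zvanishM _ _ e'); rewrite mulrA [e' * e]mulrC ee mul1r. Qed.

Lemma zvanish_eq0 x : (forall N, zvanish N x) -> x = 0.
Proof. by move=> xN; apply/fpsP => a; apply: (xN (a j).+1). Qed.

(** The leading coefficient [Q^(s+2)] is a unit times a power of a variable other than [z], so it
    does not affect divisibility by powers of [z]. If [z^(N+2)] divides [x], the lower terms of the
    equation are divisible by [z^(N+1)], hence so is [x''], and two integrations improve the order
    of [x]. *)
Lemma linearized_uniq s b c Q k e x :
  k != j -> Q = fpsX K k * e -> e (mexp0 n) = 1 ->
  linearized s b c j Q x = 0 -> zvanish 2 x -> x = 0.
Proof.
move=> kj QE e1 xE x2.
have ee : e * fps_inv e = 1 by rewrite fps_mulV // e1 oner_neq0.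
suff xN N : zvanish N.+2 x.
  by apply: zvanish_eq0 => N; apply: (zvanishW _ (xN N)); lia.
elim: N => // N IH; apply: zvanish_primitive; first by apply: (zvanishW _ IH); lia.
apply: zvanish_primitive.
  by apply: (@zvanishW N.+1) => //; apply: zvanish_deriv.
have x0 : zvanish N.+1 x by apply: (zvanishW _ IH); lia.
have x1 : zvanish N.+1 (D x) by apply: zvanish_deriv.
apply: (@zvanish_cancelXn _ k (3 + s.-1) _ kj).
apply: (@zvanish_cancel_unit _ (e ^+ (3 + s.-1)) (fps_inv e ^+ (3 + s.-1))).
  by rewrite -exprMn ee expr1n.
have -> : e ^+ (3 + s.-1) * (fpsX K k ^+ (3 + s.-1) * D (D x))
    = Q * (Q * (Q * Q ^+ s.-1)) * D (D x).
  by rewrite mulrA -exprMn [e * _]mulrC -QE exprD; ring.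
move: xE; rewrite /linearized; set p := D Q; set A := Q ^+ s.-1.
set T := (X in X = 0) => T0.
have -> : Q * (Q * (Q * A)) * D (D x) = T + - (
  ((s.-1%:R + 2) * (Q * (Q * A)) * D p
   - (s.-1%:R + 2) * (s.-1%:R + 1) * (Q * A) * p ^+ 2
   + fpsC n b * (s.-1%:R * A * p ^+ 3 * z)) * x
  + (2 * (fpsC n c - (s.-1%:R + 2) * (Q * A)) * Q * p
   + fpsC n b * (3 * (Q * A) * p ^+ 2 * z)) * D x).
  by rewrite /T; ring.
by rewrite T0 add0r; apply/zvanishN/zvanishD; apply: zvanishM.
Qed.

Lemma fps_subst_free k (u : 'I_n -> fps K k) (v : 'I_n -> fps K k) x :
  (forall i, i != j -> u i = v i) -> D x = 0 -> fps_subst u x = fps_subst v x.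
Proof.
move=> uv dx; apply/fpsP => a; apply: eq_bigr => b _.
have [b0|b0] := posnP (b j).
  congr (_ * fcoef _ a); apply: eq_bigr => i _; case: (eqVneq i j) => [->|/uv -> //].
  by rewrite b0 !expr0.
suff -> : x b = 0 by rewrite !mul0r.
have bE : mexpD (mexpB b (mexp1 j)) (mexp1 j) = b.
  by apply/ffunP => i; rewrite !ffunE; case: eqP => [->|_]; rewrite ?subnK // subn0 addn0.
have /eqP : D x (mexpB b (mexp1 j)) = 0 by rewrite dx.
by rewrite fps_derivE bE mulf_eq0 pnatr_eq0 => /eqP.
Qed.

Lemma fps_divX x : exists x0 q, [/\ x = x0 + z * q, D x0 = 0 &
  forall a : mexp n, a j = 0%N -> x0 a = x a].
Proof.
exists (Fps (fun a => if a j == 0%N then x a else 0)).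
exists (Fps (fun a => x (mexpD a (mexp1 j)))); split.
- apply/fpsP => a; rewrite fpsDE fpsXM_coef /=; have [a0|a0] := posnP (a j).
    by rewrite addr0.
  rewrite add0r; congr (fcoef x _); apply/ffunP => i; rewrite !ffunE.
  by case: eqP => [->|_]; rewrite ?subnK // subn0 addn0.
- by apply/fpsP => a; rewrite fps_derivE /= !ffunE eqxx addn1 mulr0.
by move=> a /= ->.
Qed.

Definition at0 (i : 'I_n) : fps K n := if i == j then 0 else fpsX K i.

Lemma at0_const i : at0 i (mexp0 n) = 0.
Proof. by rewrite /at0; case: ifP => // _; rewrite fpsX_const. Qed.

Lemma zvanish_at0 x : fps_subst at0 x = 0 -> zvanish 1 x.
Proof.
have [x0 [q [-> dx0 x0E]]] := fps_divX x.
rewrite fps_substD ?fps_substM ?fps_substX; try exact: at0_const.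
have {1}-> : at0 j = 0 by rewrite /at0 eqxx.
rewrite mul0r addr0.
rewrite (@fps_subst_free _ _ (fun i => fpsX K i)) // => [|i ij]; last first.
  by rewrite /at0 (negbTE ij).
rewrite fps_subst_id => -> a; rewrite ltnS leqn0 => /eqP a0.
by rewrite add0r fpsXM_coef a0.
Qed.

Lemma zvanish2_at0 x : fps_subst at0 x = 0 -> fps_subst at0 (D x) = 0 -> zvanish 2 x.
Proof. by move=> /zvanish_at0 x0 /zvanish_at0 x1; apply: zvanish_primitive. Qed.

Lemma fps_deriv_at0 k x : k != j ->
  fps_deriv k (fps_subst at0 x) = fps_subst at0 (fps_deriv k x).
Proof.
move=> kj; rewrite fps_deriv_subst; last exact: at0_const.
rewrite (bigD1 k) //= big1 => [|i ik]; rewrite /at0.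
  by rewrite (negbTE kj) fps_derivX eqxx mulr1 addr0.
case: ifP => _; first by rewrite fps_deriv0 mulr0.
by rewrite fps_derivX eq_sym (negbTE ik) mulr0.
Qed.

Section Division.
Variable Q : fps K n.
Hypotheses (Q0 : Q (mexp0 n) = 0) (dQ : D Q = 0).

Definition graph (i : 'I_n) : fps K n := if i == j then Q else fpsX K i.

Lemma graph_const i : graph i (mexp0 n) = 0.
Proof. by rewrite /graph; case: ifP => // _; rewrite fpsX_const. Qed.

Lemma graph_free x : D x = 0 -> fps_subst graph x = x.
Proof.
move=> dx; rewrite (@fps_subst_free _ _ (fun i => fpsX K i)) ?fps_subst_id // => i ij.
by rewrite /graph (negbTE ij).
Qed.

Let shift (t : fps K n) (i : 'I_n) : fps K n := if i == j then fpsX K i + t else fpsX K i.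
Let shift_const (t : fps K n) i : t (mexp0 n) = 0 -> shift t i (mexp0 n) = 0.
Proof. by move=> t0; rewrite /shift; case: ifP; rewrite ?fpsDE ?t0 fpsX_const ?addr0. Qed.
Let shift_free (t : fps K n) x : t (mexp0 n) = 0 -> D x = 0 -> fps_subst (shift t) x = x.
Proof.
move=> t0 dx; rewrite (@fps_subst_free _ _ (fun i => fpsX K i)) ?fps_subst_id // => i ij.
by rewrite /shift (negbTE ij).
Qed.

(** The translation that adds [Q] to variable [j] carries the coordinate hyperplane to the graph; on
    the hyperplane divisibility is read off the exponents. *)
Lemma fps_divisible x : fps_subst graph x = 0 <-> exists q, x = q * (z - Q).
Proof.
split=> [x0|[q ->]]; last first.
  rewrite fps_substM ?fps_substB ?fps_substX; try exact: graph_const.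
  by rewrite (graph_free dQ) {2}/graph eqxx subrr mulr0.
have NQ0 : (- Q) (mexp0 n) = 0 by rewrite fpsNE Q0 oppr0.
pose x' := fps_subst (shift Q) x.
have [y [q [x'E dy yE]]] := fps_divX x'.
have y0 : y = 0.
  have : fps_subst at0 x' = 0.
    rewrite /x' fps_substA; [|by move=> i; apply: shift_const|exact: at0_const].
    rewrite -[RHS]x0; apply: eq_fps_subst => i; rewrite /shift /graph.
    case: ifP => [/eqP ->|ij]; last first.
      by rewrite fps_substX ?/at0 ?ij //; apply: at0_const.
    rewrite fps_substD ?fps_substX; try exact: at0_const.
    rewrite {1}/at0 eqxx add0r (@fps_subst_free _ _ (fun i => fpsX K i)) ?fps_subst_id //.
    by move=> l lj; rewrite /at0 (negbTE lj).
  move=> /zvanish_at0 v; apply/fpsP => a; have [a0|a0] := posnP (a j).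
    by rewrite yE // v // a0.
  have aE : mexpD (mexpB a (mexp1 j)) (mexp1 j) = a.
    by apply/ffunP => i; rewrite !ffunE; case: eqP => [->|_]; rewrite ?subnK // subn0 addn0.
  have /eqP : D y (mexpB a (mexp1 j)) = 0 by rewrite dy.
  by rewrite fps_derivE aE mulf_eq0 pnatr_eq0 => /eqP.
exists (fps_subst (shift (- Q)) q).
have <- : fps_subst (shift (- Q)) x' = x.
  rewrite /x' fps_substA; [|by move=> i; apply: shift_const|by move=> i; apply: shift_const].
  rewrite -[RHS]fps_subst_id; apply: eq_fps_subst => i; rewrite {2}/shift.
  case: ifP => [/eqP ->|ij]; last first.
    by rewrite fps_substX ?/shift ?ij // => l; apply: shift_const.
  rewrite fps_substD ?fps_substX; try by move=> l; apply: shift_const.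
  by rewrite shift_free // {1}/shift eqxx subrK.
rewrite x'E y0 add0r fps_substM ?fps_substX; try by move=> l; apply: shift_const.
by rewrite {1}/shift eqxx mulrC.
Qed.

End Division.
End OneDirection.

Lemma prod_zero_factor (A : comPzRingType) (J : finType) (F : J -> A) j :
  F j = 0 -> \prod_i F i = 0.
Proof. by move=> Fj; rewrite (bigD1 j) //= Fj mul0r. Qed.

(** * The field is an infinitesimal automorphism *)

Section Hypersurface.
Variables (R : realType) (s : nat) (beta : R).
Hypothesis s_gt0 : (0 < s)%N.
Local Notation C := R[i].
Local Notation I := ('i%C : R[i]).

(* The equation of [psi] that results from [is_psi] after division by
   [wbar^(m-1)]. *)
Definition psi_ode (psi : fps C 2) :=
  let x := fpsX C (ord0 : 'I_2) in
  let y := fpsX C (lift ord0 ord0 : 'I_2) in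
  let e := fps_exp (fpsC 2 I * y ^+ s * psi) in
  let Dx := fps_deriv (ord0 : 'I_2) in
  e ^+ s * Dx (Dx psi) - 2 * (Dx psi) ^+ 2
  - e ^+ s * (fpsC 2 (I * s%:R) * y ^+ s * Dx psi ^+ 2
              + fpsC 2 beta%:C%C * x * y ^+ (s + s) * Dx psi ^+ 3) = 0.

Let zi := lshift 2 (ord0 : 'I_2).
Let wi := lshift 2 (lift ord0 ord0 : 'I_2).
Let zbi := rshift 2 (ord0 : 'I_2).
Let wbi := rshift 2 (lift ord0 ord0 : 'I_2).
Local Notation z := (fpsX C zi).
Local Notation w := (fpsX C wi).
Local Notation zb := (fpsX C zbi).
Local Notation wb := (fpsX C wbi).

Definition zzbar_wbar := pair_of (z * zb) wb.

Lemma zzbar_wbar_const i : zzbar_wbar i (mexp0 4) = 0.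
Proof.
by rewrite /zzbar_wbar /pair_of; case: ifP => _; rewrite ?fps_const_mul !fpsX_const ?mulr0.
Qed.

Variable psi : fps C 2.
Hypothesis psi_x0 : forall a : mexp 2, a ord0 = 0%N -> psi a = 0.
Hypothesis psi_x1 : forall a : mexp 2, a ord0 = 1%N -> psi a = (a == mexp1 ord0)%:R.
Hypothesis psiE : psi_ode psi.

Let S := fps_subst zzbar_wbar.
(** The right-hand side of the defining equation. It does not involve [w] ([wgraph_free]), so
    restriction to the hypersurface is the substitution of it for [w]. *)
Definition wgraph : fps C 4 := wb * fps_exp (fpsC 4 I * wb ^+ s * S psi).
Local Notation Q := wgraph.

Lemma theta_graph : theta s.+1 psi = w - Q. Proof. by []. Qed.

Let SX1 : S (fpsX C (lift ord0 ord0 : 'I_2)) = wb.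
Proof. by rewrite /S fps_substX //; apply: zzbar_wbar_const. Qed.
Let SX0 : S (fpsX C (ord0 : 'I_2)) = z * zb.
Proof. by rewrite /S fps_substX //; apply: zzbar_wbar_const. Qed.
Let SM x y : S (x * y) = S x * S y.
Proof. by apply: fps_substM; apply: zzbar_wbar_const. Qed.
Let SB x y : S (x - y) = S x - S y.
Proof. by apply: fps_substB; apply: zzbar_wbar_const. Qed.
Let SD x y : S (x + y) = S x + S y.
Proof. by apply: fps_substD; apply: zzbar_wbar_const. Qed.
Let SC c : S (fpsC 2 c) = fpsC 4 c.
Proof. by apply: fps_substC; apply: zzbar_wbar_const. Qed.
Let SXn x k : S (x ^+ k) = S x ^+ k.
Proof. by apply: fps_substXn; apply: zzbar_wbar_const. Qed.
Let S0 : S 0 = 0.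
Proof. by apply: fps_subst0; apply: zzbar_wbar_const. Qed.

Let psi0 : psi (mexp0 2) = 0. Proof. by apply: psi_x0; rewrite ffunE. Qed.
Let expo := fpsC 4 I * wb ^+ s * S psi.
Let expo0 : expo (mexp0 4) = 0.
Proof.
by rewrite /expo fps_const_mul [S psi _]fps_subst_const ?psi0 ?mulr0 //; apply: zzbar_wbar_const.
Qed.
Let e := fps_exp expo.
Let e1 : e (mexp0 4) = 1. Proof. exact: fps_exp_const. Qed.

Lemma wgraph_const : Q (mexp0 4) = 0.
Proof. by rewrite /wgraph fps_const_mul fpsX_const mul0r. Qed.

Let dS k x : fps_deriv k (S x)
  = S (fps_deriv ord0 x) * fps_deriv k (z * zb)
    + S (fps_deriv (lift ord0 ord0) x) * fps_deriv k wb.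
Proof.
rewrite /S fps_deriv_subst; last exact: zzbar_wbar_const.
by rewrite !big_ord_recl big_ord0 addr0.
Qed.

Lemma wgraph_free : fps_deriv wi Q = 0.
Proof.
have d : fps_deriv wi (S psi) = 0.
  by rewrite dS fps_derivM !fps_derivX /= !(mul0r, mulr0, addr0).
have dw : fps_deriv wi (wb ^+ s) = 0.
  by case: (s) => [|k]; rewrite ?expr0 ?fps_deriv1 // fps_derivXn fps_derivX mulr0.
rewrite /wgraph fps_derivM fps_derivX mul0r add0r fps_deriv_exp //.
by rewrite -mulrA fps_derivCl fps_derivM d dw mul0r mulr0 addr0 !mulr0.
Qed.

Local Notation Dz := (fps_deriv zi).
Let dzS x : Dz (S x) = S (fps_deriv ord0 x) * zb.
Proof.
rewrite dS fps_derivM !fps_derivX eqxx mul1r.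
have -> : (zi == zbi) = false by [].
have -> : (zi == wbi) = false by [].
by rewrite !(mulr0, addr0).
Qed.

Let psi1 := S (fps_deriv ord0 psi).
Let psi2 := S (fps_deriv ord0 (fps_deriv ord0 psi)).
Let J := fpsC 4 I * wb ^+ s * psi1 * zb.

Let dzwb : Dz (wb ^+ s) = 0.
Proof. by case: (s) => [|k]; rewrite ?expr0 ?fps_deriv1 // fps_derivXn fps_derivX mulr0. Qed.

Lemma wgraph_dz : Dz Q = Q * J.
Proof.
rewrite /wgraph fps_derivM fps_derivX mul0r add0r fps_deriv_exp //.
rewrite -[fpsC 4 I * _ * _]mulrA fps_derivCl fps_derivM dzwb mul0r add0r dzS /J.
by rewrite !mulrA.
Qed.

Lemma wgraph_dzz : Dz (Dz Q) = Q * (J ^+ 2 + fpsC 4 I * wb ^+ s * zb ^+ 2 * psi2).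
Proof.
rewrite wgraph_dz fps_derivM wgraph_dz /J -!mulrA fps_derivCl !fps_derivM dzwb dzS.
have -> : Dz zb = 0 by rewrite fps_derivX.
rewrite -/psi1 -/psi2; ring.
Qed.

(** For fixed [zb] and [wb] the graph is one of the curves defining [psi]; the equation of [psi]
    pulled back along [(z zb, wb)] is the inverse equation up to a factor. *)
Lemma wgraph_ode : inverse_ode s beta%:C%C (2 * I) zi Q.
Proof.
have := congr1 S psiE; rewrite !(SB, SD, SM, SXn, SC, SX0, SX1, S0) -/psi1 -/psi2.
have -> : S (fps_exp (fpsC 2 I * fpsX C (lift ord0 ord0) ^+ s * psi)) = e.
  rewrite /S fps_subst_comp; last exact: zzbar_wbar_const.
    by rewrite -/S !SM SXn SC SX1.
  by rewrite fps_const_mul psi0 mulr0.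
rewrite fpsC1.
rewrite !fpsC_mul !fpsC_nat => E.
have sn : s%:R = s.-1%:R + 1 :> fps C 4.
  by rewrite -{1}(prednK s_gt0) -[s.-1.+1]addn1 natrD.
have QA : Q * Q ^+ s.-1 = wb ^+ s * e ^+ s by rewrite -exprS prednK // /wgraph exprMn.
have I2 : fpsC 4 I * fpsC 4 I + 1 = 0.
  rewrite -fpsC_mul -fpsC1 -fpsC_additive; apply/eqP.
  have -> : I * I + 1 = 0 by apply/eqP; rewrite eq_complex /=; apply/andP; split; apply/eqP; ring.
  by rewrite fpsC0.
rewrite /inverse_ode wgraph_dz fpsC_mul fpsC_nat.
have -> : Dz (Q * J) = Dz (Dz Q) by rewrite wgraph_dz.
rewrite wgraph_dzz.
have -> : fpsC 4 beta%:C%C * Q ^+ s.-1 * (Q * J) ^+ 3 * z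
    = fpsC 4 beta%:C%C * (Q * Q ^+ s.-1) * Q ^+ 2 * J ^+ 3 * z by ring.
rewrite QA; move: E; rewrite exprD sn.
set ws := wb ^+ s; set es := e ^+ s; set n := s.-1%:R; set bb := fpsC 4 beta%:C%C.
have JE : J = fpsC 4 I * ws * psi1 * zb by [].
move: (fpsC 4 I) I2 JE => i I2 ->.
set T := (X in X = 0) => T0; clear sn QA; set q := Q.
(* The first summand restores the factor divided out in [psi_ode]; the second is a multiple of
   [i^2 + 1], since [i] is only a letter for [ring]. *)
apply: (eq_by_sub (t := i * q ^+ 2 * ws ^+ 2 * zb ^+ 2 * T
    + q ^+ 2 * zb ^+ 2 * i * ws ^+ 2 * psi1 ^+ 2
      * (2 + bb * ws ^+ 2 * es * psi1 * z * zb) * (i * i + 1))).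
  by rewrite T0 I2; ring.
by rewrite /T; ring.
Qed.

Local Notation A0 := (at0 C zi).

Let A0z : A0 zi = 0. Proof. by []. Qed.
Let A0zb : A0 zbi = zb. Proof. by []. Qed.
Let A0wb : A0 wbi = wb. Proof. by []. Qed.

Let A0c := at0_const C zi.
Let A0X i : fps_subst A0 (fpsX C i) = A0 i. Proof. exact: fps_substX A0c i. Qed.
Let A0Zc i : fps_subst A0 (zzbar_wbar i) (mexp0 4) = 0.
Proof. by rewrite (fps_subst_const A0c) zzbar_wbar_const. Qed.
Let A0Z0 : fps_subst A0 (zzbar_wbar ord0) = 0.
Proof. by rewrite /zzbar_wbar /pair_of eqxx (fps_substM A0c) A0X A0z mul0r. Qed.

Let at0_Q : fps_subst A0 Q = wb.
Proof.
have A0S : fps_subst A0 (S psi) = 0.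
  rewrite /S (fps_substA _ zzbar_wbar_const A0c).
  apply/fpsP => a; rewrite (fps_substE A0Zc _ (leqnn _)) big1 // => b _.
  have [b0|b0] := posnP (b ord0); first by rewrite psi_x0 ?mul0r.
  by rewrite (@prod_zero_factor _ _ _ ord0) ?A0Z0 ?expr0n ?gtn_eqF // fps0E mulr0.
rewrite /wgraph fps_substM // A0X A0wb fps_subst_comp // ?expo0 //.
rewrite fps_substM // A0S mulr0 -/(fps_exp 0).
have -> : fps_exp (0 : fps C 4) = 1.
  rewrite /fps_exp fps_comp_shift ?fps0E // mul0r addr0.
  by rewrite invr1.
by rewrite mulr1.
Qed.

(** At [z = 0] the argument [x = z zb] vanishes, and only the normalized linear coefficient of [psi]
    in [x] survives. *)
Let at0_psi1 : fps_subst A0 psi1 = 1.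
Proof.
rewrite /psi1 /S (fps_substA _ zzbar_wbar_const A0c).
rewrite -[RHS](fps_substC A0Zc); apply/fpsP => a.
rewrite !(fps_substE A0Zc _ (leqnn _)); apply: eq_bigr => b _.
have [b0|b0] := posnP (b ord0); last first.
  by rewrite (@prod_zero_factor _ _ _ ord0) ?A0Z0 ?expr0n ?gtn_eqF // fps0E !mulr0.
congr (_ * _); rewrite fps_derivE b0 mul1r psi_x1 ?ffunE ?b0 ?eqxx //.
rewrite -[RHS]/((1 : fps C 2) b) fps1E.
case: (eqVneq b (mexp0 2)) => [->|bn]; first by rewrite mexp0D eqxx.
case: eqP => // /(congr1 (@mdeg 2)); rewrite mdegD mdeg1 => /eqP.
by rewrite addn1 eqSS mdeg_eq0 (negbTE bn).
Qed.

Let at0_dzQ : fps_subst A0 (Dz Q) = fpsC 4 I * wb ^+ s.+1 * zb.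
Proof.
rewrite wgraph_dz (fps_substM A0c Q J) at0_Q /J !(fps_substM A0c) at0_psi1.
by rewrite (fps_substC A0c) (fps_substXn A0c) !A0X A0zb A0wb exprS; ring.
Qed.

Variable f : fps C 1.
Hypotheses (f0 : ucoef f 0 = 1) (fE : linear_ode s beta%:C%C (2 * I) f).
Local Notation fb := (fps_map (@conjc R) f).
Local Notation U := (Ufield s f).
Local Notation V := (Vfield s f).
Local Notation Ub := (fps_map (@conjc R) U).
Local Notation Vb := (fps_map (@conjc R) V).
Local Notation uw := (fpsX C (ord0 : 'I_1)).
Local Notation D1 := (fps_deriv (ord0 : 'I_1)).

Lemma fb0 : ucoef fb 0 = 1.
Proof. by rewrite /ucoef /= -/(ucoef f 0) f0 conjc1. Qed.

Lemma conj_Vfield : Vb = V.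
Proof.
rewrite /Vfield !fps_mapM fps_mapXn fps_mapX [f * _]mulrC; congr (_ * (_ * _)).
by apply/fpsP => a /=; rewrite conjcK.
Qed.

Lemma conj_Ufield : Ub = uw ^+ s.+1 * (D1 fb * f).
Proof.
rewrite /Ufield !fps_mapM fps_mapXn fps_mapX fps_map_deriv; congr (_ * (_ * _)).
by apply/fpsP => a /=; rewrite conjcK.
Qed.

Lemma Vfield_deriv : uw * D1 V = s.+1%:R * V + uw * U + uw * Ub.
Proof.
rewrite conj_Ufield /Vfield /Ufield fps_derivM deriv_wXn fps_derivM exprS; ring.
Qed.

Let sub1 (h : fps C 4) := fps_subst (fun _ : 'I_1 => h).

(** The restriction of [(L + conj L) theta] to the hypersurface; the second [V] needs no conjugation
    by [conj_Vfield]. *)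
Definition defect : fps C 4 :=
  (sub1 Q V - z * sub1 Q U * Dz Q)
  - sub1 wb Ub * zb * fps_deriv zbi Q - sub1 wb V * fps_deriv wbi Q.

Let dz_wb (h : fps C 1) : Dz (sub1 wb h) = 0.
Proof.
rewrite /sub1 fps_deriv_subst => [|i]; last exact: fpsX_const.
by rewrite big_ord1 fps_derivX mulr0.
Qed.

(** The first bracket is a symmetry characteristic. The other terms are derivatives of [Q] in the
    parameters [zb] and [wb], multiplied by factors free of [z]. *)
Lemma defect_linearized : linearized s beta%:C%C (2 * I) zi Q defect = 0.
Proof.
have fbE := linear_ode_conj fE.
have QE := wgraph_ode.
have Ha := symmetry_a s_gt0 fE fbE f0 fb0.
have Hb := symmetry_b s_gt0 fE fbE.
have L0 : linearized s beta%:C%C (2 * I) zi Q (sub1 Q V - z * sub1 Q U * Dz Q) = 0.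
  exact: (linearized_symmetry wgraph_const QE Ha Hb).
rewrite /defect (linearizedB _ _ _ _ _ (_ - _ - _)) (linearizedB _ _ _ _ _ (_ - _)) L0.
have dzb : Dz (sub1 wb Ub * zb) = 0.
  by rewrite fps_derivM dz_wb fps_derivX mulr0 mul0r addr0.
rewrite !linearizedM ?dz_wb //.
have Lzb := linearized_deriv QE zbi; have Lwb := linearized_deriv QE wbi.
rewrite /= mulr0 addr0 in Lzb; rewrite /= mulr0 addr0 in Lwb.
by rewrite Lzb Lwb !mulr0 !subr0.
Qed.

Let at0_sub1 (h : fps C 4) p : h (mexp0 4) = 0 ->
  fps_subst A0 (sub1 h p) = sub1 (fps_subst A0 h) p.
Proof. by move=> h0; rewrite /sub1 fps_substA. Qed.

Let at0_wb : fps_subst A0 wb = wb. Proof. by rewrite A0X A0wb. Qed.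
Let at0_zb : fps_subst A0 zb = zb. Proof. by rewrite A0X A0zb. Qed.
Let at0_z : fps_subst A0 z = 0. Proof. by rewrite A0X A0z. Qed.

Let at0_sub1wb p : fps_subst A0 (sub1 wb p) = sub1 wb p.
Proof. by rewrite at0_sub1 ?at0_wb // fpsX_const. Qed.

Let at0_sub1Q p : fps_subst A0 (sub1 Q p) = sub1 wb p.
Proof. by rewrite at0_sub1 ?at0_Q // wgraph_const. Qed.

Let at0B := fps_substB A0c.
Let at0D := fps_substD A0c.
Let at0M := fps_substM A0c.

Let at0_dzbQ : fps_subst A0 (fps_deriv zbi Q) = 0.
Proof. by rewrite -fps_deriv_at0 // at0_Q fps_derivX. Qed.

Let at0_dwbQ : fps_subst A0 (fps_deriv wbi Q) = 1.
Proof. by rewrite -fps_deriv_at0 // at0_Q fps_derivX. Qed.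

Let at0_dzbdzQ : fps_subst A0 (Dz (fps_deriv zbi Q)) = fpsC 4 I * wb ^+ s.+1.
Proof.
rewrite fps_deriv_comm -fps_deriv_at0 // at0_dzQ fps_derivM fps_derivX eqxx mulr1.
by rewrite fps_derivCl fps_derivXn fps_derivX /= mulr0 mulr0 mul0r add0r.
Qed.

Let at0_dwbdzQ : fps_subst A0 (Dz (fps_deriv wbi Q))
  = fpsC 4 I * (s.+1%:R * wb ^+ s) * zb.
Proof.
rewrite fps_deriv_comm -fps_deriv_at0 // at0_dzQ fps_derivM fps_derivX /= mulr0 addr0.
by rewrite fps_derivCl fps_derivXn fps_derivX eqxx mulr1.
Qed.

Let dz_subQ p : Dz (sub1 Q p) = sub1 Q (D1 p) * Dz Q.
Proof.
rewrite /sub1 fps_deriv_subst => [|i]; last exact: wgraph_const.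
by rewrite big_ord1.
Qed.

Lemma defect_at0 : fps_subst A0 defect = 0.
Proof.
rewrite /defect; move: (at0_sub1Q V) (at0_sub1Q U) at0_dzQ at0_dzbQ at0_dwbQ.
move: (Dz Q) (fps_deriv zbi Q) (fps_deriv wbi Q) => a b d.
move=> eV eU ea eb ed; rewrite !(at0B, at0M) eV eU ea eb ed !at0_sub1wb at0_z.
by rewrite !(mul0r, mulr0, mulr1, subr0) subrr.
Qed.

(** At [z = 0] the slope of [Q] is [i wb^m zb], so the claim becomes [w V' = m V + w U + w conj U]
    evaluated at [wb], that is [Vfield_deriv]. *)
Lemma defect_dz_at0 : fps_subst A0 (Dz defect) = 0.
Proof.
have wb0 (i : 'I_1) : (fun _ : 'I_1 => wb) i (mexp0 4) = 0 by apply: fpsX_const.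
have VE : wb * sub1 wb (D1 V)
    = s.+1%:R * sub1 wb V + wb * sub1 wb U + wb * sub1 wb Ub.
  have := congr1 (sub1 wb) Vfield_deriv; rewrite /sub1.
  rewrite !(fps_substD wb0, fps_substM wb0) !(fps_substX wb0).
  by rewrite -fpsC_nat (fps_substC wb0) fpsC_nat.
rewrite /defect !fps_derivB (fps_derivM _ _ (fps_deriv zbi Q)).
rewrite (fps_derivM _ (sub1 wb V)) (fps_derivM _ _ zb) !dz_wb.
rewrite (fps_derivM _ _ (Dz Q)) (fps_derivM _ z) !dz_subQ !fps_derivX eqxx /=.
move: (at0_sub1Q (D1 V)) (at0_sub1Q U) (at0_sub1Q (D1 U)) at0_dzQ at0_dzbQ at0_dwbQ
  at0_dzbdzQ at0_dwbdzQ.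
move: (Dz (fps_deriv zbi Q)) (Dz (fps_deriv wbi Q)) (Dz (Dz Q)).
move: (Dz Q) (fps_deriv zbi Q) (fps_deriv wbi Q) => a b d bz dz az.
move=> eV eU eU1 ea eb ed ebz edz.
rewrite !(at0B, at0D, at0M) eV eU eU1 ea eb ed ebz edz !at0_sub1wb at0_z at0_zb.
rewrite !(fps_subst0, fps_subst1 A0c) exprS.
apply: (eq_by_sub (t := fpsC 4 I * wb ^+ s * zb * (wb * sub1 wb (D1 V)
  - (s.+1%:R * sub1 wb V + wb * sub1 wb U + wb * sub1 wb Ub)))).
  by rewrite VE subrr mulr0.
ring.
Qed.

(** A solution of a second-order linear equation in [z] with both initial values zero. *)
Lemma defect_eq0 : defect = 0.
Proof.
have kj : wbi != zi by [].
apply: (linearized_uniq kj (erefl : Q = wb * e) e1 defect_linearized).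
exact: zvanish2_at0 defect_at0 defect_dz_at0.
Qed.

Variable g : fps C 1.
Hypothesis LE : Lfield s.+1 f g =
  pair_of (fps_subst (fun=> fpsX C (lift ord0 ord0 : 'I_2)) U * fpsX C ord0)
          (fps_subst (fun=> fpsX C (lift ord0 ord0 : 'I_2)) V).

Let inZ0 (i : 'I_2) : (fun i : 'I_2 => fpsX C (lshift 2 i)) i (mexp0 4) = 0.
Proof. exact: fpsX_const. Qed.
Let inZb0 (i : 'I_2) : (fun i : 'I_2 => fpsX C (rshift 2 i)) i (mexp0 4) = 0.
Proof. exact: fpsX_const. Qed.

Let inZ_sub p : in_Z (fps_subst (fun _ : 'I_1 => fpsX C (lift ord0 ord0 : 'I_2)) p)
  = sub1 w p.
Proof.
rewrite /in_Z fps_substA // => [|i]; last exact: fpsX_const.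
by apply: eq_fps_subst => i; rewrite (fps_substX inZ0).
Qed.

Let inZb_sub p :
  conj_in_Zbar (fps_subst (fun _ : 'I_1 => fpsX C (lift ord0 ord0 : 'I_2)) p)
  = sub1 wb (fps_map (@conjc R) p).
Proof.
rewrite /conj_in_Zbar fps_map_subst fps_substA // => [|i]; last first.
  by rewrite fps_mapX fpsX_const.
by apply: eq_fps_subst => i; rewrite fps_mapX (fps_substX inZb0).
Qed.

Lemma Lfield_theta :
  \sum_i (in_Z (Lfield s.+1 f g i) * fps_deriv (lshift 2 i) (theta s.+1 psi)
          + conj_in_Zbar (Lfield s.+1 f g i) * fps_deriv (rshift 2 i) (theta s.+1 psi))
  = sub1 w V - sub1 w U * z * Dz Q
    - sub1 wb Ub * zb * fps_deriv zbi Q - sub1 wb V * fps_deriv wbi Q.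
Proof.
have in_ZM (p q : fps C 2) : in_Z (p * q) = in_Z p * in_Z q by rewrite /in_Z (fps_substM inZ0).
have in_ZbM (p q : fps C 2) : conj_in_Zbar (p * q) = conj_in_Zbar p * conj_in_Zbar q.
  by rewrite /conj_in_Zbar fps_mapM (fps_substM inZb0).
rewrite LE theta_graph !big_ord_recl big_ord0 addr0 /pair_of.
rewrite eqxx (_ : (lift ord0 ord0 == ord0 :> 'I_2) = false) //.
rewrite in_ZM in_ZbM !inZ_sub !inZb_sub conj_Vfield.
have -> : in_Z (fpsX C (ord0 : 'I_2)) = z by rewrite /in_Z (fps_substX inZ0).
have -> : conj_in_Zbar (fpsX C (ord0 : 'I_2)) = zb.
  by rewrite /conj_in_Zbar fps_mapX (fps_substX inZb0).
rewrite !fps_derivB !fps_derivX wgraph_free.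
rewrite (_ : (lshift 2 (ord0 : 'I_2) == wi) = false) //.
rewrite (_ : (lshift 2 (lift ord0 ord0 : 'I_2) == wi) = true) //.
rewrite (_ : (rshift 2 (ord0 : 'I_2) == wi) = false) //.
rewrite (_ : (rshift 2 (lift ord0 ord0 : 'I_2) == wi) = false) //.
rewrite -/zi -/zbi -/wbi; have -> : true%:R = 1 :> fps C 4 by [].
have -> : false%:R = 0 :> fps C 4 by [].
ring.
Qed.

Lemma Lfield_infinitesimal :
  infinitesimal_automorphism (theta s.+1 psi) (Lfield s.+1 f g).
Proof.
rewrite /infinitesimal_automorphism Lfield_theta theta_graph.
apply/(fps_divisible wgraph_const wgraph_free).
have rc := graph_const wi wgraph_const.
have rX i : fps_subst (graph wi Q) (fpsX C i) = graph wi Q i by rewrite (fps_substX rc).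
have rfree x : fps_deriv wi x = 0 -> fps_subst (graph wi Q) x = x.
  by move=> dx; apply: graph_free.
have rdQ k : fps_subst (graph wi Q) (fps_deriv k Q) = fps_deriv k Q.
  by apply: rfree; rewrite fps_deriv_comm wgraph_free fps_deriv0.
have rsub (h : fps C 4) p : h (mexp0 4) = 0 ->
    fps_subst (graph wi Q) (sub1 h p) = sub1 (fps_subst (graph wi Q) h) p.
  by move=> h0; rewrite /sub1 fps_substA.
rewrite !(fps_substB rc, fps_substM rc) !rdQ !rsub ?fpsX_const // !rX.
rewrite -[RHS]defect_eq0 /defect.
have -> : graph wi Q wi = Q by [].
have -> : graph wi Q wbi = wb by [].
have -> : graph wi Q zi = z by [].
have -> : graph wi Q zbi = zb by [].
ring.
Qed.

End Hypersurface.

Import numFieldNormedType.Exports.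
Local Open Scope classical_set_scope.

(** * The real-valued complex norm and derivatives in a real variable *)

Section ComplexNorm.
Variable R : realType.
Local Notation C := R[i].
Local Notation nc := (@Normc.normc R).
Implicit Types (x y z h d : C) (t : R).

Lemma normc_ge0 z : 0 <= nc z.
Proof. by case: z => a b; rewrite /= sqrtr_ge0. Qed.

Lemma ncM x y : nc (x * y) = nc x * nc y. Proof. exact: Normc.normcM. Qed.
Lemma ncD x y : nc (x + y) <= nc x + nc y. Proof. exact: le_normcD. Qed.
Lemma ncN x : nc (- x) = nc x. Proof. exact: normcN. Qed.
Lemma ncB x y : nc (x - y) <= nc x + nc y.
Proof. by rewrite -(ncN y); exact: ncD. Qed.
Lemma ncBC x y : nc (x - y) = nc (y - x).
Proof. by rewrite -ncN opprB. Qed.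
Lemma nc0 : nc 0 = 0. Proof. exact: Normc.normc0. Qed.
Lemma nc1 : nc 1 = 1. Proof. exact: Normc.normc1. Qed.
Lemma ncX x k : nc (x ^+ k) = nc x ^+ k.
Proof. by elim: k => [|k IH]; rewrite ?expr0 ?nc1 // !exprS ncM IH. Qed.
Lemma nc_real t : nc (t%:C)%C = `|t|.
Proof. by rewrite /= expr0n addr0 sqrtr_sqr. Qed.
Lemma nc_nat k : nc k%:R = k%:R.
Proof. by rewrite -(rmorph_nat (real_complex R)) nc_real ger0_norm. Qed.
Lemma nc_I : nc 'i%C = 1.
Proof. by rewrite /= expr0n expr1n add0r sqrtr1. Qed.
Lemma nc_eq0 z : nc z = 0 -> z = 0. Proof. exact: Normc.eq0_normc. Qed.
Lemma nc_gt0 z : z != 0 -> 0 < nc z.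
Proof. by move=> z0; rewrite lt0r normc_ge0 andbT; apply: contra z0 => /eqP/nc_eq0 ->. Qed.
Lemma ncV z : nc z^-1 = (nc z)^-1. Proof. exact: Normc.normcV. Qed.

Lemma nc_sum J (r : seq J) (P : pred J) (F : J -> C) :
  nc (\sum_(i <- r | P i) F i) <= \sum_(i <- r | P i) nc (F i).
Proof.
elim/big_rec2: _ => [|i y x _ xy]; first by rewrite nc0.
by apply: le_trans (ncD _ _) _; rewrite lerD2l.
Qed.

Lemma nc_norm z : `|z| = (nc z)%:C%C. Proof. by []. Qed.

Lemma Re_le_nc z : `|complex.Re z| <= nc z.
Proof.
case: z => a b /=; rewrite -sqrtr_sqr ler_wsqrtr // lerDl; exact: sqr_ge0.
Qed.
Lemma Im_le_nc z : `|complex.Im z| <= nc z.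
Proof.
case: z => a b /=; rewrite -sqrtr_sqr ler_wsqrtr // lerDr; exact: sqr_ge0.
Qed.
Lemma nc_le_ReIm z : nc z <= `|complex.Re z| + `|complex.Im z|.
Proof.
have -> : z = (complex.Re z)%:C%C + (complex.Im z)%:C%C * 'i%C.
  by rewrite [LHS]complexE mulrC.
apply: le_trans (ncD _ _) _; rewrite ncM nc_I mulr1 !nc_real.
by case: z => a b /=; rewrite !(mulr0, mul0r, mulr1, mul1r, addr0, add0r, subr0, subrr).
Qed.

Lemma cReM x y : complex.Re (x * y) = complex.Re x * complex.Re y - complex.Im x * complex.Im y.
Proof. by case: x y => a b [c e]. Qed.
Lemma cImM x y : complex.Im (x * y) = complex.Re x * complex.Im y + complex.Im x * complex.Re y.
Proof. by case: x y => a b [c e]. Qed.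
Lemma cReD x y : complex.Re (x + y) = complex.Re x + complex.Re y.
Proof. by case: x y => a b [c e]. Qed.
Lemma cImD x y : complex.Im (x + y) = complex.Im x + complex.Im y.
Proof. by case: x y => a b [c e]. Qed.
Lemma cReN x : complex.Re (- x) = - complex.Re x. Proof. by case: x. Qed.
Lemma cImN x : complex.Im (- x) = - complex.Im x. Proof. by case: x. Qed.
Lemma complex_eq x y : complex.Re x = complex.Re y -> complex.Im x = complex.Im y -> x = y.
Proof. by case: x y => a b [c e] /= -> ->. Qed.

(* Differentiability in a real variable, componentwise. *)
Definition rderiv (y : R -> C) t d :=
  is_derive t 1 (fun u => complex.Re (y u)) (complex.Re d)
  /\ is_derive t 1 (fun u => complex.Im (y u)) (complex.Im d).

Lemma rderiv_cst c t : rderiv (fun=> c) t 0.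
Proof. by split; apply: is_derive_cst. Qed.

Lemma rderivD (y1 y2 : R -> C) t d1 d2 : rderiv y1 t d1 -> rderiv y2 t d2 ->
  rderiv (fun u => y1 u + y2 u) t (d1 + d2).
Proof.
move=> [r1 i1] [r2 i2]; split; rewrite ?cReD ?cImD.
  have -> : (fun u => complex.Re (y1 u + y2 u))
      = (fun u => complex.Re (y1 u)) + (fun u => complex.Re (y2 u)).
    by apply/funext => u; rewrite cReD.
  exact: is_deriveD.
have -> : (fun u => complex.Im (y1 u + y2 u))
    = (fun u => complex.Im (y1 u)) + (fun u => complex.Im (y2 u)).
  by apply/funext => u; rewrite cImD.
exact: is_deriveD.
Qed.

Lemma rderivM (y1 y2 : R -> C) t d1 d2 : rderiv y1 t d1 -> rderiv y2 t d2 ->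
  rderiv (fun u => y1 u * y2 u) t (d1 * y2 t + y1 t * d2).
Proof.
move=> [r1 i1] [r2 i2]; split.
  have -> : (fun u => complex.Re (y1 u * y2 u))
      = (fun u => complex.Re (y1 u)) * (fun u => complex.Re (y2 u))
        - (fun u => complex.Im (y1 u)) * (fun u => complex.Im (y2 u)).
    by apply/funext => u; rewrite cReM.
  apply: (is_derive_eq (is_deriveB (is_deriveM r1 r2) (is_deriveM i1 i2))).
  by rewrite cReD !cReM /GRing.scale /=; ring.
have -> : (fun u => complex.Im (y1 u * y2 u))
    = (fun u => complex.Re (y1 u)) * (fun u => complex.Im (y2 u))
      + (fun u => complex.Im (y1 u)) * (fun u => complex.Re (y2 u)).
  by apply/funext => u; rewrite cImM.
apply: (is_derive_eq (is_deriveD (is_deriveM r1 i2) (is_deriveM i1 r2))).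
by rewrite cImD !cImM /GRing.scale /=; ring.
Qed.

Lemma rderiv_ext (y1 y2 : R -> C) t d : y1 =1 y2 -> rderiv y1 t d -> rderiv y2 t d.
Proof. by move=> /funext ->. Qed.

Lemma rderivZ c (y : R -> C) t d : rderiv y t d -> rderiv (fun u => c * y u) t (c * d).
Proof.
move=> yd; have := rderivM (rderiv_cst c t) yd; rewrite mul0r add0r; exact.
Qed.

Lemma rderiv_conj (y : R -> C) t d : rderiv y t d -> rderiv (fun u => ((y u)^*)%C) t (d^*)%C.
Proof.
move=> [r i]; split.
  have -> : (fun u => complex.Re ((y u)^*)%C) = (fun u => complex.Re (y u)).
    by apply/funext => u; case: (y u).
  by case: d r i.
have -> : (fun u => complex.Im ((y u)^*)%C) = - (fun u => complex.Im (y u)).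
  by apply/funext => u; rewrite /GRing.opp /=; case: (y u).
have -> : complex.Im (d^*)%C = - complex.Im d by case: (d).
exact: is_deriveN.
Qed.

Lemma rderiv_sum J (r : seq J) (y : J -> R -> C) t (d : J -> C) :
  (forall i, rderiv (y i) t (d i)) ->
  rderiv (fun u => \sum_(i <- r) y i u) t (\sum_(i <- r) d i).
Proof.
move=> yd; elim: r => [|i r IH].
  rewrite big_nil; apply: (rderiv_ext (y1 := fun=> 0)); last exact: rderiv_cst.
  by move=> u; rewrite big_nil.
rewrite big_cons; apply: (rderiv_ext (y1 := fun u => y i u + \sum_(i <- r) y i u)).
  by move=> u; rewrite big_cons.
exact: rderivD.
Qed.

Lemma rderiv0_cst (y : R -> C) : (forall t, rderiv y t 0) -> forall t, y t = y 0.
Proof.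
move=> yd t; apply: complex_eq.
  by apply: (@is_derive_0_is_cst _ (fun u => complex.Re (y u))) => u; apply: (yd u).1.
by apply: (@is_derive_0_is_cst _ (fun u => complex.Im (y u))) => u; apply: (yd u).2.
Qed.

(** The mean value theorem is applied to real and imaginary parts separately, whence the factor
    2. *)
Lemma rderiv_bound (y d : R -> C) (K : R) : (forall t, rderiv y t (d t)) ->
  (forall t, 0 <= t <= 1 -> nc (d t) <= K) ->
  forall t, 0 <= t <= 1 -> nc (y t - y 0) <= 2 * K.
Proof.
move=> yd dK t /andP[t0 t1].
have mv (F dF : R -> R) : (forall u : R, is_derive u (1 : R) F (dF u)) ->
    (forall u, 0 <= u <= 1 -> `|dF u| <= K) -> `|F t - F 0| <= K.
  move=> FE dFK.
  have cF : {within `[0, t], continuous F}.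
    by apply: derivable_within_continuous => u _; apply: (@ex_derive _ _ _ _ _ _ _ (FE u)).
  have [c] := @MVT_segment R F dF 0 t t0 (fun u _ => FE u) cF.
  rewrite in_itv /= => /andP[c0 ct] ->; rewrite normrM subr0 (ger0_norm t0).
  have cK : `|dF c| <= K by apply: dFK; rewrite c0 (le_trans ct).
  by apply: le_trans (_ : `|dF c| * 1 <= _); [apply: ler_wpM2l|rewrite mulr1].
have K0 : 0 <= K by apply: le_trans (dK 0 _); rewrite ?normc_ge0 // lexx ler01.
apply: le_trans (nc_le_ReIm _) _; rewrite cReD cImD cReN cImN mulr_natl mulr2n.
apply: lerD.
  apply: (mv (fun u => complex.Re (y u)) (fun u => complex.Re (d u))) => [u|u u01].
    exact: (yd u).1.
  by apply: le_trans (Re_le_nc _) (dK _ u01).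
apply: (mv (fun u => complex.Im (y u)) (fun u => complex.Im (d u))) => [u|u u01].
  exact: (yd u).2.
by apply: le_trans (Im_le_nc _) (dK _ u01).
Qed.

End ComplexNorm.

(** * Complex differentiation with quadratic remainder *)

Section ComplexDerivative.
Variable R : realType.
Local Notation C := R[i].
Local Notation nc := (@Normc.normc R).
Implicit Types (z h d : C) (F G : C -> C).

(* Complex differentiability with a quadratic remainder. *)
Definition qderiv F z d := exists K : R, exists2 delta : R, 0 < delta &
  0 <= K /\ forall h, nc h < delta -> nc (F (z + h) - F z - h * d) <= K * nc h ^+ 2.

Lemma qderiv_eq F z d d' : d = d' -> qderiv F z d -> qderiv F z d'.
Proof. by move=> ->. Qed.

Lemma qderiv_local F G z d (r : R) : 0 < r ->
  (forall h, nc h < r -> F (z + h) = G (z + h)) -> qderiv F z d -> qderiv G z d.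
Proof.
move=> r0 FG [K [e e0 [K0 FE]]]; exists K, (Num.min r e); first by rewrite lt_min r0.
split=> // h; rewrite lt_min => /andP[hr he].
rewrite -FG // -[z in G z]addr0 -FG ?nc0 // addr0; exact: FE.
Qed.

Lemma qderiv_cst c z : qderiv (fun=> c) z 0.
Proof.
exists 0, 1 => //; split=> // h _.
by rewrite subrr sub0r mulr0 oppr0 nc0 mul0r.
Qed.

Lemma qderiv_lin c z : qderiv (fun x => x * c) z c.
Proof.
exists 0, 1 => //; split=> // h _.
by rewrite mulrDl [z * c + _]addrC addrK subrr nc0 mul0r.
Qed.

Lemma qderivM F G z d d' : qderiv F z d -> qderiv G z d' ->
  qderiv (fun x => F x * G x) z (d * G z + F z * d').
Proof.
move=> [K [e e0 [K0 FE]]] [L [r r0 [L0 GE]]].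
exists (K * nc (G z) + nc (F z) * L + (nc d + K) * (nc d' + L)).
exists (Num.min 1 (Num.min e r)); first by rewrite !lt_min ltr01 e0.
split; first by rewrite !(addr_ge0, mulr_ge0, normc_ge0).
move=> h; rewrite !lt_min => /and3P[h1 he hr].
have {}FE := FE _ he; have {}GE := GE _ hr.
set a := F (z + h) - F z - h * d in FE; set b := G (z + h) - G z - h * d' in GE.
have -> : F (z + h) * G (z + h) - F z * G z - h * (d * G z + F z * d')
    = a * G z + F z * b + (h * d + a) * (h * d' + b) by rewrite /a /b; ring.
have h2 : nc h ^+ 2 <= nc h by rewrite expr2 ler_piMl ?normc_ge0 // ltW.
have bd (x y : C) (M : R) : 0 <= M -> nc y <= M * nc h ^+ 2 ->
    nc (h * x + y) <= (nc x + M) * nc h.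
  move=> M0 yM; apply: le_trans (ncD _ _) _; rewrite ncM mulrDl mulrC lerD2l.
  by apply: le_trans yM _; apply: ler_wpM2l.
apply: le_trans (ncD _ _) _; rewrite [leRHS]mulrDl; apply: lerD.
  apply: le_trans (ncD _ _) _; rewrite [leRHS]mulrDl !ncM; apply: lerD.
    by rewrite mulrAC; apply: ler_wpM2r; rewrite ?normc_ge0.
  by rewrite -mulrA; apply: ler_wpM2l; rewrite ?normc_ge0.
rewrite ncM; apply: le_trans (_ : (nc d + K) * nc h * ((nc d' + L) * nc h) <= _).
  by apply: ler_pM; rewrite ?normc_ge0 // bd.
by rewrite mulrACA expr2.
Qed.

Lemma qderivZ c F z d : qderiv F z d -> qderiv (fun x => c * F x) z (c * d).
Proof.
by move=> FE; have := qderivM (qderiv_cst c z) FE; apply: qderiv_eq; rewrite mul0r add0r.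
Qed.

Lemma qderiv_comp F G z d d' : qderiv G z d -> qderiv F (G z) d' ->
  qderiv (fun x => F (G x)) z (d * d').
Proof.
move=> [K [e e0 [K0 GE]]] [L [r r0 [L0 FE]]].
set M := nc d + K; have M0 : 0 <= M by rewrite addr_ge0 ?normc_ge0.
exists (K * nc d' + L * M ^+ 2), (Num.min 1 (Num.min e (r / (M + 1)))).
  by rewrite !lt_min ltr01 e0 divr_gt0 // ltr_wpDl.
split; first by rewrite !(addr_ge0, mulr_ge0, normc_ge0, exprn_ge0).
move=> h; rewrite !lt_min => /and3P[h1 he hr].
have {}GE := GE _ he; set a := G (z + h) - G z - h * d in GE.
set k := h * d + a; have GzE : G (z + h) = G z + k by rewrite /k /a; ring.
have h2 : nc h ^+ 2 <= nc h by rewrite expr2 ler_piMl ?normc_ge0 // ltW.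
have kM : nc k <= M * nc h.
  apply: le_trans (ncD _ _) _; rewrite ncM /M [leRHS]mulrDl mulrC lerD2l.
  by apply: le_trans GE _; apply: ler_wpM2l.
have kr : nc k < r.
  apply: le_lt_trans kM _; apply: le_lt_trans (_ : (M + 1) * nc h < _).
    by rewrite ler_wpM2r ?normc_ge0 // lerDl.
  by rewrite mulrC -ltr_pdivlMr // ltr_wpDl.
have {}FE := FE _ kr; rewrite GzE.
have -> : F (G z + k) - F (G z) - h * (d * d')
    = a * d' + (F (G z + k) - F (G z) - k * d') by rewrite /k; ring.
apply: le_trans (ncD _ _) _; rewrite ncM [leRHS]mulrDl; apply: lerD.
  by rewrite mulrAC; apply: ler_wpM2r; rewrite ?normc_ge0.
apply: le_trans FE _; rewrite -mulrA; apply: ler_wpM2l => //.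
by rewrite -exprMn; apply: lerXn2r; rewrite ?nnegrE ?mulr_ge0 ?normc_ge0.
Qed.

Lemma qderiv_is_derive F z d : qderiv F z d ->
  is_derive (z : C^o) (1 : C^o) (F : C^o -> C^o) d.
Proof.
move=> [K [e e0 [K0 FE]]].
have cv : ((fun h : C^o => h^-1 *: ((F : C^o -> C^o) (h *: 1 + z) - F z)) @ 0^')
    --> (d : C^o).
  apply/cvgrPdist_lt => eps eps0.
  have [eR epsE] : exists r : R, eps = r%:C%C.
    by exists (complex.Re eps); rewrite RRe_real // gtr0_real.
  rewrite epsE ltcR in eps0.
  have r0 : 0 < Num.min e (eR / (K + 1)).
    by rewrite lt_min e0 divr_gt0 // ltr_wpDl.
  near=> h.
  have hn0 : h != 0 by near: h; exact: nbhs_dnbhs_neq.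
  have hr : nc h < Num.min e (eR / (K + 1)).
    rewrite -ltcR -nc_norm.
    by near: h; apply: dnbhs0_lt; rewrite ltcR.
  move: hr; rewrite lt_min => /andP[he hK].
  rewrite nc_norm epsE ltcR; have {}FE := FE _ he.
  rewrite [h *: 1]mulr1 [h + z]addrC.
  have -> : d - h^-1 *: (F (z + h) - F z) = - (h^-1 * (F (z + h) - F z - h * d)).
    by rewrite mulrBr mulKf // opprB.
  rewrite ncN ncM ncV.
  have h0 := nc_gt0 hn0.
  apply: le_lt_trans (_ : (nc h)^-1 * (K * nc h ^+ 2) < _).
    by apply: ler_wpM2l => //; rewrite invr_ge0 ltW.
  rewrite mulrCA expr2 mulKf ?gt_eqF //.
  apply: le_lt_trans (_ : (K + 1) * nc h < _).
    by rewrite ler_wpM2r ?normc_ge0 // lerDl.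
  by rewrite mulrC -ltr_pdivlMr // ltr_wpDl.
have dv : derivable (F : C^o -> C^o) (z : C^o) 1.
  by apply/cvg_ex; exists d.
apply: DeriveDef => //.
exact: (cvg_lim (@norm_hausdorff _ _) cv).
Unshelve. all: by end_near.
Qed.

End ComplexDerivative.

(** * The complex exponential and its Taylor remainders *)

Section ComplexExponential.
Variable R : realType.
Local Notation C := R[i].
Local Notation nc := (@Normc.normc R).
Implicit Types (x y z h d : C) (t u : R).

Lemma expCD x y : expC (x + y) = expC x * expC y.
Proof.
apply: complex_eq; rewrite ?cReM ?cImM /expC /= cReD cImD expRD ?cosD ?sinD; ring.
Qed.

Lemma expC0 : expC (0 : C) = 1.
Proof. by rewrite /expC /= expR0 cos0 sin0 !mul1r. Qed.

Lemma nc_expC z : nc (expC z) = expR (complex.Re z).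
Proof.
by rewrite /expC /= !exprMn -mulrDr cos2Dsin2 mulr1 sqrtr_sqr ger0_norm ?expR_ge0.
Qed.

Lemma rderiv_id t : rderiv (fun u => u%:C%C) t 1.
Proof. by split; [exact: is_derive_id|exact: is_derive_cst]. Qed.

Lemma rderiv_line z t : rderiv (fun u => u%:C%C * z) t z.
Proof.
have := rderivM (rderiv_id t) (rderiv_cst z t); by rewrite mul1r mulr0 addr0.
Qed.

Lemma rderivX (f : R -> C) t d k : rderiv f t d ->
  rderiv (fun u => f u ^+ k.+1) t (k.+1%:R * (f t ^+ k * d)).
Proof.
move=> fd; elim: k => [|k IH]; first by rewrite expr0 !mul1r.
have -> : k.+2%:R * (f t ^+ k.+1 * d)
    = d * f t ^+ k.+1 + f t * (k.+1%:R * (f t ^+ k * d)).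
  by rewrite -[k.+2]addn1 natrD exprS; ring.
apply: (rderiv_ext (y1 := fun u => f u * f u ^+ k.+1)).
  by move=> u; rewrite -exprS.
exact: rderivM.
Qed.

Lemma Re_realM u z : complex.Re (u%:C%C * z) = u * complex.Re z.
Proof. by case: z => c e /=; rewrite mul0r subr0. Qed.
Lemma Im_realM u z : complex.Im (u%:C%C * z) = u * complex.Im z.
Proof. by case: z => c e /=; rewrite mul0r addr0. Qed.

Lemma rderiv_expC z t : rderiv (fun u => expC (u%:C%C * z)) t (z * expC (t%:C%C * z)).
Proof.
have Re_l u := Re_realM u z; have Im_l u := Im_realM u z.
set a := complex.Re z in Re_l *; set b := complex.Im z in Im_l *.
have lin c : is_derive t (1 : R) (fun u : R => u * c) c.
  have := is_deriveM (is_derive_id t (1 : R)) (is_derive_cst c t (1 : R)).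
  by rewrite scaler0 add0r /GRing.scale /= mulr1.
have E := @is_derive1_comp R expR (fun u => u * a) t _ _ (is_derive_expR (t * a)) (lin a).
have Cc := @is_derive1_comp R cos (fun u => u * b) t _ _ (is_derive_cos (t * b)) (lin b).
have Ss := @is_derive1_comp R sin (fun u => u * b) t _ _ (is_derive_sin (t * b)) (lin b).
split.
  have -> : (fun u => complex.Re (expC (u%:C%C * z)))
      = (expR \o (fun u => u * a)) * (cos \o (fun u => u * b)).
    by apply/funext => u; rewrite /expC /= Re_l Im_l.
  apply: (is_derive_eq (is_deriveM E Cc)).
  by rewrite /expC cReM Re_l Im_l /GRing.scale /= -/a -/b; ring.
have -> : (fun u => complex.Im (expC (u%:C%C * z)))
    = (expR \o (fun u => u * a)) * (sin \o (fun u => u * b)).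
  by apply/funext => u; rewrite /expC /= Re_l Im_l.
apply: (is_derive_eq (is_deriveM E Ss)).
by rewrite /expC cImM Re_l Im_l /GRing.scale /= -/a -/b; ring.
Qed.

Definition exp_remainder N z := expC z - \sum_(k < N) z ^+ k / k`!%:R.

Lemma rderiv_exp_remainder N z t :
  rderiv (fun u => exp_remainder N.+1 (u%:C%C * z)) t (z * exp_remainder N (t%:C%C * z)).
Proof.
rewrite /exp_remainder mulrBr; apply: rderivD; first exact: rderiv_expC.
apply: (rderiv_ext (y1 := fun u => -1 * \sum_(k < N.+1) (u%:C%C * z) ^+ k / k`!%:R)).
  by move=> u; rewrite mulN1r.
rewrite -[X in rderiv _ _ X]mulN1r; apply: rderivZ.
have -> : z * \sum_(k < N) (t%:C%C * z) ^+ k / k`!%:R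
    = 0 + \sum_(k < N) z * ((t%:C%C * z) ^+ k / k`!%:R).
  by rewrite add0r mulr_sumr.
apply: (rderiv_ext (y1 := fun u => 1 / 0`!%:R
    + \sum_(k < N) (u%:C%C * z) ^+ k.+1 / (k.+1)`!%:R)).
  by move=> u; rewrite big_ord_recl expr0.
apply: rderivD; first exact: rderiv_cst.
apply: rderiv_sum => k.
apply: (rderiv_ext (y1 := fun u => (k.+1`!%:R)^-1 * (u%:C%C * z) ^+ k.+1)).
  by move=> u; rewrite mulrC.
have -> : z * ((t%:C%C * z) ^+ k / k`!%:R)
    = (k.+1`!%:R)^-1 * (k.+1%:R * ((t%:C%C * z) ^+ k * z)).
  rewrite factS natrM invfM; have k0 : k.+1%:R != 0 :> C by rewrite pnatr_eq0.
  have f0 : k`!%:R != 0 :> C by rewrite pnatr_eq0 -lt0n fact_gt0.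
  by move: k.+1%:R k0 => w w0; field; rewrite f0 w0.
by apply: rderivZ; apply: rderivX; apply: rderiv_line.
Qed.

(** Along the segment from 0 to [z] the derivative of one remainder is [z] times the previous one,
    so each induction step costs a factor [2] from [rderiv_bound]. *)
Lemma exp_remainder_bound N z : nc z <= 1 ->
  nc (exp_remainder N z) <= 2 ^+ N * expR 1 * nc z ^+ N.
Proof.
elim: N z => [|N IH] z z1.
  rewrite /exp_remainder big_ord0 subr0 !expr0 mul1r mulr1 nc_expC ler_expR.
  exact: le_trans (ler_norm _) (le_trans (Re_le_nc _) z1).
have B t : 0 <= t <= 1 ->
    nc (z * exp_remainder N (t%:C%C * z)) <= 2 ^+ N * expR 1 * nc z ^+ N.+1.
  move=> /andP[t0 t1].
  have tz : nc (t%:C%C * z) <= nc z.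
    by rewrite ncM nc_real ger0_norm // ler_piMl ?normc_ge0.
  rewrite ncM exprS mulrCA; apply: ler_wpM2l; rewrite ?normc_ge0 //.
  apply: le_trans (IH _ (le_trans tz z1)) _; apply: ler_wpM2l.
    by rewrite mulr_ge0 ?exprn_ge0 ?expR_ge0.
  by apply: lerXn2r; rewrite ?nnegrE ?normc_ge0.
have := rderiv_bound (rderiv_exp_remainder N z) B (t := 1).
rewrite ler01 lexx mul1r mul0r {2}/exp_remainder expC0 big_ord_recl big1.
  rewrite expr0 fact0 divr1 addr0 subrr subr0 [2 ^+ N.+1]exprS -!mulrA; exact.
by move=> i _; rewrite expr0n mul0r.
Qed.

Lemma qderiv_expC z : qderiv (@expC R) z (expC z).
Proof.
exists (nc (expC z) * (2 ^+ 2 * expR 1)), 1 => //; split.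
  by rewrite !mulr_ge0 ?normc_ge0 ?exprn_ge0 ?expR_ge0.
move=> h /ltW h1; have -> : expC (z + h) - expC z - h * expC z
    = expC z * exp_remainder 2 h.
  by rewrite expCD /exp_remainder !big_ord_recl big_ord0 /= expr0 expr1 !divr1; ring.
by rewrite ncM -[leRHS]mulrA; apply: ler_wpM2l; rewrite ?normc_ge0 ?exp_remainder_bound.
Qed.

Lemma is_derive_rderiv (F : C^o -> C^o) (t : R) (d : C) :
  is_derive (t%:C%C : C^o) (1 : C^o) F d -> rderiv (fun u => F (u%:C%C)) t d.
Proof.
move=> FE.
have cv : ((fun h : C^o => h^-1 *: (F (h *: 1 + t%:C%C) - F t%:C%C)) @ 0^')
    --> (d : C^o).
  by rewrite -(derive_val (is_derive := FE)); apply: (@ex_derive _ _ _ _ _ _ _ FE).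
have cvR (eps : R) : 0 < eps -> exists2 r : R, 0 < r & forall h : R, h != 0 -> `|h| < r ->
    nc (h^-1%:C%C * (F ((h + t)%:C%C) - F t%:C%C) - d) < eps.
  move=> e0; move/cvgrPdist_lt : cv => /(_ eps%:C%C); rewrite ltcR => /(_ e0).
  move=> [r /= r0 rE]; have rR : r = (complex.Re r)%:C%C by rewrite RRe_real // gtr0_real.
  exists (complex.Re r); first by rewrite -ltcR -rR.
  move=> h h0 hr; rewrite ncBC -ltcR -nc_norm.
  have := rE h%:C%C; rewrite /ball_ /= sub0r normrN nc_norm nc_real rR ltcR => /(_ hr).
  have hc0 : (h%:C%C : C) != 0 by rewrite eq_complex /= eqxx andbT.
  move=> /(_ hc0); rewrite [_ *: 1]mulr1 -rmorphD -fmorphV; exact.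
have part (P : C -> R) (PD : forall x y, P (x - y) = P x - P y)
    (PZ : forall (a : R) x, P (a%:C%C * x) = a * P x) (Pn : forall x, `|P x| <= nc x) :
    is_derive t (1 : R) (fun u : R => P (F u%:C%C)) (P d).
  have cvP : ((fun h : R => h^-1 *: (P (F (h *: 1 + t)%:C%C) - P (F t%:C%C))) @ 0^')
      --> P d.
    apply/cvgrPdist_lt => eps e0; have [r r0 rE] := cvR _ e0.
    near=> h; rewrite distrC.
    have h0 : h != 0 by near: h; exact: nbhs_dnbhs_neq.
    have hr : `|h| < r by near: h; apply: dnbhs0_lt.
    apply: le_lt_trans (rE _ h0 hr); rewrite [h *: 1]mulr1 -PD.
    by rewrite /GRing.scale /= -PZ -PD; apply: Pn.
  have dv : derivable (fun u : R => P (F u%:C%C)) t (1 : R) by apply/cvg_ex; exists (P d).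
  by apply: DeriveDef => //; apply: (cvg_lim (@norm_hausdorff _ _) cvP).
split.
  apply: part => [x y|a x|x]; first by rewrite cReD cReN.
    exact: Re_realM.
  exact: Re_le_nc.
apply: part => [x y|a x|x]; first by rewrite cImD cImN.
  exact: Im_realM.
exact: Im_le_nc.
Unshelve. all: by end_near.
Qed.

End ComplexExponential.

(** * Geometrically convergent sums over square boxes *)

Section BoxSums.
Variable R : realType.
Local Notation C := R[i].
Local Notation nc := (@Normc.normc R).
Local Notation q := (2^-1 : R).

Lemma half_ge0 : 0 <= q. Proof. by rewrite invr_ge0. Qed.
Lemma halfX_ge0 k : 0 <= q ^+ k. Proof. by rewrite exprn_ge0 ?half_ge0. Qed.
Lemma le_geometric (a b K : R) : 0 <= K -> (forall N, a <= b + K * q ^+ N) -> a <= b.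
Proof.
move=> K0 ab; rewrite leNgt; apply/negP => ba.
have e0 : 0 < a - b by rewrite subr_gt0.
have := archi_boundP (divr_ge0 K0 (ltW e0)); set N := Num.bound _ => KN.
have NN : N%:R <= 2 ^+ N :> R by rewrite -natrX ler_nat ltnW // ltn_expl.
have := ab N; rewrite -lerBlDl leNgt => /negP; apply.
rewrite exprVn ltr_pdivrMr ?exprn_gt0 // mulrC -ltr_pdivrMr //.
exact: lt_le_trans KN NN.
Qed.

Lemma geom_le2 N : \sum_(i < N) q ^+ i <= 2.
Proof.
have E : \sum_(i < N) q ^+ i = 2 - 2 * q ^+ N.
  elim: N => [|N IH]; first by rewrite big_ord0 expr0; lra.
  by rewrite big_ord_recr /= IH exprS; lra.
by rewrite E lerBlDr lerDl mulr_ge0 ?halfX_ge0.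
Qed.

Definition box (c : nat -> nat -> C) N := \sum_(i < N.+1) \sum_(j < N.+1) c i j.

Lemma box_bound c (M : R) N : (forall i j, nc (c i j) <= M * q ^+ (i + j)) ->
  nc (box c N) <= 4 * M.
Proof.
move=> cM; have M0 : 0 <= M by have := cM 0 0; rewrite mulr1; apply: le_trans (normc_ge0 _).
apply: le_trans (nc_sum _ _ _) _.
apply: le_trans (_ : \sum_(i < N.+1) 2 * M * q ^+ i <= _).
  apply: ler_sum => i _; apply: le_trans (nc_sum _ _ _) _.
  apply: le_trans (_ : \sum_(j < N.+1) M * q ^+ i * q ^+ j <= _).
    by apply: ler_sum => j _; rewrite -mulrA -exprD.
  rewrite -mulr_sumr [leRHS](_ : _ = M * q ^+ i * 2); last by ring.
  by apply: ler_wpM2l; [rewrite mulr_ge0 ?halfX_ge0|exact: geom_le2].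
rewrite -mulr_sumr; have -> : 4 * M = 2 * M * 2 by ring.
by apply: ler_wpM2l; [rewrite mulr_ge0|exact: geom_le2].
Qed.

Lemma box_step c (M : R) N : (forall i j, nc (c i j) <= M * q ^+ (i + j)) ->
  nc (box c N.+1 - box c N) <= 2 * M * q ^+ N.
Proof.
move=> cM; have M0 : 0 <= M by have := cM 0 0; rewrite mulr1; apply: le_trans (normc_ge0 _).
have -> : box c N.+1 - box c N
    = \sum_(i < N.+1) c i N.+1 + \sum_(j < N.+2) c N.+1 j.
  rewrite /box [X in X - _]big_ord_recr /=.
  have -> : \sum_(i < N.+1) \sum_(j < N.+2) c i j
      = \sum_(i < N.+1) \sum_(j < N.+1) c i j + \sum_(i < N.+1) c i N.+1.
    by rewrite -big_split; apply: eq_bigr => i _; rewrite big_ord_recr.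
  ring.
apply: le_trans (ncD _ _) _.
have -> : 2 * M * q ^+ N = M * q ^+ N.+1 * 2 + M * q ^+ N.+1 * 2.
  by rewrite exprS; field.
apply: lerD; apply: le_trans (nc_sum _ _ _) _.
  apply: le_trans (_ : \sum_(i < N.+1) M * q ^+ N.+1 * q ^+ i <= _).
    by apply: ler_sum => i _; rewrite -mulrA -exprD addnC.
  by rewrite -mulr_sumr; apply: ler_wpM2l; [rewrite mulr_ge0 ?halfX_ge0|exact: geom_le2].
apply: le_trans (_ : \sum_(i < N.+2) M * q ^+ N.+1 * q ^+ i <= _).
  by apply: ler_sum => i _; rewrite -mulrA -exprD.
by rewrite -mulr_sumr; apply: ler_wpM2l; [rewrite mulr_ge0 ?halfX_ge0|exact: geom_le2].
Qed.

(** The intervals of radius [2 K 2^(-N)] around [u N] are nested; the limit is the supremum of their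
    left ends. *)
Lemma real_geometric_limit (u : nat -> R) (K : R) :
  (forall N, `|u N.+1 - u N| <= K * q ^+ N) ->
  exists l, forall N, `|u N - l| <= 2 * K * q ^+ N.
Proof.
move=> uK; have K0 : 0 <= K by have := uK 0; rewrite mulr1; apply: le_trans.
pose lo N := u N - 2 * K * q ^+ N; pose hi N := u N + 2 * K * q ^+ N.
have step N : lo N <= lo N.+1 /\ hi N.+1 <= hi N.
  have := uK N; rewrite /lo /hi ler_norml exprS => /andP[a b].
  have -> : 2 * K * (q * q ^+ N) = K * q ^+ N by field.
  by split; lra.
have lom N k : lo N <= lo (N + k)%N.
  by elim: k => [|k IH]; rewrite ?addn0 ?lexx // addnS (le_trans IH) // (step _).1.
have him N k : hi (N + k)%N <= hi N.
  by elim: k => [|k IH]; rewrite ?addn0 ?lexx // addnS (le_trans _ IH) // (step _).2.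
have lohi N : lo N <= hi N.
  by rewrite /lo /hi lerD2l -subr_ge0 opprK addr_ge0 // !mulr_ge0 ?halfX_ge0.
have lh N M : lo N <= hi M.
  by apply: le_trans (lom N M) _; apply: le_trans (lohi _) _; rewrite addnC.
have hs : has_sup (range lo).
  by split; [exists (lo 0); exists 0|exists (hi 0) => _ [N _ <-]].
exists (sup (range lo)) => N; rewrite ler_distl; apply/andP; split.
  by rewrite lerBlDr; apply: ge_sup; [case: hs|move=> _ [M _ <-]; exact: lh].
by rewrite -lerBlDr; apply: (sup_upper_bound hs); exists N.
Qed.

Lemma geometric_limit (u : nat -> C) (K : R) :
  (forall N, nc (u N.+1 - u N) <= K * q ^+ N) ->
  exists l, forall N, nc (u N - l) <= 4 * K * q ^+ N.
Proof.
move=> uK.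
have [a aE] : exists l, forall N, `|complex.Re (u N) - l| <= 2 * K * q ^+ N.
  apply: real_geometric_limit => N; rewrite -cReN -cReD.
  exact: le_trans (Re_le_nc _) (uK N).
have [b bE] : exists l, forall N, `|complex.Im (u N) - l| <= 2 * K * q ^+ N.
  apply: real_geometric_limit => N; rewrite -cImN -cImD.
  exact: le_trans (Im_le_nc _) (uK N).
exists (a +i* b)%C => N; apply: le_trans (nc_le_ReIm _) _.
rewrite cReD cImD cReN cImN.
have -> : 4 * K * q ^+ N = 2 * K * q ^+ N + 2 * K * q ^+ N by ring.
exact: lerD.
Qed.

Lemma geometric_limit_bound (u : nat -> C) (l : C) (K B : R) : 0 <= K ->
  (forall N, nc (u N - l) <= K * q ^+ N) -> (forall N, nc (u N) <= B) -> nc l <= B.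
Proof.
move=> K0 ul uB; apply: (le_geometric K0) => N.
have -> : l = u N - (u N - l) by ring.
by apply: le_trans (ncB _ _) _; apply: lerD.
Qed.

Lemma geometric_lim (u : nat -> C) (l : C) (K : R) : 0 <= K ->
  (forall N, nc (u N - l) <= K * q ^+ N) -> lim ((u : nat -> C^o) @ \oo) = l.
Proof.
move=> K0 ul; apply: (cvg_lim (@norm_hausdorff _ _)).
apply/cvgrPdist_lt => eps eps0.
have epsE : eps = (complex.Re eps)%:C%C by rewrite RRe_real // gtr0_real.
rewrite epsE ltcR in eps0 *; set e := complex.Re eps in eps0 *.
set N0 := Num.bound (K / e); exists N0 => // N /= N0N.
rewrite nc_norm ltcR ncBC; apply: le_lt_trans (ul N) _.
have KN : K / e < N0%:R by apply: archi_boundP; rewrite divr_ge0 // ltW.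
rewrite exprVn ltr_pdivrMr ?exprn_gt0 // mulrC -ltr_pdivrMr //.
apply: lt_le_trans KN _; apply: le_trans (_ : N%:R <= _); first by rewrite ler_nat.
by rewrite -natrX ler_nat ltnW // ltn_expl.
Qed.

(** Each term of a summable family of nonnegative numbers is at most the sum. Only these Cauchy
    estimates are used of convergence from here on. *)
Lemma convergent_bound n (p : fps C n) : convergent p ->
  exists M B : R, [/\ 0 < M, 1 <= B & forall a, nc (p a) <= M * B ^+ mdeg a].
Proof.
move=> [r [r0 rs]].
pose F (a : mexp n) := (nc (p a) * r ^+ mdeg a)%:E.
set S := (\esum_(a in [set: mexp n]) `|F a|)%E.
have Fa a : (`|F a| <= S)%E.
  apply: esum_ge; exists [set a]%classic; first by split => //; exact: finite_set1.
  by rewrite fsbig_set1.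
have S0 : (0 <= S)%E by apply: esum_ge0 => a _; exact: abse_ge0.
have Sfin : S \is a fin_num by rewrite ge0_fin_numE.
exists (fine S + 1), (Num.max 1 r^-1); split; first by rewrite ltr_wpDl // fine_ge0.
  by rewrite le_max lexx.
move=> a; have := Fa a; rewrite -(fineK Sfin) /= lee_fin => h.
apply: le_trans (_ : fine S * r^-1 ^+ mdeg a <= _).
  rewrite exprVn ler_pdivlMr ?exprn_gt0 //; apply: le_trans h; exact: ler_norm.
have r1 : 0 <= r^-1 by rewrite invr_ge0 ltW.
have rm : r^-1 <= Num.max 1 r^-1 by rewrite le_max lexx orbT.
apply: ler_pM; rewrite ?fine_ge0 ?exprn_ge0 ?lerDl //.
by apply: lerXn2r; rewrite ?nnegrE // (le_trans r1).
Qed.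

End BoxSums.

Lemma eq_lerW (A : numDomainType) (x y : A) : x = y -> x <= y.
Proof. by move=> ->. Qed.

Definition mexp2 i j : mexp 2 := [ffun k => pair_of i j k].

Lemma mexp2_0 i j : mexp2 i j ord0 = i.
Proof. by rewrite ffunE /pair_of eqxx. Qed.

Lemma mexp2_1 i j : mexp2 i j (lift ord0 ord0) = j.
Proof. by rewrite ffunE. Qed.

Lemma mexp2E (a : mexp 2) : a = mexp2 (a ord0) (a (lift ord0 ord0)).
Proof.
apply/ffunP => k; rewrite ffunE /pair_of; case: eqP => [->//|].
move=> k0; congr (a _); apply/val_inj; case: k k0 => -[|[|?]] //= lt k0.
by case: k0; apply/val_inj.
Qed.

Lemma mdeg_mexp2 i j : mdeg (mexp2 i j) = (i + j)%N.
Proof. by rewrite /mdeg !big_ord_recl big_ord0 addn0 mexp2_0 mexp2_1. Qed.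

Lemma sum_box2 (A : nmodType) (c : mexp 2 -> A) N :
  \sum_(b <- below [ffun=> N]) c b = \sum_(i < N.+1) \sum_(j < N.+1) c (mexp2 i j).
Proof.
have E : perm_eq (below ([ffun=> N] : mexp 2))
    [seq mexp2 (i : 'I_N.+1) (j : 'I_N.+1) | i <- enum 'I_N.+1, j <- enum 'I_N.+1].
  apply: uniq_perm; first exact: below_uniq.
    apply: allpairs_uniq; rewrite ?enum_uniq // => -[i j] [i' j'] _ _ /= E.
    have := congr1 (fun a : mexp 2 => a ord0) E; rewrite !mexp2_0 => /val_inj ->.
    by have := congr1 (fun a : mexp 2 => a (lift ord0 ord0)) E; rewrite !mexp2_1 => /val_inj ->.
  move=> b; rewrite mem_below; apply/forallP/allpairsP => [bN|[[i j] [_ _ ->]] k].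
    have b0 : (b ord0 < N.+1)%N by have := bN ord0; rewrite ffunE ltnS.
    have b1 : (b (lift ord0 ord0) < N.+1)%N.
      by have := bN (lift ord0 ord0); rewrite ffunE ltnS.
    by exists (Ordinal b0, Ordinal b1); rewrite !mem_enum; split=> //; apply: mexp2E.
  by rewrite !ffunE /pair_of; case: ifP => _; rewrite -ltnS.
rewrite (perm_big _ E) big_allpairs_dep /= big_enum; apply: eq_bigr => i _.
by rewrite big_enum.
Qed.

(** * Evaluation and differentiation of convergent series in two variables *)

Section EvalTwo.
Variable R : realType.
Local Notation C := R[i].
Local Notation nc := (@Normc.normc R).
Local Notation q := (2^-1 : R).
Implicit Types (p : fps C 2) (x y h : C) (M B : R).

Definition eval_term p x y i j : C := p (mexp2 i j) * (x ^+ i * y ^+ j).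

Definition fps_bounded M B p := forall a, nc (p a) <= M * B ^+ mdeg a.

Lemma eval_term_bound M B p x y i j : 0 <= M -> 0 < B -> fps_bounded M B p ->
  nc x <= (2 * B)^-1 -> nc y <= (2 * B)^-1 -> nc (eval_term p x y i j) <= M * q ^+ (i + j).
Proof.
move=> M0 B0 pB xB yB; rewrite !ncM !ncX.
have b0 : 0 <= (2 * B)^-1 by rewrite invr_ge0 mulr_ge0 // ltW.
have -> : M * q ^+ (i + j) = M * B ^+ (i + j) * ((2 * B)^-1 ^+ i * (2 * B)^-1 ^+ j).
  by rewrite -exprD -mulrA -exprMn invfM mulrCA mulfV ?gt_eqF // mulr1.
apply: ler_pM; rewrite ?normc_ge0 ?mulr_ge0 ?exprn_ge0 ?normc_ge0 //.
  by have := pB (mexp2 i j); rewrite mdeg_mexp2.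
by apply: ler_pM; rewrite ?exprn_ge0 ?normc_ge0 // lerXn2r ?nnegrE ?normc_ge0.
Qed.

Lemma fps_eval_box M B p x y N : 0 <= M -> 0 < B -> fps_bounded M B p ->
  nc x <= (2 * B)^-1 -> nc y <= (2 * B)^-1 ->
  nc (box (eval_term p x y) N - fps_eval p (pair_of x y)) <= 8 * M * q ^+ N.
Proof.
move=> M0 B0 pB xB yB.
have cM i j := @eval_term_bound M B p x y i j M0 B0 pB xB yB.
have [l lE] := geometric_limit (fun N => box_step N cM).
have E : 4 * (2 * M) = 8 * M by ring.
rewrite E in lE; suff -> : fps_eval p (pair_of x y) = l by apply: lE.
apply: (@geometric_lim _ _ _ (8 * M)); first by rewrite mulr_ge0.
move=> k; have := lE k; congr (nc (_ - _) <= _); rewrite sum_box2.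
apply: eq_bigr => i _; apply: eq_bigr => j _; rewrite /eval_term.
by rewrite !big_ord_recl big_ord0 mulr1 mexp2_0 mexp2_1.
Qed.

(** The factor [k + 1] produced by differentiation is at most [2^k], so doubling the ratio absorbs
    it. *)
Lemma fps_bounded_deriv M B p : 0 <= M -> 1 <= B -> fps_bounded M B p ->
  fps_bounded (M * B) (2 * B) (fps_deriv ord0 p).
Proof.
move=> M0 B1 pB a; rewrite fps_derivE ncM nc_nat.
have := pB (mexpD a (mexp1 ord0)); rewrite mdegD mdeg1 addn1 => h.
have B0 : 0 <= B by apply: le_trans B1.
apply: le_trans (_ : 2 ^+ mdeg a * (M * B ^+ (mdeg a).+1) <= _).
  apply: ler_pM; rewrite ?ler0n ?normc_ge0 // -natrX ler_nat.
  exact: leq_ltn_trans (leq_mdeg a ord0) (ltn_expl _ _).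
by rewrite exprMn exprS; apply: eq_lerW; ring.
Qed.

(** The remainder keeps a geometric form in [i], so it can be summed against the coefficients of a
    bounded series. *)
Lemma taylor1_bound x h (r : R) i : 0 < r -> nc x <= r -> nc (x + h) <= r ->
  nc ((x + h) ^+ i - x ^+ i - h * (i%:R * x ^+ i.-1)) <= nc h ^+ 2 * r ^- 2 * (2 * r) ^+ i.
Proof.
move=> r0 xr xhr; elim: i => [|i IH].
  by rewrite !expr0 subrr mul0r mulr0 subr0 nc0 mulr1 mulr_ge0 ?exprn_ge0 ?invr_ge0 ?exprn_ge0 ?normc_ge0 // ltW.
have -> : (x + h) ^+ i.+1 - x ^+ i.+1 - h * (i.+1%:R * x ^+ i.+1.-1)
    = (x + h) * ((x + h) ^+ i - x ^+ i - h * (i%:R * x ^+ i.-1))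
      + h ^+ 2 * (i%:R * x ^+ i.-1).
  case: i {IH} => [|i] /=; first by rewrite !expr0 !expr1; ring.
  have -> : i.+2%:R = i.+1%:R + 1 :> C by rewrite -[i.+2]addn1 natrD.
  by rewrite !exprS; move: (i.+1%:R) => u; ring.
apply: le_trans (ncD _ _) _; rewrite !ncM !ncX nc_nat.
set H := nc h ^+ 2; have H0 : 0 <= H by rewrite exprn_ge0 ?normc_ge0.
have ri : 0 <= r by apply: ltW.
have -> : H * r ^- 2 * (2 * r) ^+ i.+1
    = r * (H * r ^- 2 * (2 * r) ^+ i) + H * (r ^- 2 * (2 * r) ^+ i * r).
  by rewrite [(2 * r) ^+ _]exprS; ring.
apply: lerD; first by apply: ler_pM; rewrite ?normc_ge0.
apply: ler_wpM2l => //.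
case: i {IH} => [|i]; first by rewrite mul0r !mulr_ge0 ?invr_ge0 ?exprn_ge0 ?mulr_ge0.
apply: le_trans (_ : 2 ^+ i.+1 * r ^+ i <= _).
  apply: ler_pM; rewrite ?ler0n ?exprn_ge0 ?normc_ge0 //.
    by rewrite -natrX ler_nat ltnW // ltn_expl.
  by apply: lerXn2r; rewrite ?nnegrE ?normc_ge0.
apply: eq_lerW; rewrite exprMn [r ^+ i.+1]exprS expr2; field.
by rewrite gt_eqF.
Qed.

(** First-order Taylor remainders are summed term by term over each box, uniformly in its size,
    before passing to the limit. *)
Lemma qderiv_eval M B p x y : 0 <= M -> 1 <= B -> fps_bounded M B p ->
  nc x < (4 * B)^-1 -> nc y <= (4 * B)^-1 ->
  qderiv (fun x => fps_eval p (pair_of x y)) x (fps_eval (fps_deriv ord0 p) (pair_of x y)).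
Proof.
move=> M0 B1 pB xr yr; have B0 : 0 < B by apply: lt_le_trans B1.
set r := (4 * B)^-1 in xr yr; have r0 : 0 < r by rewrite invr_gt0 mulr_gt0.
have rle : r <= (2 * B)^-1.
  by rewrite /r lef_pV2 ?posrE ?mulr_gt0 //; apply: ler_wpM2r; [exact: ltW|rewrite ler_nat].
have rle' : r <= (2 * (2 * B))^-1 by rewrite mulrA -natrM.
have dB := fps_bounded_deriv M0 B1 pB.
exists (4 * (M * r ^- 2)), (r - nc x); first by rewrite subr_gt0.
split; first by rewrite !mulr_ge0 ?invr_ge0 ?exprn_ge0 // ltW.
move=> h hr; have xhr : nc (x + h) <= r.
  by apply: le_trans (ncD _ _) _; rewrite addrC -lerBrDr ltW.
have xr' := ltW xr.
have e1 N := @fps_eval_box M B p (x + h) y N M0 B0 pB (le_trans xhr rle) (le_trans yr rle).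
have e2 N := @fps_eval_box M B p x y N M0 B0 pB (le_trans xr' rle) (le_trans yr rle).
have MB0 : 0 <= M * B by apply: mulr_ge0 => //; exact: ltW.
have BB0 : 0 < 2 * B by rewrite mulr_gt0.
have e3 N := @fps_eval_box (M * B) (2 * B) _ x y N MB0 BB0 dB
  (le_trans xr' rle') (le_trans yr rle').
pose d i j := p (mexp2 i j) * (((x + h) ^+ i - x ^+ i - h * (i%:R * x ^+ i.-1)) * y ^+ j).
pose c' i j := p (mexp2 i j) * ((i%:R * x ^+ i.-1) * y ^+ j).
have dE N : box d N = box (eval_term p (x + h) y) N - box (eval_term p x y) N - h * box c' N.
  rewrite /box mulr_sumr -!sumrB; apply: eq_bigr => i _.
  rewrite mulr_sumr -!sumrB; apply: eq_bigr => j _.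
  by rewrite /d /c' /eval_term; ring.
(* Differentiating a box term by term misses the row [i = N] of the box of the derived series;
   [last] shows that this row is geometrically small. *)
have c'E N : box c' N = box (eval_term (fps_deriv ord0 p) x y) N
    - \sum_(j < N.+1) eval_term (fps_deriv ord0 p) x y N j.
  rewrite /box [\sum_(i < N.+1) \sum_(j < _) c' i j]big_ord_recl big1 ?add0r; last first.
    by move=> j _; rewrite /c' /= mul0r mul0r mulr0.
  rewrite [X in X - _]big_ord_recr /= addrK; apply: eq_bigr => i _.
  apply: eq_bigr => j _; rewrite /c' /eval_term fps_derivE mexp2_0 /=.
  have -> : mexpD (mexp2 i j) (mexp1 ord0) = mexp2 i.+1 j.
    by apply/ffunP => k; rewrite !ffunE /pair_of; case: eqP; rewrite ?addn1 ?addn0.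
  by rewrite /bump leq0n add1n /=; ring.
have last N : nc (\sum_(j < N.+1) eval_term (fps_deriv ord0 p) x y N j) <= 2 * (M * B) * q ^+ N.
  apply: le_trans (nc_sum _ _ _) _.
  apply: le_trans (_ : \sum_(j < N.+1) M * B * q ^+ N * q ^+ j <= _).
    apply: ler_sum => j _; rewrite -mulrA -exprD.
    apply: (eval_term_bound N j MB0 BB0 dB); [exact: le_trans rle'|exact: le_trans rle'].
  rewrite -mulr_sumr [leRHS](_ : _ = M * B * q ^+ N * 2); last by ring.
  by apply: ler_wpM2l; [rewrite mulr_ge0 ?halfX_ge0|exact: geom_le2].
have dM i j : nc (d i j) <= M * r ^- 2 * nc h ^+ 2 * q ^+ (i + j).
  rewrite /d !ncM ncX; have rB : 2 * r * B = q.
    by rewrite /r; field; rewrite gt_eqF.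
  have -> : M * r ^- 2 * nc h ^+ 2 * q ^+ (i + j)
      = (M * B ^+ (i + j)) * ((nc h ^+ 2 * r ^- 2 * (2 * r) ^+ i) * (2 * r) ^+ j).
    by rewrite -rB exprMn !exprD; ring.
  have r2 : 0 <= 2 * r by rewrite mulr_ge0 ?ltW.
  apply: ler_pM; rewrite ?normc_ge0 ?mulr_ge0 ?exprn_ge0 ?normc_ge0 //.
    by have := pB (mexp2 i j); rewrite mdeg_mexp2.
  apply: ler_pM; rewrite ?normc_ge0 ?exprn_ge0 ?normc_ge0 ?taylor1_bound //.
  have rr : r <= 2 * r by rewrite mulr_natl mulr2n lerDl ltW.
  by apply: lerXn2r; rewrite ?nnegrE ?normc_ge0 // (le_trans yr rr).
pose K := 8 * M + 8 * M + nc h * (8 * (M * B) + 2 * (M * B)).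
apply: (@geometric_limit_bound _ (box d) _ K).
- rewrite /K; have M8 : 0 <= 8 * M by apply: mulr_ge0.
  apply: addr_ge0; first exact: addr_ge0.
  by apply: mulr_ge0; rewrite ?normc_ge0 // addr_ge0 // mulr_ge0.
- move=> N; rewrite dE c'E.
  have := last N; have := e3 N; have := e2 N; have := e1 N.
  set b1 := box (eval_term p (x + h) y) N; set a1 := fps_eval p (pair_of (x + h) y).
  set b2 := box (eval_term p x y) N; set a2 := fps_eval p (pair_of x y).
  set b3 := box _ N; set a3 := fps_eval _ (pair_of x y); set L := \sum_(_ < _) _.
  move=> E1 E2 E3 E4.
  have -> : b1 - b2 - h * (b3 - L) - (a1 - a2 - h * a3)
      = (b1 - a1) - (b2 - a2) - h * ((b3 - a3) - L) by ring.
  rewrite /K [leRHS]mulrDl; apply: le_trans (ncB _ _) _; apply: lerD.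
    by rewrite mulrDl; apply: le_trans (ncB _ _) _; apply: lerD.
  rewrite ncM -mulrA; apply: ler_wpM2l; rewrite ?normc_ge0 // mulrDl.
  by apply: le_trans (ncB _ _) _; apply: lerD.
by move=> N; have := box_bound N dM; rewrite !mulrA.
Qed.

End EvalTwo.

(** * Asymptotic expansions at the origin from the right *)

Section Asymptotics.
Variable R : realType.
Local Notation C := R[i].
Local Notation nc := (@Normc.normc R).
Local Notation q := (2^-1 : R).
Implicit Types (G H : R -> C) (P Q : fps C 1) (e : R).

Definition psum N P e : C := \sum_(k < N) ucoef P k * e%:C%C ^+ k.

(* [O(e ^ N)] as [e] decreases to 0. *)
Definition bigO N G := exists K : R, exists2 delta : R, 0 < delta &
  forall e, 0 < e < delta -> nc (G e) <= K * e ^+ N.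

(* [P] is the asymptotic expansion of [G] as [e] decreases to 0. *)
Definition asy G P := forall N, bigO N (fun e => G e - psum N P e).

Lemma bigO_ext N G H (r : R) : 0 < r -> (forall e, 0 < e < r -> G e = H e) ->
  bigO N G -> bigO N H.
Proof.
move=> r0 GH [K [d d0 GK]]; exists K, (Num.min r d); first by rewrite lt_min r0.
by move=> e; rewrite lt_min => /and3P[e0 er ed]; rewrite -GH ?e0 // GK // e0.
Qed.

Lemma bigOD N G H : bigO N G -> bigO N H -> bigO N (fun e => G e + H e).
Proof.
move=> [K [d d0 GK]] [L [r r0 HL]]; exists (K + L), (Num.min d r).
  by rewrite lt_min d0.
move=> e; rewrite lt_min => /and3P[e0 ed er]; apply: le_trans (ncD _ _) _.
by rewrite mulrDl lerD ?GK ?HL ?e0.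
Qed.

Lemma bigOM N M G H : bigO N G -> bigO M H -> bigO (N + M) (fun e => G e * H e).
Proof.
move=> [K [d d0 GK]] [L [r r0 HL]]; exists (K * L), (Num.min d r).
  by rewrite lt_min d0.
move=> e; rewrite lt_min => /and3P[e0 ed er]; rewrite ncM exprD mulrACA.
by apply: ler_pM; rewrite ?normc_ge0 ?GK ?HL ?e0.
Qed.

Lemma bigO_cst c : bigO 0 (fun=> c).
Proof. by exists (nc c), 1 => // e _; rewrite mulr1. Qed.

Lemma bigO_id : bigO 1 (fun e => e%:C%C).
Proof.
by exists 1, 1 => // e /andP[e0 _]; rewrite nc_real mul1r expr1 ger0_norm // ltW.
Qed.

Lemma bigOW N M G : (N <= M)%N -> bigO M G -> bigO N G.
Proof.
move=> NM [K [d d0 GK]]; exists `|K|, (Num.min d 1); first by rewrite lt_min d0 ltr01.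
move=> e; rewrite lt_min => /and3P[e0 ed e1].
apply: le_trans (GK e _) _; first by rewrite e0.
apply: le_trans (_ : `|K| * e ^+ M <= _).
  by apply: ler_wpM2r; rewrite ?ler_norm // exprn_ge0 // ltW.
by apply: ler_wpM2l => //; apply: ler_wiXn2l; rewrite ?ltW.
Qed.

Lemma bigO0 N : bigO N (fun=> 0).
Proof. by exists 0, 1 => // e _; rewrite nc0 mul0r. Qed.

Lemma bigON N G : bigO N G -> bigO N (fun e => - G e).
Proof. by move=> [K [d d0 GK]]; exists K, d => // e ed; rewrite ncN GK. Qed.

Lemma bigO_sum N J (r : seq J) (G : J -> R -> C) :
  (forall i, bigO N (G i)) -> bigO N (fun e => \sum_(i <- r) G i e).
Proof.
move=> GN; elim: r => [|i r IH].
  by apply: bigO_ext (bigO0 N) => // e _; rewrite big_nil.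
apply: (@bigO_ext _ (fun e => G i e + \sum_(i <- r) G i e) _ 1) => // [e _|].
  by rewrite big_cons.
exact: bigOD.
Qed.

Lemma bigO_monomial c k : bigO k (fun e => c * e%:C%C ^+ k).
Proof.
elim: k => [|k IH].
  by apply: bigO_ext (bigO_cst c) => // e _; rewrite expr0 mulr1.
apply: (@bigO_ext _ (fun e => e%:C%C * (c * e%:C%C ^+ k)) _ 1) => // [e _|].
  by rewrite exprS mulrCA.
exact: (bigOM bigO_id IH).
Qed.

Lemma bigO_horner N (p : {poly C}) : (forall k, (k < N)%N -> p`_k = 0) ->
  bigO N (fun e => p.[e%:C%C]).
Proof.
move=> pN; apply: (@bigO_ext _ (fun e => \sum_(i < size p) p`_i * e%:C%C ^+ i) _ 1) => //.
  by move=> e _; rewrite horner_coef.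
apply: bigO_sum => i; have [iN|Ni] := ltnP i N.
  by rewrite pN //; apply: bigO_ext (bigO0 N) => // e _; rewrite mul0r.
exact: bigOW Ni (bigO_monomial _ _).
Qed.

Definition ptrunc N P : {poly C} := \poly_(k < N) ucoef P k.

Lemma psum_horner N P e : psum N P e = (ptrunc N P).[e%:C%C].
Proof. by rewrite horner_poly. Qed.

Lemma asyE G P :
  asy G P <-> forall N, bigO N (fun e => G e - (ptrunc N P).[e%:C%C]).
Proof.
by split=> GP N; apply: bigO_ext (GP N) => // e _; rewrite psum_horner.
Qed.

Lemma asy_bounded G P : asy G P -> bigO 0 G.
Proof.
move=> /(_ 0%N); apply: bigO_ext => // e _.
by rewrite /psum big_ord0 subr0.
Qed.

Lemma asyD G H P Q : asy G P -> asy H Q -> asy (fun e => G e + H e) (P + Q).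
Proof.
move=> GP HQ N; apply: bigO_ext (bigOD (GP N) (HQ N)) => // e _.
rewrite addrACA -opprD; congr (_ - _); rewrite /psum -big_split /=.
by apply: eq_bigr => k _; rewrite mulrDl.
Qed.

Lemma asyN G P : asy G P -> asy (fun e => - G e) (- P).
Proof.
move=> GP N; apply: bigO_ext (bigON (GP N)) => // e _.
rewrite opprB addrC; congr (_ + _); rewrite /psum -sumrN.
by apply: eq_bigr => k _; rewrite ucoefN mulNr opprK.
Qed.

Lemma asyB G H P Q : asy G P -> asy H Q -> asy (fun e => G e - H e) (P - Q).
Proof. by move=> GP HQ; apply: asyD => //; apply: asyN. Qed.

Lemma asyM G H P Q : asy G P -> asy H Q -> asy (fun e => G e * H e) (P * Q).
Proof.
move=> GP HQ; apply/asyE => N; have {}HQ0 := asy_bounded HQ.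
move/asyE: GP => /(_ N) GP; move/asyE: HQ => /(_ N) HQ.
have pb : bigO 0 (fun e => (ptrunc N P).[e%:C%C]) by apply: bigO_horner.
have t : bigO N (fun e => (ptrunc N P * ptrunc N Q - ptrunc N (P * Q)).[e%:C%C]).
  apply: bigO_horner => k kN; rewrite coefB coefM coef_poly kN ucoefM.
  apply/eqP; rewrite subr_eq0; apply/eqP; apply: eq_bigr => i _.
  rewrite !coef_poly (leq_ltn_trans _ kN) ?(leq_ltn_trans _ kN) ?leq_subr //.
  by rewrite -ltnS.
have h1 := bigOM GP HQ0; rewrite addn0 in h1.
have h2 := bigOM pb HQ; rewrite add0n in h2.
apply: bigO_ext (bigOD (bigOD h1 h2) t) => // e _.
by rewrite hornerD hornerN hornerM; ring.
Qed.

Lemma asyC c : asy (fun=> c) (fpsC 1 c).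
Proof.
case=> [|N]; first by apply: bigO_ext (bigO_cst c) => // e _; rewrite /psum big_ord0 subr0.
apply: bigO_ext (bigO0 N.+1) => // e _.
rewrite /psum big_ord_recl big1 ?addr0 ?ucoefC ?expr0 ?mulr1 ?subrr // => i _.
by rewrite ucoefC mul0r.
Qed.

Lemma asyX : asy (fun e => e%:C%C) (fpsX C (ord0 : 'I_1)).
Proof.
have cX k : ucoef (fpsX C (ord0 : 'I_1)) k = (k == 1%N)%:R.
  by rewrite -[fpsX _ _]mulr1 ucoefXM; case: k => [|[|k]] //; rewrite ucoefC.
case=> [|[|N]].
- by apply: bigO_ext (bigOW (leq0n 1) bigO_id) => // e _; rewrite /psum big_ord0 subr0.
- by apply: bigO_ext bigO_id => // e _; rewrite /psum big_ord1 cX mul0r subr0.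
apply: bigO_ext (bigO0 N.+2) => // e _.
rewrite /psum !big_ord_recl big1 => [|i _]; last by rewrite cX mul0r.
by rewrite !cX mul0r add0r mul1r expr1 addr0 subrr.
Qed.

Lemma asyXn G P k : asy G P -> asy (fun e => G e ^+ k) (P ^+ k).
Proof.
move=> GP; elim: k => [|k IH]; first exact: asyC.
apply: (@eq_rect _ (fun e => G e * G e ^+ k) (fun G => asy G _)).
  by rewrite exprS; apply: asyM.
by apply/funext => e; rewrite exprS.
Qed.

Lemma asy_sum J (r : seq J) (G : J -> R -> C) (P : J -> fps C 1) :
  (forall i, asy (G i) (P i)) ->
  asy (fun e => \sum_(i <- r) G i e) (\sum_(i <- r) P i).
Proof.
move=> GP; elim: r => [|i r IH].
  rewrite big_nil; have -> : (fun e => \sum_(i <- [::]) G i e) = fun=> 0.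
    by apply/funext => e; rewrite big_nil.
  by rewrite -fpsC0; apply: asyC.
rewrite big_cons.
have -> : (fun e => \sum_(j <- i :: r) G j e) = (fun e => G i e + \sum_(j <- r) G j e).
  by apply/funext => e; rewrite big_cons.
exact: asyD.
Qed.

(** As [G] is [O(e)], the Taylor remainder of order [N] is [O(e^N)]; below degree [N] the
    exponential series agrees with its truncation [E]. *)
Lemma asy_expC G P : ucoef P 0 = 0 -> asy G P -> asy (fun e => expC (G e)) (fps_exp P).
Proof.
move=> P0 GP N.
have G1 : bigO 1 G.
  by apply: bigO_ext (GP 1%N) => // e _; rewrite /psum big_ord1 P0 mul0r subr0.
have [K [d d0 GK]] := G1.
have rem : bigO N (fun e => exp_remainder N (G e)).
  exists (2 ^+ N * expR 1 * `|K| ^+ N), (Num.min d (`|K| + 1)^-1).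
    by rewrite lt_min d0 invr_gt0 ltr_wpDl.
  move=> e; rewrite lt_min => /and3P[e0 ed eK].
  have Ke : nc (G e) <= `|K| * e.
    apply: le_trans (GK e _) _; first by rewrite e0.
    by rewrite expr1; apply: ler_wpM2r; rewrite ?ler_norm // ltW.
  have Ke1 : `|K| * e <= 1.
    apply: le_trans (_ : (`|K| + 1) * e <= _); first by rewrite ler_wpM2r ?lerDl // ltW.
    by rewrite mulrC -ler_pdivlMr ?div1r ?ltW // ltr_wpDl.
  apply: le_trans (exp_remainder_bound N (le_trans Ke Ke1)) _.
  rewrite -[leRHS]mulrA -exprMn; apply: ler_wpM2l.
    by rewrite mulr_ge0 ?exprn_ge0 ?expR_ge0.
  by apply: lerXn2r; rewrite ?nnegrE ?normc_ge0 ?mulr_ge0 // ltW.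
pose E := \sum_(k < N) fpsC 1 (k`!%:R)^-1 * P ^+ k.
have EE : asy (fun e => \sum_(k < N) (k`!%:R)^-1 * G e ^+ k) E.
  by apply: asy_sum => k; apply: asyM; [exact: asyC|exact: asyXn].
apply: bigO_ext (bigOD rem (EE N)) => // e _.
have -> : psum N (fps_exp P) e = psum N E e.
  apply: eq_bigr => k _; congr (_ * _).
  have Pv : vanish 1 P by apply/vanish_const.
  have -> : ucoef (fps_exp P) k = \sum_(j < k.+1) (j`!%:R)^-1 * ucoef (P ^+ j) k.
    by rewrite {1}/ucoef /fps_exp [LHS]/= mdeg_ord1 ffunE.
  rewrite /E ucoef_sum.
  rewrite (big_ord_widen N (fun j => (j`!%:R)^-1 * ucoef (P ^+ j) k)) // big_mkcond.
  apply: eq_bigr => j _; rewrite ucoefCM; case: ltnP => // kj.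
  have /vanish_ucoef -> : vanish (j * 1) (P ^+ j) by apply: vanishX.
    by rewrite mulr0.
  by rewrite muln1.
rewrite /exp_remainder addrA; congr (_ - _).
rewrite -addrA -[RHS]addr0; congr (_ + _); rewrite addrC -sumrB big1 // => k _.
by rewrite mulrC subrr.
Qed.

(** If all lower coefficients vanish, the next one is at most [K e] in norm for every small [e]. *)
Lemma asy_uniq0 P (r : R) G : 0 < r -> (forall e, 0 < e < r -> G e = 0) -> asy G P -> P = 0.
Proof.
move=> r0 G0 GP; apply: ucoef_inj; elim/ltn_ind => N IH.
have [K [d d0 PK]] := GP N.+1.
have PN e : 0 < e < Num.min r d -> nc (ucoef P N) <= K * e.
  rewrite lt_min => /and3P[e0 er ed]; have := PK e; rewrite e0 ed => /(_ isT).
  rewrite G0 ?e0 // sub0r ncN /psum big_ord_recr /= big1 => [|i _]; last by rewrite IH ?mul0r.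
  by rewrite add0r ncM ncX nc_real (ger0_norm (ltW e0)) exprS mulrA ler_pM2r // exprn_gt0.
apply/nc_eq0/eqP; rewrite eq_le normc_ge0 andbT leNgt; apply/negP => a0.
set a := nc _ in PN a0; set r' := Num.min r d in PN.
have r'0 : 0 < r' by rewrite lt_min r0.
pose e := Num.min (r' / 2) (a / (2 * (`|K| + 1))).
have K1 : 0 < `|K| + 1 by rewrite ltr_wpDl.
have e0 : 0 < e by rewrite lt_min !divr_gt0 // mulr_gt0.
have er : e < r' by rewrite gt_min ltr_pdivrMr // ltr_pMr // ltr1n.
have ea : e * (2 * (`|K| + 1)) <= a by rewrite -ler_pdivlMr ?mulr_gt0 // ge_min lexx orbT.
have := PN e; rewrite e0 er => /(_ isT) h.
have : a <= (`|K| + 1) * e.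
  apply: le_trans h _; apply: ler_wpM2r; first exact: ltW.
  by apply: le_trans (ler_norm K) _; rewrite lerDl.
by move: (mulr_gt0 K1 e0) ea; rewrite mulrCA [e * _]mulrC; lra.
Qed.

End Asymptotics.

Lemma sum_diagonal (A : nmodType) (t : nat -> nat -> A) N K : (N <= K)%N ->
  \sum_(i < K.+1) \sum_(j < K.+1) (if (i + j == N)%N then t i j else 0)
  = \sum_(i < N.+1) t i (N - i)%N.
Proof.
move=> NK; rewrite (big_ord_widen K.+1 (fun i => t i (N - i)%N)) // [RHS]big_mkcond.
apply: eq_bigr => i _; case: ltnP => [iN|Ni]; last first.
  by rewrite big1 // => j _; rewrite gtn_eqF // (leq_trans Ni) ?leq_addr.
have jK : (N - i < K.+1)%N by rewrite ltnS (leq_trans (leq_subr _ _)).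
rewrite (bigD1 (Ordinal jK)) //= subnKC -1?ltnS // eqxx big1 ?addr0 // => j jN.
case: eqP => // ij; case/negP: jN; apply/eqP/val_inj => /=.
by rewrite -ij addKn.
Qed.

(** * Restriction of a series in two variables to lines through the origin *)

Section Line.
Variable R : realType.
Local Notation C := R[i].
Local Notation nc := (@Normc.normc R).
Local Notation q := (2^-1 : R).
Local Notation X := (fpsX C (ord0 : 'I_1)).
Implicit Types (p : fps C 2) (u : C).

Definition line u : 'I_2 -> fps C 1 := pair_of (fpsC 1 u * X) X.

Lemma line_const u i : line u i (mexp0 1) = 0.
Proof.
by rewrite /line /pair_of; case: ifP => _; rewrite ?fpsCM_coef fpsX_const ?mulr0.
Qed.

Lemma line_coef u p n :
  ucoef (fps_subst (line u) p) n = \sum_(i < n.+1) p (mexp2 i (n - i)) * u ^+ i.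
Proof.
rewrite /ucoef (fps_substE (line_const u) _ (leqnn _)) mdeg_ord1 ffunE sum_box2.
rewrite -(sum_diagonal (fun i j => p (mexp2 i j) * u ^+ i) (leqnn n)).
apply: eq_bigr => i _; apply: eq_bigr => j _.
rewrite !big_ord_recl big_ord0 mulr1 mexp2_0 mexp2_1.
have -> : line u ord0 = fpsC 1 u * X by [].
have -> : line u (lift ord0 ord0) = X by [].
rewrite exprMn -mulrA -exprD -[X ^+ _]mulr1.
have -> : fpsC 1 u ^+ i = fpsC 1 (u ^+ i) :> fps C 1.
  by elim: (nat_of_ord i) => [|k IH]; rewrite ?expr0 // !exprS IH fpsC_mul.
transitivity (p (mexp2 i j) * ucoef (fpsC 1 (u ^+ i) * (X ^+ (i + j) * 1)) n).
  by [].
rewrite ucoefCM ucoefXnM -fpsC1 ucoefC.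
case: (eqVneq (i + j)%N n) => [E|/eqP ij].
  by rewrite (eq_leq E) subn_eq0 (eq_leq (esym E)) mulr1.
case: leqP => h; last by rewrite !mulr0.
by rewrite subn_eq0; case: leqP => h'; rewrite ?mulr0 //; case: ij; lia.
Qed.

Lemma poly_eq0_eval (P : {poly C}) : (forall x, P.[x] = 0) -> P = 0.
Proof.
move=> P0; apply/eqP; apply/negPn/negP => Pn0.
pose rs := [seq k%:R : C | k <- iota 0 (size P)].
have := @max_poly_roots _ P rs Pn0; rewrite size_map size_iota ltnn => H.
suff : false by []; apply: H; first by apply/allP => x _; apply/eqP.
by rewrite map_inj_uniq ?iota_uniq // => a b /eqP; rewrite eqr_nat => /eqP.
Qed.

(** The [n]-th coefficient on the line of slope [u] is a polynomial in [u] whose coefficients are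
    those of the degree [n] part of [p]; vanishing for all [u], it is zero. *)
Lemma line_eq0 p : (forall u, fps_subst (line u) p = 0) -> p = 0.
Proof.
move=> p0; apply/fpsP => a; rewrite (mexp2E a).
set i := a _; set j := a _.
pose P : {poly C} := \poly_(k < (i + j).+1) p (mexp2 k (i + j - k)).
have P0 : P = 0.
  apply: poly_eq0_eval => u; rewrite horner_poly -line_coef p0.
  by [].
have := congr1 (fun P : {poly C} => P`_i) P0.
by rewrite coef_poly ltnS leq_addr addKn coef0.
Qed.

(** Terms of total degree below [N] form the partial sum of the restricted series; the others,
    collected in [hi], are bounded by [(2 A e)^N] times a convergent geometric sum. *)
Lemma asy_eval M B p u : 0 <= M -> 1 <= B -> fps_bounded M B p ->
  asy (fun e => fps_eval p (pair_of (u * e%:C%C) e%:C%C)) (fps_subst (line u) p).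
Proof.
move=> M0 B1 pB N; have B0 : 0 < B by apply: lt_le_trans B1.
pose A := B * (1 + nc u); have u1 : 1 <= 1 + nc u by rewrite lerDl normc_ge0.
have A0 : 0 < A by rewrite mulr_gt0 // (lt_le_trans _ u1).
have BA : B <= A by rewrite /A ler_peMr // ltW.
exists (4 * M * (2 * A) ^+ N), (2 * A)^-1; first by rewrite invr_gt0 mulr_gt0.
move=> e /andP[e0 eA]; have e0' := ltW e0.
have eB : e <= (2 * B)^-1.
  have A20 : 0 < 2 * A by apply: mulr_gt0.
  have B20 : 0 < 2 * B by apply: mulr_gt0.
  by apply: le_trans (ltW eA) _; rewrite lef_pV2 ?posrE //; apply: ler_wpM2l.
have ne : nc e%:C%C = e by rewrite nc_real ger0_norm.
have uA : nc (u * e%:C%C) <= A / B * e.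
  rewrite ncM ne; apply: ler_wpM2r => //.
  by rewrite /A mulrAC mulfV ?gt_eqF // mul1r lerDr.
have uB : nc (u * e%:C%C) <= (2 * B)^-1.
  apply: le_trans uA _; apply: le_trans (_ : A / B * (2 * A)^-1 <= _).
    by apply: ler_wpM2l; [rewrite divr_ge0 // ltW|exact: ltW].
  by apply: eq_lerW; field; rewrite !gt_eqF.
pose t := eval_term p (u * e%:C%C) e%:C%C.
pose hi i j := if (i + j < N)%N then 0 else t i j.
have tE i j : t i j = p (mexp2 i j) * u ^+ i * e%:C%C ^+ (i + j).
  by rewrite /t /eval_term exprMn exprD; ring.
have lowE K : (N <= K)%N -> box t K - box hi K = psum N (fps_subst (line u) p) e.
  move=> NK; rewrite /box -sumrB.
  have -> : \sum_(i < K.+1) (\sum_(j < K.+1) t i j - \sum_(j < K.+1) hi i j)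
      = \sum_(i < K.+1) \sum_(j < K.+1) (if (i + j < N)%N then t i j else 0).
    apply: eq_bigr => i _; rewrite -sumrB; apply: eq_bigr => j _; rewrite /hi.
    by case: ifP; rewrite ?subr0 ?subrr.
  elim: (N) NK => [|n IH] nK.
    by rewrite /psum big_ord0 big1 // => i _; rewrite big1.
  have -> : psum n.+1 (fps_subst (line u) p) e = psum n (fps_subst (line u) p) e
      + ucoef (fps_subst (line u) p) n * e%:C%C ^+ n by rewrite /psum big_ord_recr.
  rewrite -IH ?(ltnW nK) // line_coef mulr_suml.
  have -> : \sum_(i < n.+1) p (mexp2 i (n - i)) * u ^+ i * e%:C%C ^+ n
      = \sum_(i < n.+1) t i (n - i)%N.
    by apply: eq_bigr => i _; rewrite tE subnKC // -ltnS.
  rewrite -(sum_diagonal t (ltnW nK)) -big_split; apply: eq_bigr => i _.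
  rewrite -big_split; apply: eq_bigr => j _ /=; rewrite ltnS leq_eqVlt.
  by case: ltngtP => _ /=; rewrite ?addr0 ?add0r.
have hib i j : nc (hi i j) <= M * ((2 * A) ^+ N * e ^+ N) * q ^+ (i + j).
  rewrite /hi; case: ltnP => ij.
    rewrite nc0; apply: mulr_ge0; last exact: halfX_ge0.
    by apply: mulr_ge0 => //; apply: mulr_ge0; rewrite exprn_ge0 // mulr_ge0 // ltW.
  have Ae1 : 2 * A * e <= 1.
    have A20 : 0 < 2 * A by apply: mulr_gt0.
    by rewrite -(ler_pdivlMl _ _ A20) mulr1 ltW.
  have Ae0 : 0 <= 2 * A * e.
    by apply: mulr_ge0 => //; apply: mulr_ge0 => //; exact: ltW.
  apply: le_trans (_ : M * ((2 * A * e) ^+ (i + j) * q ^+ (i + j)) <= _); last first.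
    rewrite mulrA -exprMn; apply: ler_wpM2r; first exact: halfX_ge0.
    by apply: ler_wpM2l => //; apply: ler_wiXn2l.
  rewrite -exprMn (_ : 2 * A * e / 2 = A * e); last by field.
  rewrite /t /eval_term !ncM !ncX.
  have -> : M * (A * e) ^+ (i + j) = M * B ^+ (i + j) * ((A / B * e) ^+ i * (A / B * e) ^+ j).
    by rewrite -exprD -mulrA -exprMn; congr (_ * _ ^+ _); field; rewrite gt_eqF.
  have AB0 : 0 <= A / B * e by rewrite mulr_ge0 ?divr_ge0 // ltW.
  apply: ler_pM; rewrite ?normc_ge0 ?mulr_ge0 ?exprn_ge0 ?normc_ge0 //.
    by have := pB (mexp2 i j); rewrite mdeg_mexp2.
  apply: ler_pM; rewrite ?exprn_ge0 ?normc_ge0 //; apply: lerXn2r;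
    rewrite ?nnegrE ?normc_ge0 // ne ler_peMl // ler_pdivlMr // mul1r.
  exact: BA.
apply: (@geometric_limit_bound _ (fun K => box hi (N + K)%N) _ (8 * M)).
- exact: mulr_ge0.
- move=> K; have NK : (N <= N + K)%N by rewrite leq_addr.
  rewrite -(lowE _ NK); set b := box t _; set b' := box hi _; set E := fps_eval _ _.
  have -> : b' - (E - (b - b')) = b - E by ring.
  apply: le_trans (@fps_eval_box _ M B p _ _ (N + K)%N M0 B0 pB uB _) _; first by rewrite ne.
  apply: ler_wpM2l; first exact: mulr_ge0.
  apply: ler_wiXn2l; rewrite ?half_ge0 ?leq_addl //.
  by rewrite invf_le1 // ler1n.
by move=> K; have := box_bound (N + K)%N hib; rewrite !mulrA.
Qed.

End Line.

(** * From the equation of the curves to the formal equation of [psi] *)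

Section PsiEquation.
Variables (R : realType) (s : nat) (beta : R) (psi : fps R[i] 2).
Hypothesis psiP : is_psi s.+1 beta psi.
Local Notation C := R[i].
Local Notation I := ('i%C : R[i]).
Local Notation nc := (@Normc.normc R).
Local Notation Dx := (fps_deriv (ord0 : 'I_2)).

Let ev p (x y : C) : C := fps_eval p (pair_of x y).

(* The equation of the curves at a point, divided by [eta^(2 m - 2)] and the
   square of the slope. *)
Lemma curve_ode_point : exists2 r : R, 0 < r & forall (e : R) (x : C),
  0 < e < r -> nc x < r ->
  let y := e%:C%C in
  let E := expC (I * y ^+ s * ev psi x y) in
  E ^+ s * ev (Dx (Dx psi)) x y - 2 * ev (Dx psi) x y ^+ 2
  - E ^+ s * (I * s%:R * y ^+ s * ev (Dx psi) x y ^+ 2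
              + beta%:C%C * x * y ^+ (s + s) * ev (Dx psi) x y ^+ 3) = 0.
Proof.
have [cv _ _ [rho [rho0 ode]]] := psiP.
have [M [B [M0 B1 psiB]]] := convergent_bound cv.
have B0 : 0 < B by apply: lt_le_trans B1.
have dB := fps_bounded_deriv (ltW M0) B1 psiB.
have B1' : 1 <= 2 * B by apply: le_trans B1 _; rewrite ler_peMl ?ler1n ?ltW.
have MB0 : 0 <= M * B by apply: mulr_ge0; apply: ltW.
(* The parameter [xi] is taken real and equal to [rho / 2], and [eta] real, so that conjugation
   disappears; [z = x / xi] then stays within [rho] because [nc x < rho * k]. *)
pose k := rho / 2; have k0 : 0 < k by rewrite divr_gt0.
have kr : k < rho by rewrite ltr_pdivrMr // ltr_pMr // ltr1n.
have B80 : 0 < 4 * (2 * B) by rewrite !mulr_gt0.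
pose r := Num.min (4 * (2 * B))^-1 (Num.min rho (rho * k)).
have r0 : 0 < r by rewrite !lt_min invr_gt0 B80 rho0 mulr_gt0.
have B4r : (4 * (2 * B))^-1 <= (4 * B)^-1.
  rewrite lef_pV2 ?posrE ?mulr_gt0 //; apply: ler_wpM2l => //.
  by rewrite ler_peMl ?ler1n ?ltW.
exists r => // e x /andP[e0 er] xr y E.
have ne : nc y = e by rewrite /y nc_real ger0_norm // ltW.
have y0 : y != 0 by rewrite /y eq_complex /= eqxx andbT gt_eqF.
move: er xr; rewrite !lt_min => /and3P[eB erho _] /and3P[xB xrho xk].
pose c : C := k%:C%C; have c0 : c != 0 by rewrite /c eq_complex /= eqxx andbT gt_eqF.
have nk : nc c = k by rewrite /c nc_real ger0_norm // ltW.
pose z := x / c; have zc : z * c = x by rewrite /z mulfVK.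
have nz : nc z < rho by rewrite /z ncM ncV nk ltr_pdivrMr.
have conjy : (y^*)%C = y by exact: conjc_real.
have conjc' : (c^*)%C = c by exact: conjc_real.
pose F z' := curve s.+1 psi c y z'.
have FE z' : F z' = y * expC (I * y ^+ s * ev psi (z' * c) y).
  by rewrite /F /curve conjy conjc'.
pose J z' := I * y ^+ s * (c * ev (Dx psi) (z' * c) y).
have yB : nc y <= (4 * B)^-1 by rewrite ne (le_trans (ltW eB)).
have yB' : nc y <= (4 * (2 * B))^-1 by rewrite ne ltW.
have dpsi z' : nc (z' * c) < (4 * (2 * B))^-1 ->
    qderiv (fun z' => ev psi (z' * c) y) z' (c * ev (Dx psi) (z' * c) y).
  move=> zB; apply: (@qderiv_comp _ (fun x => ev psi x y) (fun z => z * c)).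
    exact: qderiv_lin.
  exact: (@qderiv_eval _ M B) (ltW M0) B1 psiB (lt_le_trans zB B4r) yB.
have dpsi1 z' : nc (z' * c) < (4 * (2 * B))^-1 ->
    qderiv (fun z' => ev (Dx psi) (z' * c) y) z' (c * ev (Dx (Dx psi)) (z' * c) y).
  move=> zB; apply: (@qderiv_comp _ (fun x => ev (Dx psi) x y) (fun z => z * c)).
    exact: qderiv_lin.
  exact: (@qderiv_eval _ (M * B) (2 * B)) MB0 B1' dB zB yB'.
have dF z' : nc (z' * c) < (4 * (2 * B))^-1 -> qderiv F z' (F z' * J z').
  move=> zB; have -> : F = fun z' => y * expC (I * y ^+ s * ev psi (z' * c) y).
    by apply/funext.
  apply: qderiv_eq (qderivZ y (qderiv_comp (qderivZ (I * y ^+ s) (dpsi z' zB))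
    (qderiv_expC _))).
  by rewrite /J; ring.
have dFJ : qderiv (fun z' => F z' * J z') z
    (F z * (J z ^+ 2 + I * y ^+ s * (c ^+ 2 * ev (Dx (Dx psi)) x y))).
  have zB : nc (z * c) < (4 * (2 * B))^-1 by rewrite zc.
  apply: qderiv_eq (qderivM (dF z zB)
    (qderivZ (I * y ^+ s) (qderivZ c (dpsi1 z zB)))).
  by rewrite /J zc; ring.
have d1E z' : nc (z' * c) < (4 * (2 * B))^-1 ->
    derive1 (F : C^o -> C^o) z' = F z' * J z'.
  move=> zB; rewrite derive1E.
  exact: (derive_val (is_derive := qderiv_is_derive (dF z' zB))).
have d2E : derive1n 2 (F : C^o -> C^o) z
    = F z * (J z ^+ 2 + I * y ^+ s * (c ^+ 2 * ev (Dx (Dx psi)) x y)).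
  rewrite derive1nS derive1n1 derive1E.
  pose d := ((4 * (2 * B))^-1 - nc x) / k.
  have d0 : 0 < d by rewrite divr_gt0 // subr_gt0.
  have Q : qderiv (derive1 (F : C^o -> C^o)) z
      (F z * (J z ^+ 2 + I * y ^+ s * (c ^+ 2 * ev (Dx (Dx psi)) x y))).
    apply: (qderiv_local d0 _ dFJ) => h hd; rewrite d1E // mulrDl zc.
    apply: le_lt_trans (ncD _ _) _; rewrite addrC -ltrBrDr ncM nk.
    by rewrite -ltr_pdivlMr.
  exact: (derive_val (is_derive := qderiv_is_derive Q)).
have zB : nc (z * c) < (4 * (2 * B))^-1 by rewrite zc.
have {}ode : derive1n 2 (F : C^o -> C^o) z
    = - (2 * I / F z ^+ s.+1 - s.+1%:R / F z) * derive1 (F : C^o -> C^o) z ^+ 2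
      - beta%:C%C / F z ^+ 2 * derive1 (F : C^o -> C^o) z ^+ 3 * z.
  by apply: ode y0 _ _ nz; rewrite ?nk ?ne.
rewrite d2E d1E // in ode.
set w := F z in ode; have wE : w = y * E by rewrite /w FE zc.
have E0 : E != 0.
  apply/eqP => E0; have := expC0 R; rewrite -(subrr (I * y ^+ s * ev psi x y)).
  by rewrite expCD -/E E0 mul0r => /esym/eqP; rewrite oner_eq0.
have w0 : w != 0 by rewrite wE mulf_neq0.
set P2 := ev (Dx (Dx psi)) x y in ode *.
set P1 := ev (Dx psi) x y.
have JE : J z = I * y ^+ s * (c * P1) by rewrite /J zc.
pose ys := y ^+ s; pose Es := E ^+ s; pose n : C := s%:R.
have ws : w ^+ s = ys * Es by rewrite wE exprMn.
have ys0 : ys != 0 by rewrite expf_neq0.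
have Es0 : Es != 0 by rewrite expf_neq0.
have I2 : I * I + 1 = 0.
  by apply/eqP; rewrite eq_complex /=; apply/andP; split; apply/eqP; ring.
(* The equation of the curve, multiplied by [w ^+ s] and divided by [w], after its slope has been
   written [w * J]. *)
have T0 : ys * Es * (J z ^+ 2 + I * ys * (c ^+ 2 * P2)) + (2 * I - (n + 1) * (ys * Es)) * J z ^+ 2
    + beta%:C%C * (ys * Es) * J z ^+ 3 * z = 0.
  have ode' : w * (J z ^+ 2 + I * ys * (c ^+ 2 * P2))
      = - (2 * I / (w * (ys * Es)) - (n + 1) / w) * (w * J z) ^+ 2
        - beta%:C%C / w ^+ 2 * (w * J z) ^+ 3 * z.
    by rewrite -ws -exprS /n natr1.
  apply: (mulfI w0); rewrite mulr0.
  apply: (eq_by_sub (t := ys * Es * (w * (J z ^+ 2 + I * ys * (c ^+ 2 * P2))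
     - (- (2 * I / (w * (ys * Es)) - (n + 1) / w) * (w * J z) ^+ 2
        - beta%:C%C / w ^+ 2 * (w * J z) ^+ 3 * z)))).
    by rewrite ode' subrr mulr0.
  by field; rewrite w0 ys0 Es0.
have m0 : I * c ^+ 2 * ys ^+ 2 != 0.
  by rewrite !mulf_neq0 ?expf_neq0 // I_neq0.
apply: (mulfI m0); rewrite mulr0 exprD -/ys -/Es -/n -zc.
apply: (eq_by_sub (t := (ys * Es * (J z ^+ 2 + I * ys * (c ^+ 2 * P2))
   + (2 * I - (n + 1) * (ys * Es)) * J z ^+ 2
   + beta%:C%C * (ys * Es) * J z ^+ 3 * z)
   - c ^+ 2 * ys ^+ 2 * I * P1 ^+ 2
   * (2 + beta%:C%C * ys ^+ 2 * Es * P1 * (z * c)) * (I * I + 1))).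
  by rewrite T0 I2 mulr0 subr0.
by rewrite JE -/ys; ring.
Qed.

(** On the ray [x = u e], [y = e] the pointwise equation expands asymptotically into the restricted
    formal equation, which is therefore zero; a series that vanishes on all lines is zero. *)
Lemma is_psi_ode : psi_ode s beta psi.
Proof.
have [r r0 rE] := curve_ode_point.
have [cv psi_x0 _ _] := psiP.
have [M [B [M0 B1 psiB]]] := convergent_bound cv.
have dB := fps_bounded_deriv (ltW M0) B1 psiB.
have B0 : 0 <= B by exact: le_trans ler01 B1.
have B1' : 1 <= 2 * B by apply: le_trans B1 _; rewrite ler_peMl ?ler1n.
have MB0 : 0 <= M * B by apply: mulr_ge0 => //; exact: ltW.
have ddB := fps_bounded_deriv MB0 B1' dB.
have B20 : 0 <= 2 * B by rewrite mulr_ge0.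
have B1'' : 1 <= 2 * (2 * B) by apply: le_trans B1' _; rewrite ler_peMl ?ler1n.
have MB0' : 0 <= M * B * (2 * B) by exact: mulr_ge0.
rewrite /psi_ode; apply: line_eq0 => u.
have a0 := asy_eval u (ltW M0) B1 psiB.
have a1 := asy_eval u MB0 B1' dB.
have a2 := asy_eval u MB0' B1'' ddB.
have lc := line_const u.
have psi0 : psi (mexp0 2) = 0 by apply: psi_x0; rewrite ffunE.
rewrite !(fps_substB lc, fps_substD lc, fps_substM lc, fps_substXn lc, fps_substC lc).
rewrite fps_subst_comp //; last by rewrite fps_const_mul psi0 mulr0.
rewrite !(fps_substM lc, fps_substXn lc, fps_substC lc, fps_substX lc, fps_substD lc, fps_subst1 lc).
rewrite -/(fps_exp _).
set L0 := fps_subst _ psi in a0 *.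
set L1 := fps_subst _ (Dx psi) in a1 *; set L2 := fps_subst _ (Dx (Dx psi)) in a2 *.
have -> : line u ord0 = fpsC 1 u * fpsX C (ord0 : 'I_1) by [].
have -> : line u (lift ord0 ord0) = fpsX C (ord0 : 'I_1) by [].
have aC c := @asyC R c; have aX := asyX R; have aXs k := asyXn k aX.
have aE : asy (fun e => expC (I * e%:C%C ^+ s * ev psi (u * e%:C%C) e%:C%C))
    (fps_exp (fpsC 1 I * fpsX C (ord0 : 'I_1) ^+ s * L0)).
  apply: asy_expC; last exact: asyM (asyM (aC I) (aXs s)) a0.
  by rewrite ucoef_const fps_const_mul /L0 (fps_subst_const lc) psi0 mulr0.
pose d := Num.min r (r / (nc u + 1)).
have nu : 0 < nc u + 1 by rewrite ltr_wpDl ?normc_ge0.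
have d0 : 0 < d by rewrite lt_min r0 divr_gt0.
apply: (asy_uniq0 d0 (G := fun e =>
  let y := e%:C%C in let x := u * y in
  let E := expC (I * y ^+ s * ev psi x y) in
  E ^+ s * ev (Dx (Dx psi)) x y - 2 * ev (Dx psi) x y ^+ 2
  - E ^+ s * (I * s%:R * y ^+ s * ev (Dx psi) x y ^+ 2
              + beta%:C%C * x * y ^+ (s + s) * ev (Dx psi) x y ^+ 3))).
  move=> e /andP[e0]; rewrite lt_min => /andP[er eu]; apply: rE; first by rewrite e0.
  rewrite ncM nc_real ger0_norm ?ltW //.
  apply: le_lt_trans (_ : (nc u + 1) * e < _); first by rewrite ler_wpM2r ?lerDl // ltW.
  by rewrite mulrC -ltr_pdivlMr.
have a2c : asy (fun=> 2 : C) 2.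
  by have := @asyC R 2; rewrite fpsC_nat.
apply: asyB; first apply: asyB.
- exact: asyM (asyXn s aE) a2.
- exact: asyM a2c (asyXn 2 a1).
apply: asyM (asyXn s aE) (asyD _ _).
  exact: asyM (asyM (aC _) (aXs s)) (asyXn 2 a1).
exact: asyM (asyM (asyM (aC _) (asyM (aC u) aX)) (aXs (s + s)%N)) (asyXn 3 a1).
Qed.

End PsiEquation.

(** * One-parameter groups of formal mappings *)

Section Flow.
Variable R : realType.
Local Notation C := R[i].

Lemma rderiv_shift (y : R -> C) t d : rderiv y 0 d -> rderiv (fun u => y (u - t)) t d.
Proof.
have sh (g : R -> R) e : is_derive (0 : R) (1 : R) g e ->
    is_derive (t : R) (1 : R) (fun u => g (u - t)) e.
  move=> gE; have d1 : is_derive (t : R) (1 : R) (fun u : R => u - t) 1.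
    by apply: (is_derive_eq (is_deriveB (is_derive_id t 1) (is_derive_cst t t 1))); rewrite subr0.
  have gE' : is_derive (t - t) (1 : R) g e by rewrite subrr.
  by have := @is_derive1_comp R g (fun u => u - t) t e 1 gE' d1; rewrite mulr1.
by move=> [r i]; split; apply: sh.
Qed.

Lemma rderiv_subst n k (h : 'I_n -> fps C k) (p : R -> fps C n) t (d : fps C n) a :
  (forall b, rderiv (fun u => p u b) t (d b)) ->
  rderiv (fun u => fps_subst h (p u) a) t (fps_subst h d a).
Proof.
move=> pd; apply: rderiv_sum => b.
apply: (rderiv_ext (y1 := fun u => (\prod_i h i ^+ b i) a * p u b)).
  by move=> u; rewrite mulrC.
by rewrite [d b * _]mulrC; apply: rderivZ.
Qed.

Lemma rderiv_coefM n (p q : R -> fps C n) t (d e : fps C n) a :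
  (forall b, rderiv (fun u => p u b) t (d b)) ->
  (forall b, rderiv (fun u => q u b) t (e b)) ->
  rderiv (fun u => (p u * q u) a) t ((d * q t + p t * e) a).
Proof.
move=> pd qe; rewrite fpsDE !fpsME -big_split /=; apply: rderiv_sum => b.
exact: rderivM.
Qed.

Section OneParameter.
Variables (n : nat) (L : formal_field R n) (Phi : R -> formal_map R n).
Hypothesis Phi0 : forall t i, Phi t i (mexp0 n) = 0.
Hypothesis Phi_id : forall i, Phi 0 i = fpsX C i.
Hypothesis PhiD : forall s t i, Phi (s + t) i = fps_subst (Phi t) (Phi s i).
Hypothesis dPhi : forall i a, rderiv (fun u => Phi u i a) 0 (L i a).

Definition lie (p : fps C n) : fps C n := \sum_i L i * fps_deriv i p.

Lemma lie_vanish N p : vanish N.+1 p -> vanish N (lie p).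
Proof. by move=> pN; apply: vanish_sum => i _; apply/vanishMl/fps_deriv_vanish. Qed.

Lemma lieX i : lie (fpsX C i) = L i.
Proof.
rewrite /lie (bigD1 i) //= big1 ?addr0 => [|j ji]; rewrite fps_derivX ?eqxx ?mulr1 //.
by rewrite (negbTE ji) mulr0.
Qed.

Lemma flow_subst0 p : fps_subst (Phi 0) p = p.
Proof. by rewrite (eq_fps_subst p Phi_id) fps_subst_id. Qed.

(** The Leibniz rule carries the formula from coordinates to polynomials. Each coefficient depends
    on a finite jet of [p], which gives the general case. *)
Lemma flow_deriv0 p a : rderiv (fun u => fps_subst (Phi u) p a) 0 (lie p a).
Proof.
move: a; elim/fps_ind: p => [c|i|p q pE qE|p q pE qE|p lim] a.
- have -> : lie (fpsC n c) = 0.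
    by apply: big1 => i _; rewrite fps_derivC mulr0.
  apply: (rderiv_ext (y1 := fun=> fpsC n c a)); last exact: rderiv_cst.
  by move=> u; rewrite (fps_substC (Phi0 u)).
- rewrite lieX; apply: rderiv_ext (dPhi i a) => u.
  by rewrite (fps_substX (Phi0 u)).
- have -> : lie (p + q) = lie p + lie q.
    by rewrite /lie -big_split; apply: eq_bigr => i _; rewrite fps_derivD mulrDr.
  apply: rderiv_ext (rderivD (pE a) (qE a)) => u.
  by rewrite (fps_substD (Phi0 u)).
- have -> : lie (p * q) = lie p * q + p * lie q.
    rewrite /lie mulr_suml mulr_sumr -big_split; apply: eq_bigr => i _.
    by rewrite fps_derivM mulrDr !mulrA [p * L i]mulrC.
  have := rderiv_coefM a pE qE; rewrite !flow_subst0.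
  by apply: rderiv_ext => u; rewrite (fps_substM (Phi0 u)).
have [q [qE pq]] := lim (mdeg a).+2.
have -> : lie p a = lie q a.
  have -> : lie p = lie (p - q) + lie q.
    by rewrite /lie -big_split; apply: eq_bigr => i _; rewrite -{1}[p](subrK q) fps_derivD mulrDr.
  by rewrite fpsDE (lie_vanish pq) ?add0r.
apply: rderiv_ext (qE a) => u; apply/esym.
rewrite -[p in LHS](subrK q) (fps_substD (Phi0 u)) fpsDE.
by rewrite (fps_subst_vanish (Phi0 u) pq) ?add0r // ltnW.
Qed.

(** The group law moves the derivative from time 0 to time [t]. *)
Lemma flow_deriv p a t :
  rderiv (fun u => fps_subst (Phi u) p a) t (fps_subst (Phi t) (lie p) a).
Proof.
apply: (rderiv_ext (y1 := fun u => fps_subst (Phi t) (fps_subst (Phi (u - t)) p) a)).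
  move=> u; rewrite (fps_substA _ (Phi0 (u - t)) (Phi0 t)).
  by congr (fcoef _ a); apply: eq_fps_subst => i; rewrite -PhiD subrK.
apply: (@rderiv_subst _ _ _ (fun u => fps_subst (Phi (u - t)) p)) => b.
exact: (rderiv_shift t (flow_deriv0 p b)).
Qed.

Lemma flow_coef_deriv i a t : rderiv (fun u => Phi u i a) t (fps_subst (Phi t) (L i) a).
Proof.
rewrite -(lieX i); apply: rderiv_ext (flow_deriv (fpsX C i) a t) => u.
by rewrite (fps_substX (Phi0 u)).
Qed.

Lemma flow_invariant p t : lie p = 0 -> fps_subst (Phi t) p = p.
Proof.
move=> Lp; apply/fpsP => a; rewrite -[in RHS](flow_subst0 p).
apply: (rderiv0_cst (y := fun u => fps_subst (Phi u) p a)) => u.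
by have := flow_deriv p a u; rewrite Lp fps_subst0.
Qed.

End OneParameter.
End Flow.

(** * Mappings of the complexified space *)

Section Double.
Variables (R : realType) (n : nat).
Local Notation C := R[i].
Implicit Types G H : formal_map R n.

(** The mapping [(G(Z), conj G(Zbar))] whose pullback appears in [formal_automorphism]; it reduces
    statements with conjugation to plain substitution. *)
Definition doubled G (j : 'I_(n + n)) : fps C (n + n) :=
  match fintype.split j with
  | inl i => in_Z (G i)
  | inr i => conj_in_Zbar (G i)
  end.

Lemma doubled_l G i : doubled G (lshift n i) = in_Z (G i).
Proof. by rewrite /doubled (unsplitK (inl i)). Qed.

Lemma doubled_r G i : doubled G (rshift n i) = conj_in_Zbar (G i).
Proof. by rewrite /doubled (unsplitK (inr i)). Qed.

Let XZ (i : 'I_n) : fpsX C (lshift n i) (mexp0 (n + n)) = 0.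
Proof. exact: fpsX_const. Qed.
Let XZb (i : 'I_n) : fpsX C (rshift n i) (mexp0 (n + n)) = 0.
Proof. exact: fpsX_const. Qed.

Lemma doubled_vanish N G : (forall i, vanish N (G i)) -> forall j, vanish N (doubled G j).
Proof.
move=> GN j; case: (split_ordP j) => i ->; rewrite ?doubled_l ?doubled_r.
  exact: (fps_subst_vanish XZ (GN i)).
apply: (fps_subst_vanish XZb) => a aN; rewrite /fps_map /= GN //.
exact: conjc0.
Qed.

Lemma doubled_X j : doubled (fun i => fpsX C i) j = fpsX C j.
Proof.
case: (split_ordP j) => i ->; rewrite ?doubled_l ?doubled_r /in_Z /conj_in_Zbar.
  by rewrite fps_substX.
by rewrite fps_mapX fps_substX.
Qed.

Lemma doubled_subst G H j : (forall i, G i (mexp0 n) = 0) -> (forall i, H i (mexp0 n) = 0) ->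
  doubled (fun i => fps_subst G (H i)) j = fps_subst (doubled G) (doubled H j).
Proof.
move=> G0 H0.
have dG0 i : doubled G i (mexp0 (n + n)) = 0.
  by apply/vanish_const/doubled_vanish => l; apply/vanish_const.
case: (split_ordP j) => i ->; rewrite ?doubled_l ?doubled_r /in_Z /conj_in_Zbar.
  rewrite !fps_substA //; apply: eq_fps_subst => l.
  by rewrite fps_substX // doubled_l.
rewrite fps_map_subst !fps_substA //.
  by apply: eq_fps_subst => l; rewrite fps_substX // doubled_r.
by move=> l; rewrite /fps_map /= G0; exact: conjc0.
Qed.

Lemma eq_doubled G H : G =1 H -> doubled G =1 doubled H.
Proof. by move=> GH j; rewrite /doubled; case: fintype.split => i; rewrite GH. Qed.

End Double.

(** * The real flow preserves the ideal of the hypersurface *)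

Section FlowAutomorphism.
Variables (R : realType) (n : nat) (L : formal_field R n) (F : R[i] -> formal_map R n).
Hypothesis FP : formal_flow L F.
Local Notation C := R[i].

Lemma formal_flow_const t i : F t i (mexp0 n) = 0.
Proof. by have [/(_ t)[]] := FP. Qed.

(** By the group law [F 0] is idempotent, and it is invertible. *)
Lemma formal_flow_id i : F 0 i = fpsX C i.
Proof.
have [inv FD _ _] := FP; have [_ [G [G0 GF FG]]] := inv 0.
have F00 j : fps_subst (F 0) (F 0 j) = F 0 j by rewrite -FD addr0.
rewrite -(GF i) -[in RHS]F00 fps_substA //; last exact: formal_flow_const.
by rewrite (eq_fps_subst _ GF) fps_subst_id.
Qed.

Definition real_flow (t : R) : formal_map R n := F t%:C%C.

Lemma real_flow_const t i : real_flow t i (mexp0 n) = 0.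
Proof. exact: formal_flow_const. Qed.
Lemma real_flow_id i : real_flow 0 i = fpsX C i.
Proof. exact: formal_flow_id. Qed.
Lemma real_flowD s t i : real_flow (s + t) i = fps_subst (real_flow t) (real_flow s i).
Proof. by rewrite /real_flow rmorphD; have [_ -> _ _] := FP. Qed.
Lemma real_flow_deriv0 i a : rderiv (fun u => real_flow u i a) 0 (L i a).
Proof.
have [_ _ dF dF0] := FP; apply: (@is_derive_rderiv _ (fun u => F u i a)).
apply: DeriveDef; first exact: dF.
by rewrite -derive1E; exact: dF0.
Qed.

Lemma doubled_flow_deriv0 j a :
  rderiv (fun u => doubled (real_flow u) j a) 0 (doubled L j a).
Proof.
case: (split_ordP j) => i ->.
  apply: (rderiv_ext (y1 := fun u => in_Z (real_flow u i) a)).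
    by move=> u; rewrite doubled_l.
  by rewrite doubled_l; apply: rderiv_subst => b; apply: real_flow_deriv0.
apply: (rderiv_ext (y1 := fun u => conj_in_Zbar (real_flow u i) a)).
  by move=> u; rewrite doubled_r.
rewrite doubled_r; apply: (@rderiv_subst _ _ _ _ (fun u => fps_map (@conjc R) (real_flow u i))) => b.
exact/rderiv_conj/real_flow_deriv0.
Qed.

Variables (w : 'I_(n + n)) (Q : fps C (n + n)).
Hypotheses (Q0 : Q (mexp0 (n + n)) = 0) (Qw : fps_deriv w Q = 0).
Local Notation theta := (fpsX C w - Q).
Hypotheses (L2 : forall i, vanish 2 (L i)) (Linf : infinitesimal_automorphism theta L).

Let dF0 t j : doubled (real_flow t) j (mexp0 (n + n)) = 0.
Proof.
by apply/vanish_const/doubled_vanish => i; apply/vanish_const/real_flow_const.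
Qed.

Let dF_id j : doubled (real_flow 0) j = fpsX C j.
Proof. by rewrite (eq_doubled real_flow_id) doubled_X. Qed.

Let dFD s t j : doubled (real_flow (s + t)) j
  = fps_subst (doubled (real_flow t)) (doubled (real_flow s) j).
Proof.
rewrite -doubled_subst; [|exact: real_flow_const|exact: real_flow_const].
by apply: eq_doubled => i; rewrite real_flowD.
Qed.

Let theta0 : theta (mexp0 (n + n)) = 0.
Proof. by rewrite fpsBE Q0 fpsX_const subrr. Qed.

Let theta_w : fps_deriv w theta = 1.
Proof. by rewrite fps_derivB fps_derivX eqxx Qw subr0. Qed.

(** The constant term of the factor is the coefficient of [w] in [lam * theta]; it vanishes because
    the field vanishes to order two. *)
Let lie_theta : exists2 lam : fps C (n + n), lam (mexp0 (n + n)) = 0 & lie (doubled L) theta = lam * theta.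
Proof.
have [lam lamE] := Linf; exists lam; last first.
  rewrite -lamE /lie big_split_ord /= big_split /=.
  by congr (_ + _); apply: eq_bigr => i _; rewrite ?doubled_l ?doubled_r.
have : vanish 1 (fps_deriv w (lam * theta)).
  rewrite -lamE; apply/fps_deriv_vanish/vanish_sum => i _.
  have v2 := doubled_vanish L2.
  by apply: vanishD; apply: vanishMr; rewrite -?doubled_l -?doubled_r.
move=> /vanish_const; rewrite fps_derivM fpsDE !fps_const_mul theta_w theta0.
by rewrite mulr0 add0r fps1E eqxx mulr1.
Qed.

Let y t := fps_subst (doubled (real_flow t)) theta.

Let y0 : y 0 = theta.
Proof. exact: (@flow_subst0 _ _ (fun t => doubled (real_flow t)) dF_id). Qed.

Let y_deriv : exists mu : R -> fps C (n + n),
  (forall t, vanish 1 (mu t)) /\ forall t a, rderiv (fun u => y u a) t ((mu t * y t) a).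
Proof.
have [lam lam0 lamE] := lie_theta.
exists (fun t => fps_subst (doubled (real_flow t)) lam); split=> [t|t a].
  by apply: (fps_subst_vanish (dF0 t)); apply/vanish_const.
rewrite /y -(fps_substM (dF0 t)) -lamE.
exact: (flow_deriv dF0 dF_id dFD doubled_flow_deriv0).
Qed.

Let y_divisible t : exists q, y t = q * theta.
Proof.
have [mu [mu1 yd]] := y_deriv; apply/(fps_divisible Q0 Qw).
pose g := graph w Q; have g0 : forall i, g i (mexp0 (n + n)) = 0 := graph_const w Q0.
apply: vanish_eq => N; rewrite subr0; elim: N t => [|N IH] t a //.
(* On the graph, [mu] lies in the maximal ideal and [y] in its [N]-th power by induction.
   Coefficients of degree at most [N] thus have derivative zero and keep their value at time 0,
   where [y] is [theta]. *)
rewrite ltnS => aN.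
have x0 : fps_subst g (y 0) = 0.
  by apply/(fps_divisible Q0 Qw); exists 1; rewrite mul1r y0.
rewrite -[0](congr1 (fun p : fps C _ => p a) x0).
apply: (rderiv0_cst (y := fun u => fps_subst g (y u) a)) => u.
have := rderiv_subst g a (yd u); rewrite (fps_substM g0).
have m1 : vanish 1 (fps_subst g (mu u)) by apply: fps_subst_vanish.
by rewrite (vanishM m1 (IH u)).
Qed.

(** The factor has constant term 1: it equals the coefficient of [w] in [y t], which is constant in
    time since [mu * y] vanishes to order two. *)
Lemma flow_formal_automorphism t : formal_automorphism theta (F t%:C%C).
Proof.
split; first by have [/(_ t%:C%C)] := FP.
have [q qE] := y_divisible t; exists q; split; last exact: qE.
have [mu [mu1 yd]] := y_deriv.
have y1 u : vanish 1 (y u).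
  by apply: (fps_subst_vanish (dF0 u)); apply/vanish_const.
have yw : y t (mexp1 w) = 1.
  rewrite (rderiv0_cst (y := fun u => y u (mexp1 w))) => [|u].
    rewrite y0; have := congr1 (fun p : fps C _ => p (mexp0 _)) theta_w.
    rewrite fps_derivE ffunE mul1r [mexpD _ _]mexpDC mexpD0 => ->.
    by rewrite fps1E eqxx.
  have := yd u (mexp1 w); rewrite (vanishM (mu1 u) (y1 u)) //.
  by rewrite mdeg1.
have := congr1 (fun p : fps C _ => fps_deriv w p (mexp0 _)) qE.
rewrite fps_derivE ffunE mul1r [mexpD _ _]mexpDC mexpD0 yw fps_derivM theta_w.
rewrite mulr1 fpsDE fps_const_mul theta0 mulr0 add0r => <-.
by apply/eqP; rewrite oner_eq0.
Qed.

End FlowAutomorphism.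

(** * Zeros of the sine, and dominated convergence for series *)

Section RealAnalysis.
Variable R : realType.

Lemma sin_eq0_pi (x : R) : sin x = 0 -> exists k : int, x = pi *~ k.
Proof.
move=> x0.
have sub (n : nat) y : sin y = 0 -> sin (y - pi *+ n) = 0.
  move=> y0; elim: n => [|n IH]; first by rewrite mulr0n subr0.
  have e : y - pi *+ n.+1 + pi = y - pi *+ n by rewrite mulrSr; ring.
  have := sinDpi (y - pi *+ n.+1); rewrite e IH.
  by move/esym/eqP; rewrite oppr_eq0 => /eqP.
have add (n : nat) y : sin y = 0 -> sin (y + pi *+ n) = 0.
  move=> y0; elim: n => [|n IH]; first by rewrite mulr0n addr0.
  by rewrite mulrSr addrA sinDpi IH oppr0.
have shift (k : int) : sin (x - pi *~ k) = 0.
  by case: k => n; [apply: sub|rewrite NegzE mulrNz opprK; apply: add].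
exists (Num.floor (x / pi)); set k := Num.floor _.
have pi0 := @pi_gt0 R.
have r0 : 0 <= x - pi *~ k.
  by rewrite subr_ge0 -mulrzr -ler_pdivlMl // mulrC floor_le.
have rpi : x - pi *~ k < pi.
  rewrite ltrBlDl -[X in _ + X]mulr1 -mulrzr -mulrDr -[1 in X in _ < X]/(1%:~R) -intrD.
  by rewrite -ltr_pdivrMl // mulrC floorD1_gt.
apply/eqP; rewrite -subr_eq0; apply/negPn/negP => rn0.
suff : (0 : R) < 0 by rewrite ltxx.
rewrite -[X in _ < X](shift k); apply: sin_gt0_pi.
by rewrite rpi andbT lt_neqAle eq_sym rn0 r0.
Qed.

Lemma cos2_eq1_pi (x : R) : cos (2 * x) = 1 -> exists k : int, x = pi *~ k.
Proof.
move=> c1; apply: sin_eq0_pi; apply/eqP; rewrite -sqrf_eq0 sin2cos2.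
have := cos_mulr2n x; rewrite -[x *+ 2]mulr_natl c1 => h.
by apply/eqP; move: h; rewrite -mulr_natl; lra.
Qed.

Lemma cvgn_sum J (r : seq J) (y : J -> nat -> R) (l : J -> R) :
  (forall i, y i k @[k --> \oo] --> l i) ->
  \sum_(i <- r) y i k @[k --> \oo] --> \sum_(i <- r) l i.
Proof.
move=> yl; elim: r => [|i r IH].
  by under eq_fun do rewrite big_nil; rewrite big_nil; apply: cvg_cst.
by under eq_fun do rewrite big_cons; rewrite big_cons; apply: cvgD.
Qed.

(* Dominated convergence for sums, with the exponential series as majorant. *)
Lemma tannery (y : nat -> nat -> R) (l : nat -> R) (M E : R) :
  0 <= M -> 0 <= E ->
  (forall i k, (i <= k)%N -> `|y i k| <= M * exp_coeff E i) ->
  (forall i, y i k @[k --> \oo] --> l i) ->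
  (forall k, (0 < k)%N -> \sum_(i < k.+1) y i k = 0) ->
  series l @ \oo --> 0.
Proof.
move=> M0 E0 yM yl ys.
have cE := is_cvg_series_exp_coeff E.
pose S := series (exp_coeff E).
have nd : {homo S : n m / (n <= m)%N >-> n <= m}.
  by apply: nondecreasing_series => n _ _; apply: exp_coeff_ge0.
have Sle n : S n <= lim (S @ \oo) by apply: nondecreasing_cvgn_le.
(* For each [k] the whole sum is zero, so its first [n] terms are minus its tail, which the tail of
   the exponential series dominates. *)
have bound n : `|series l n| <= M * (lim (S @ \oo) - S n).
  have cn : `|\sum_(0 <= i < n) y i k| @[k --> \oo] --> `|series l n|.
    by apply: cvg_norm; apply: cvgn_sum.
  apply: (cvgr_to_le cn); near=> k.
  have nk : (n <= k)%N by near: k; exists n.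
  have k0 : (0 < k)%N by near: k; exists 1%N.
  have := ys k k0; rewrite -(big_mkord xpredT (fun i => y i k)).
  rewrite (big_cat_nat (n := n)) //=; last exact: leqW.
  move/eqP; rewrite addr_eq0 => /eqP ->; rewrite normrN.
  apply: le_trans (ler_norm_sum _ _ _) _.
  apply: (@le_trans _ _ (M * (S k.+1 - S n))); last first.
    by apply: ler_wpM2l => //; rewrite lerD2r.
  have -> : S k.+1 - S n = \sum_(n <= i < k.+1) exp_coeff E i.
    rewrite /S /series /= (big_cat_nat (n := n) (p := k.+1)) //=; last exact: leqW.
    by rewrite addrAC subrr add0r.
  rewrite mulr_sumr !big_nat; apply: ler_sum => i /andP[_].
  by rewrite ltnS; apply: yM.
apply/norm_cvg0P.
apply: (squeeze_cvgr (f := fun=> 0) (h := fun n => M * (lim (S @ \oo) - S n))).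
- by apply: nearW => n; rewrite normr_ge0 bound.
- exact: cvg_cst.
rewrite -[X in _ --> X](mulr0 M) -(subrr (lim (S @ \oo))).
apply: cvgM; first exact: cvg_cst.
by apply: cvgB => //; exact: cvg_cst.
Unshelve. all: by end_near. Qed.

End RealAnalysis.

(** The induction step rests on [(1 + 1/k)^i <= exp(i/k) <= e] for [i <= k]. *)
Lemma expn_le_ffact (R : realType) k i : (i <= k)%N ->
  (k ^ i)%:R <= expR 1 ^+ i * (k ^_ i)%:R :> R.
Proof.
elim: k i => [|k IH] [|i] //; rewrite ?mul1r // ltnS => ik.
rewrite ffactSS expnS !natrM exprS [X in _ <= X]mulrCA; apply: ler_wpM2l => //.
rewrite -mulrA; apply: (@le_trans _ _ (expR 1 * (k ^ i)%:R)); last first.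
  by apply: ler_wpM2l; [exact: expR_ge0|exact: IH].
case: (posnP k) => [k0|k0].
  by move: ik; rewrite k0 leqn0 => /eqP ->; rewrite !expn0 mulr1 -[1%:R]expR0 ler_expR.
have kR : 0 < k%:R :> R by rewrite ltr0n.
rewrite !natrX (_ : k.+1%:R = k%:R * (1 + k%:R^-1)); last first.
  by rewrite mulrDr mulr1 mulfV ?gt_eqF // -natr1.
rewrite exprMn mulrC; apply: ler_wpM2r; first exact: exprn_ge0.
apply: (@le_trans _ _ (expR k%:R^-1 ^+ i)).
  by rewrite lerXn2r ?nnegrE ?expR_ge0 ?addr_ge0 ?invr_ge0 // expR_ge1Dx.
by rewrite -expRM_natl ler_expR ler_pdivrMr // mul1r ler_nat.
Qed.

Lemma leq_bin2 n n' m : (n <= n')%N -> ('C(n, m) <= 'C(n', m))%N.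
Proof.
move=> /subnK <-; elim: (n' - n)%N => [|d IH] //.
case: m IH => [|m] IH; first by rewrite !bin0.
by rewrite addSn binS; apply: leq_trans IH (leq_addr _ _).
Qed.

Lemma sum_bin_le M i : (\sum_(r < i.+1) 'C(M, r) <= 'C(M + i, i))%N.
Proof.
rewrite -binomial.Vandermonde; apply: leq_sum => r _.
by rewrite leq_pmulr // bin_gt0 leq_subr.
Qed.

(** * Growth of the coefficients of [f] *)

Section Growth.
Variables (R : realType) (s : nat) (beta : R) (f : fps R[i] 1).
Local Notation C := R[i].
Local Notation I := ('i%C : R[i]).
Let sigma j : R := (s * j)%:R * (s * j.+1)%:R - beta.
Hypotheses (s_gt0 : (0 < s)%N) (sigma_neq0 : forall j, sigma j != 0).
Hypotheses (f0 : ucoef f 0 = 1) (fE : linear_ode s beta%:C%C (2 * I) f).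

Definition acoef j := ucoef f (s * j)%N.
Definition aratio j : R := 2 * (s * j.+1)%:R / sigma j.
(** The real factor of [acoef (k - i) / acoef k]; the phase [I ^+ i] is split off in
    [acoef_quot]. *)
Definition aquot i k := \prod_(j < i) aratio (k - j.+1).

Lemma acoef_rec j : acoef j = I * (aratio j)%:C%C * acoef j.+1.
Proof.
have := linear_ode_rec s_gt0 (I2_neq0 R) (s * j) fE; rewrite -mulnSr -/(acoef j) -/(acoef j.+1).
have -> : (s * j)%:R * (s * j.+1)%:R - beta%:C%C = (sigma j)%:C%C :> C.
  by rewrite /sigma (rmorphB (real_complex R)) (rmorphM (real_complex R)) !(rmorph_nat (real_complex R)).
have sg : (sigma j)%:C%C != 0 :> C by rewrite eq_complex /= eqxx andbT.
move=> E; apply: (mulfI sg); rewrite -E /aratio !rmorphM /= fmorphV !rmorph_nat.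
by field.
Qed.

Lemma acoef_neq0 j : acoef j != 0.
Proof.
elim: j => [|j IH]; first by rewrite /acoef muln0 f0 oner_neq0.
by apply: contraNneq IH => a0; rewrite acoef_rec a0 mulr0.
Qed.

Lemma acoef_quot i k : (i <= k)%N -> acoef (k - i) = I ^+ i * (aquot i k)%:C%C * acoef k.
Proof.
elim: i => [|i IH] ik; first by rewrite subn0 /aquot big_ord0 !mul1r.
rewrite acoef_rec /aquot big_ord_recr /= -/(aquot i k) -subSn // subSS IH 1?ltnW //.
by rewrite (rmorphM (real_complex R) (aquot i k)) exprS; ring.
Qed.

(** [sigma j] grows like [(s j)^2], so consecutive coefficients of [f] have a quotient growing
    linearly in the index. *)
Lemma aratio_cvg : j.+1%:R * aratio j @[j --> \oo] --> (2 / s%:R : R).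
Proof.
have sR : s%:R != 0 :> R by rewrite pnatr_eq0 -lt0n.
pose u (j : nat) : R := j.+1%:R^-1.
have u0 : u @ \oo --> (0 : R) := cvg_harmonic.
have E : (fun j => j.+1%:R * aratio j)
    = (fun j => 2 * s%:R * (s%:R ^+ 2 * (1 - u j) - beta * u j ^+ 2)^-1).
  apply/funext => j; have j0 : j.+1%:R != 0 :> R by rewrite pnatr_eq0.
  have jE : j%:R = j.+1%:R * (1 - u j) :> R.
    by rewrite mulrBr mulr1 mulfV // -natr1 addrK.
  have sE : sigma j = j.+1%:R ^+ 2 * (s%:R ^+ 2 * (1 - u j) - beta * u j ^+ 2).
    by rewrite /sigma !natrM jE /u; field.
  have d0 : s%:R ^+ 2 * (1 - u j) - beta * u j ^+ 2 != 0.
    by apply: contraNneq (sigma_neq0 j) => d0; rewrite sE d0 mulr0.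
  by rewrite /aratio sE natrM; field; rewrite d0 nat1r.
have -> : 2 / s%:R = 2 * s%:R * (s%:R ^+ 2 * (1 - 0) - beta * (0 * 0))^-1 :> R by field.
rewrite E; apply: cvgM; first exact: cvg_cst.
apply: cvgV; first by rewrite subr0 mulr1 !mulr0 subr0 expf_neq0.
apply: cvgB; apply: cvgM; try exact: cvg_cst.
  by apply: cvgB => //; exact: cvg_cst.
exact: cvgM.
Qed.

Lemma aratio_bound : exists2 D : R, 0 <= D & forall j, `|aratio j| * j.+1%:R <= D.
Proof.
have [M [_ MP]] := cvg_seq_bounded (cvgP _ aratio_cvg).
exists (`|M| + 1); first by rewrite addr_ge0.
move=> j; have /MP/(_ j Logic.I) /= h : M < `|M| + 1 by rewrite (le_lt_trans (ler_norm _)) ?ltrDl.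
by rewrite mulrC -[X in X * _](ger0_norm (ler0n R _)) -normrM.
Qed.

Lemma ratio_shift_cvg i : n.+1%:R / (n.+1 + i)%:R @[n --> \oo] --> (1 : R).
Proof.
pose u (j : nat) : R := j.+1%:R^-1.
have u0 : u @ \oo --> (0 : R) := cvg_harmonic.
have E : (fun n => n.+1%:R / (n.+1 + i)%:R) = (fun n => (1 + i%:R * u n)^-1).
  apply/funext => n; have n0 : n.+1%:R != 0 :> R by rewrite pnatr_eq0.
  have ni : n.+1%:R + i%:R != 0 :> R by rewrite -natrD pnatr_eq0.
  by rewrite natrD /u; move: (n.+1%:R) n0 ni => x n0 ni; field; rewrite n0 ni.
rewrite E.
suff : (1 + i%:R * u n)^-1 @[n --> \oo] --> ((1 + i%:R * 0)^-1 : R).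
  by rewrite mulr0 addr0 invr1.
apply: cvgV; first by rewrite mulr0 addr0 oner_eq0.
by apply: cvgD; [exact: cvg_cst|apply: cvgM => //; exact: cvg_cst].
Qed.

Lemma cvg_mul_shift (u : nat -> R) i (l : R) : n.+1%:R * u n @[n --> \oo] --> l ->
  (n.+1 + i)%:R * u n @[n --> \oo] --> l.
Proof.
move=> ul; have r1 : (n.+1 + i)%:R / n.+1%:R @[n --> \oo] --> (1 : R).
  pose v (j : nat) : R := j.+1%:R^-1.
  have v0 : v @ \oo --> (0 : R) := cvg_harmonic.
  have -> : (fun n => (n.+1 + i)%:R / n.+1%:R) = (fun n => 1 + i%:R * v n).
    by apply/funext => n; rewrite natrD mulrDl mulfV // pnatr_eq0.
  suff : 1 + i%:R * v n @[n --> \oo] --> (1 + i%:R * 0 : R) by rewrite mulr0 addr0.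
  by apply: cvgD; [exact: cvg_cst|apply: cvgM => //; exact: cvg_cst].
have -> : (fun n => (n.+1 + i)%:R * u n)
    = (fun n => (n.+1 + i)%:R / n.+1%:R * (n.+1%:R * u n)).
  by apply/funext => n; rewrite mulrA mulfVK // pnatr_eq0.
by rewrite -[l]mul1r; apply: cvgM.
Qed.

Lemma aquot_cvg i : k%:R ^+ i * aquot i k @[k --> \oo] --> ((2 / s%:R) ^+ i : R).
Proof.
elim: i => [|i IH].
  under eq_fun do rewrite expr0 mul1r /aquot big_ord0; rewrite expr0; exact: cvg_cst.
have -> : (fun k => k%:R ^+ i.+1 * aquot i.+1 k)
    = (fun k => k%:R ^+ i * aquot i k * (k%:R * aratio (k - i.+1))).
  by apply/funext => k; rewrite /aquot big_ord_recr /= exprSr; ring.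
rewrite exprSr; apply: cvgM => //; rewrite -(cvg_shiftn i.+1).
under eq_fun do rewrite addnK -addSnnS.
exact/cvg_mul_shift/aratio_cvg.
Qed.

Lemma bin_cvg i r : 'C(s * (k - i), r)%:R / k%:R ^+ r @[k --> \oo] -->
  (s%:R ^+ r / r`!%:R : R).
Proof.
elim: r => [|r IH].
  by under eq_fun do rewrite bin0 expr0 divr1; rewrite expr0 divr1; apply: cvg_cst.
have E k : 'C(s * (k - i), r.+1)%:R / k%:R ^+ r.+1
    = 'C(s * (k - i), r)%:R / k%:R ^+ r * ((s * (k - i) - r)%:R / k%:R / r.+1%:R) :> R.
  have := mul_bin_left (s * (k - i)) r.
  move=> /(congr1 (fun n => n%:R : R)); rewrite !natrM => E.
  have r0 : r.+1%:R != 0 :> R by rewrite pnatr_eq0.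
  apply: (mulfI r0); rewrite [LHS]mulrA E -!exprVn exprSr.
  by move: (k%:R^-1) => x; field; rewrite nat1r.
under eq_fun do rewrite E.
have -> : s%:R ^+ r.+1 / (r.+1)`!%:R = s%:R ^+ r / r`!%:R * (s%:R / r.+1%:R) :> R.
  by rewrite factS natrM exprSr invfM; ring.
apply: cvgM => //; apply: cvgM; last exact: cvg_cst.
rewrite -(cvg_shiftn i.+1).
pose u (j : nat) : R := j.+1%:R^-1.
have u0 : u @ \oo --> (0 : R) := cvg_harmonic.
have L : (s%:R - r%:R * u n) * (n.+1%:R / (n.+1 + i)%:R) @[n --> \oo] --> (s%:R : R).
  suff : (s%:R - r%:R * u n) * (n.+1%:R / (n.+1 + i)%:R) @[n --> \oo]
      --> ((s%:R - r%:R * 0) * 1 : R) by rewrite mulr0 subr0 mulr1.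
  apply: cvgM (ratio_shift_cvg i); apply: cvgB; first exact: cvg_cst.
  by apply: cvgM => //; exact: cvg_cst.
apply: cvg_trans L; apply: near_eq_cvg; near=> n.
have rn : (r <= s * n.+1)%N.
  by rewrite (leq_trans _ (leq_pmull _ s_gt0)) //; near: n; exists r => // n /= /leqW.
rewrite /= -addSnnS addnK natrB // natrM /u.
have n0 : n.+1%:R != 0 :> R by rewrite pnatr_eq0.
have ni : (n.+1 + i)%:R != 0 :> R by rewrite pnatr_eq0.
by move: (n.+1%:R) ((n.+1 + i)%:R) n0 ni => x y x0 y0; field; rewrite x0 y0.
Unshelve. all: by end_near. Qed.

(** The quotient behaves like [(2 / (s k))^i] and the binomial like [(s k)^r / r!], so the product
    survives only when [r = i]. *)
Lemma aquot_bin_cvg i r : (r <= i)%N ->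
  aquot i k * 'C(s * (k - i), r)%:R @[k --> \oo] -->
  (if r == i then 2 ^+ i / i`!%:R else 0 : R).
Proof.
move=> ri; have sR : s%:R != 0 :> R by rewrite pnatr_eq0 -lt0n.
have inv0 : k%:R^-1 @[k --> \oo] --> (0 : R).
  rewrite -(cvg_shiftn 1); under eq_fun do rewrite addn1; exact: cvg_harmonic.
have pw d : k%:R^-1 ^+ d @[k --> \oo] --> (0 ^+ d : R).
  elim: d => [|d IH]; first by under eq_fun do rewrite expr0; rewrite expr0; apply: cvg_cst.
  by under eq_fun do rewrite exprS; rewrite exprS; apply: cvgM.
have L : k%:R ^+ i * aquot i k * ('C(s * (k - i), r)%:R / k%:R ^+ r) * k%:R^-1 ^+ (i - r)
    @[k --> \oo] --> ((2 / s%:R) ^+ i * (s%:R ^+ r / r`!%:R) * 0 ^+ (i - r) : R).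
  exact: cvgM (cvgM (@aquot_cvg i) (@bin_cvg i r)) (pw (i - r)%N).
have -> : (if r == i then 2 ^+ i / i`!%:R else 0)
    = (2 / s%:R) ^+ i * (s%:R ^+ r / r`!%:R) * 0 ^+ (i - r) :> R.
  case: eqVneq => [->|rni].
    by rewrite subnn expr0 mulr1 expr_div_n mulrA mulfVK ?expf_neq0.
  by rewrite expr0n subn_eq0 leqNgt ltn_neqAle rni ri mulr0.
apply: cvg_trans L; apply: near_eq_cvg; near=> k.
have k0 : k%:R != 0 :> R.
  by rewrite pnatr_eq0 -lt0n; near: k; exists 1%N.
rewrite -[in k%:R ^+ i](subnK ri) exprD exprVn.
by field; rewrite !expf_neq0.
Unshelve. all: by end_near. Qed.

Variable D : R.
Hypotheses (D0 : 0 <= D) (DP : forall j, `|aratio j| * j.+1%:R <= D).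

Lemma aquot_ffact i k : (i <= k)%N -> `|aquot i k| * (k ^_ i)%:R <= D ^+ i.
Proof.
elim: i => [|i IH] ik; first by rewrite /aquot big_ord0 normr1 ffactn0 mul1r.
rewrite /aquot big_ord_recr /= normrM ffactnSr natrM mulrACA exprSr.
apply: ler_pM; rewrite ?mulr_ge0 //; first by apply: IH; exact: ltnW.
by have := DP (k - i.+1); rewrite subnSK.
Qed.

Lemma aquot_exp i k : (i <= k)%N -> `|aquot i k| <= exp_coeff D i.
Proof.
move=> ik; rewrite /exp_coeff /= ler_pdivlMr ?ltr0n ?fact_gt0 //.
apply: le_trans (aquot_ffact ik); apply: ler_wpM2l => //.
by rewrite ler_nat -bin_ffact leq_pmull // bin_gt0.
Qed.

(** By Vandermonde the binomials add up to at most ['C(s k, i)], hence to at most [(s k)^i / i!].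
    Replacing [k^i] by [e^i] times the falling factorial lets [aquot_ffact] finish; the bound is
    uniform in [k]. *)
Lemma aquot_bin_exp i k : (i <= k)%N ->
  `|aquot i k| * \sum_(r < i.+1) 'C(s * (k - i), r)%:R <= exp_coeff (D * s%:R * expR 1) i.
Proof.
move=> ik; rewrite /exp_coeff /= ler_pdivlMr ?ltr0n ?fact_gt0 // -natr_sum -[X in X <= _]mulrA -natrM.
apply: (@le_trans _ _ (`|aquot i k| * (s%:R ^+ i * (expR 1 ^+ i * (k ^_ i)%:R)))).
  apply: ler_wpM2l => //; apply: (@le_trans _ _ ((s * k) ^ i)%:R).
    rewrite ler_nat; apply: leq_trans (_ : (s * k) ^_ i <= _)%N.
      rewrite -bin_ffact leq_mul2r; apply/orP; right.
      apply: leq_trans (sum_bin_le _ _) _; apply: leq_bin2.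
      by rewrite -[X in (_ <= s * X)%N](subnK ik) mulnDr leq_add2l leq_pmull.
    by elim: i {ik} => // i IH; rewrite ffactnSr expnSr leq_mul // leq_subr.
  by rewrite expnMn natrM natrX; apply: ler_wpM2l; [exact: exprn_ge0|exact: expn_le_ffact].
rewrite !exprMn [X in X <= _](_ : _ = `|aquot i k| * (k ^_ i)%:R * (s%:R ^+ i * expR 1 ^+ i));
  last by ring.
rewrite -[X in _ <= X]mulrA; apply: ler_wpM2r; last exact: aquot_ffact.
by rewrite mulr_ge0 // exprn_ge0 // expR_ge0.
Qed.

End Growth.

(** * Sums over multiples of [s], exponential terms, and coefficients of powers *)

Lemma sum_multiples (A : nmodType) (F : nat -> A) s k : (0 < s)%N ->
  (forall l, (l <= s * k)%N -> ~~ (s %| l)%N -> F l = 0) ->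
  \sum_(l < (s * k).+1) F l = \sum_(i < k.+1) F (s * i)%N.
Proof.
move=> s0; elim: k => [|k IH] F0; first by rewrite muln0 !big_ord1 muln0.
rewrite [RHS]big_ord_recr /= -IH => [|l lk]; last first.
  by apply: F0; rewrite (leq_trans lk) // leq_mul2l leqnSn orbT.
rewrite -!(big_mkord xpredT F) (big_cat_nat (n := (s * k).+1)) //=; last first.
  by rewrite ltnS leq_mul2l leqnSn orbT.
congr (_ + _); rewrite mulnS addnC big_nat_recr /=; last by rewrite -[X in (X < _)%N]addn0 ltn_add2l.
rewrite big_nat big1 ?add0r // => l /andP[kl lk]; apply: F0.
  by rewrite mulnS addnC ltnW.
apply/negP => /dvdnP[q lE]; move: kl lk; rewrite lE [(q * s)%N]mulnC -mulnSr !ltn_pmul2l //.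
by rewrite ltnS => kq; rewrite leqNgt kq.
Qed.

Lemma sum_ord_widen0 (A : nmodType) (F : nat -> A) n K : (n <= K)%N ->
  (forall r, (n <= r)%N -> F r = 0) -> \sum_(r < K) F r = \sum_(r < n) F r.
Proof.
move=> nK F0; rewrite (big_ord_widen K F nK) [RHS]big_mkcond; apply: eq_bigr => r _.
by case: ltnP => // /F0.
Qed.

Section ExpCoeff.
Variable R : realType.

Lemma exp_coeffM (x D : R) i : x ^+ i * exp_coeff D i = exp_coeff (x * D) i.
Proof. by rewrite /exp_coeff /= exprMn mulrA. Qed.

Lemma exp_coeff_le (x y : R) i : 0 <= x -> x <= y -> exp_coeff x i <= exp_coeff y i.
Proof.
move=> x0 xy; rewrite /exp_coeff /= ler_wpM2r ?invr_ge0 //.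
by rewrite lerXn2r // nnegrE // (le_trans x0).
Qed.

Lemma imaginaryX i : ('i%C : R[i]) ^+ i
  = ((-1) ^+ i./2)%:C%C * (if odd i then 'i%C else 1).
Proof.
rewrite -[in LHS](odd_double_half i) exprD -mul2n exprM.
have -> : ('i%C : R[i]) ^+ 2 = (-1)%:C%C.
  by apply/eqP; rewrite expr2 eq_complex /=; apply/andP; split; apply/eqP; ring.
by rewrite mulrC rmorphXn; case: odd; rewrite ?expr1 ?expr0.
Qed.

Lemma cos_coeff_Re (t : R) i : cos_coeff (2 * t) i
  = complex.Re ('i%C ^+ i * (t%:C%C) ^+ i) * (2 ^+ i / i`!%:R).
Proof.
rewrite imaginaryX mulrAC -rmorphXn -(rmorphM (real_complex R)) Re_realM /cos_coeff /=.
by rewrite exprMn -exprnP; case: odd => /=; ring.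
Qed.

End ExpCoeff.

Section PowerBound.
Variables (R : realType) (eta : fps R[i] 1).
Local Notation C := R[i].
Local Notation nc := (@Normc.normc R).

(** The bound is uniform in [r]: halving the ratio of [eta] leaves a sum of powers of one half in
    the convolution, and the missing constant term supplies the last factor one half. *)
Lemma fps_pow_bound (H : R) : 0 <= H -> ucoef eta 0 = 0 ->
  (forall j, (0 < j)%N -> nc (ucoef eta j) <= (H / 2) ^+ j) ->
  forall r l, nc (ucoef (eta ^+ r) l) <= H ^+ l.
Proof.
move=> H0 e0 eH; elim=> [|r IH] l.
  rewrite expr0 -fpsC1 ucoefC; case: l => [|l]; first by rewrite expr0 eqxx nc1.
  by rewrite nc0 exprn_ge0.
rewrite exprS ucoefM big_ord_recl e0 mul0r add0r; apply: le_trans (nc_sum _ _ _) _.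
apply: (@le_trans _ _ (\sum_(j < l) (H ^+ l / 2) * 2^-1 ^+ j)); last first.
  rewrite -mulr_sumr -mulrA ler_piMr ?exprn_ge0 // ler_pdivrMl // mulr1.
  exact: geom_le2.
apply: ler_sum => j _; rewrite ncM lift0.
apply: le_trans (_ : (H / 2) ^+ j.+1 * H ^+ (l - j.+1) <= _).
  by apply: ler_pM => //; rewrite ?normc_ge0 ?eH.
by rewrite exprMn mulrAC -exprD subnKC // exprS mulrA.
Qed.

Lemma fps_pow_order s (t : C) r i : (0 < s)%N -> (forall j, (j < s)%N -> ucoef eta j = 0) ->
  ucoef eta s = t -> (i <= r)%N ->
  ucoef (eta ^+ r) (s * i) = if i == r then t ^+ r else 0.
Proof.
move=> s0 e0 es ir.
pose e' := useries (fun k => ucoef eta (k + s)).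
have eE : eta = fpsX C (ord0 : 'I_1) ^+ s * e'.
  apply: ucoef_inj => k; rewrite ucoefXnM ucoef_useries; case: leqP => h; last exact: e0.
  by rewrite subnK.
rewrite eE exprMn -exprM ucoefXnM; case: eqVneq => [->|ni].
  rewrite leqnn subnn ucoef_const fps_const_exp -ucoef_const ucoef_useries add0n.
  by rewrite es.
case: leqP => //; rewrite leq_mul2l; have ri : (i < r)%N by rewrite ltn_neqAle ni ir.
by case/orP; [rewrite eqn0Ngt s0|rewrite leqNgt ri].
Qed.


End PowerBound.

(** * No convergent series represent the logarithmic derivative of [f] *)

Section Divergence.
Variables (R : realType) (s : nat) (beta : R) (f : fps R[i] 1).
Local Notation C := R[i].
Local Notation I := ('i%C : R[i]).
Local Notation nc := (@Normc.normc R).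
Local Notation w := (fpsX C (ord0 : 'I_1)).
Hypotheses (s_gt0 : (0 < s)%N)
  (sigma_neq0 : forall j, (s * j)%:R * (s * j.+1)%:R - beta != 0).
Hypotheses (f0 : ucoef f 0 = 1) (fE : linear_ode s beta%:C%C (2 * I) f).
Local Notation T := (aquot s beta).

(** The coefficient of [w^(s k)] in a product with [f], divided by [acoef k]; indices that are not
    multiples of [s] drop out. *)
Lemma quotient_sum (c : nat -> C) k :
  \sum_(l < (s * k).+1) c l * ucoef f (s * k - l) = 0 ->
  \sum_(i < k.+1) (T i k)%:C%C * (I ^+ i * c (s * i)%N) = 0.
Proof.
rewrite (sum_multiples (F := fun l => c l * ucoef f (s * k - l)) s_gt0) => [|l lk nl].
  move=> E; apply: (mulIf (acoef_neq0 s_gt0 sigma_neq0 f0 fE k)); rewrite mul0r mulr_suml -[RHS]E.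
  apply: eq_bigr => i _; rewrite -mulnBr -/(acoef s f (k - i)).
  rewrite (acoef_quot s_gt0 sigma_neq0 fE) -1?ltnS //; ring.
rewrite (linear_ode_supp s_gt0 (I2_neq0 R) fE) ?mulr0 //.
by apply: contra nl => h; rewrite -(subKn lk) dvdn_sub // dvdn_mulr.
Qed.

Lemma aquot_cvg0 i : T i k @[k --> \oo] --> ((i == 0%N)%:R : R).
Proof.
have := aquot_bin_cvg s_gt0 sigma_neq0 (leq0n i).
under eq_fun do rewrite bin0 mulr1.
by case: i => [|i]; rewrite ?expr0 ?fact0 ?divr1.
Qed.

Lemma Re_IX i (z : C) : `|complex.Re (I ^+ i * z)| <= nc z.
Proof. by apply: le_trans (Re_le_nc _) _; rewrite ncM ncX nc_I expr1n mul1r. Qed.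

(** Compare coefficients of [w^(s k)] in [P w f' = w Q f], divide by [s k] times the leading
    coefficient of [f], and let [k] grow. Every term with [i > 0] tends to zero and so does the
    right side, leaving [P(0) = 0]. *)
Theorem no_convergent_log_derivative (P Q : fps C 1) (M B : R) : 0 <= M -> 1 <= B ->
  (forall l, nc (ucoef P l) <= M * B ^+ l) -> (forall l, nc (ucoef Q l) <= M * B ^+ l) ->
  ucoef P 0 = 1 -> P * fps_deriv ord0 f = Q * f -> False.
Proof.
move=> M0 B1 PB QB P0 PQ; have B0 : 0 <= B := le_trans ler01 B1.
have [D D0 DP] := aratio_bound s_gt0 sigma_neq0.
pose q := w * Q.
have qB l : nc (ucoef q l) <= M * B ^+ l.
  rewrite /q ucoefXM; case: l => [|l]; first by rewrite nc0 mulr_ge0 // exprn_ge0.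
  by apply: le_trans (QB l) _; rewrite ler_wpM2l // exprS ler_peMl // exprn_ge0.
pose c k l := ucoef P l * (s * k - l)%:R - ucoef q l.
have ce k : \sum_(i < k.+1) (T i k)%:C%C * (I ^+ i * c k (s * i)%N) = 0.
  apply: quotient_sum.
  have E : P * (w * fps_deriv ord0 f) = q * f by rewrite /q -mulrA -PQ mulrCA.
  have := congr1 (fun p => ucoef p (s * k)) E; rewrite !ucoefM => /eqP.
  rewrite -subr_eq0 -sumrB => /eqP Z; rewrite -[RHS]Z; apply: eq_bigr => l _.
  rewrite /c mulrBl; congr (_ - _); rewrite -mulrA; congr (_ * _); rewrite ucoefXM.
  by case: (s * k - l)%N => [|j]; rewrite ?mul0r // ucoef_deriv.
(* The limits of the summands [y i k]; only [l 0 = 1] is nonzero, and the last factors 1 and 0 are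
   the limits of [(k - i) / k] and of [1 / (s k)]. *)
pose l i := complex.Re (I ^+ i * ucoef P (s * i)) * ((i == 0%N)%:R * 1)
  - complex.Re (I ^+ i * ucoef q (s * i)) * ((i == 0%N)%:R * 0).
pose y i k := complex.Re (I ^+ i * ucoef P (s * i)) * (T i k * ((k - i)%:R / k%:R))
  - complex.Re (I ^+ i * ucoef q (s * i)) * (T i k * (s * k)%:R^-1).
have dom i k : (i <= k)%N -> `|y i k| <= (M + M) * exp_coeff (B ^+ s * D) i.
  move=> ik; apply: le_trans (ler_normB _ _) _; rewrite mulrDl.
  have Tb := aquot_exp DP ik.
  rewrite -exp_coeffM -exprM.
  have bnd p r : nc (ucoef p (s * i)) <= M * B ^+ (s * i) -> 0 <= r <= 1 ->
      `|complex.Re (I ^+ i * ucoef p (s * i)) * (T i k * r)| <= M * (B ^+ (s * i) * exp_coeff D i).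
    move=> pB /andP[r0 r1]; rewrite normrM mulrA; apply: ler_pM => //.
      exact: le_trans (Re_IX _ _) pB.
    rewrite normrM -[X in _ <= X]mulr1; apply: ler_pM => //.
    by rewrite ger0_norm.
  apply: lerD; apply: bnd => //.
    rewrite divr_ge0 //=; case: (posnP k) => [->|k0]; first by rewrite invr0 mulr0.
    by rewrite ler_pdivrMr ?ltr0n // mul1r ler_nat leq_subr.
  rewrite invr_ge0 ler0n /=; case: (posnP (s * k)%N) => [->|k0]; first by rewrite invr0.
  by rewrite invf_le1 ?ltr0n // ler1n.
have yl i : y i k @[k --> \oo] --> l i.
  have T0 := @aquot_cvg0 i.
  apply: cvgB; (apply: cvgM; first exact: cvg_cst); apply: cvgM => //.
    rewrite -(cvg_shiftn i.+1); have := ratio_shift_cvg (R := R) i.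
    by under [in X in _ -> X]eq_fun do rewrite -addSnnS addnK.
  have inv0 : k%:R^-1 @[k --> \oo] --> (0 : R).
    rewrite -(cvg_shiftn 1); under eq_fun do rewrite addn1; exact: cvg_harmonic.
  rewrite -[X in _ --> X](mulr0 (s%:R^-1)).
  by under eq_fun do rewrite natrM invfM; apply: cvgM => //; exact: cvg_cst.
have ys k : (0 < k)%N -> \sum_(i < k.+1) y i k = 0.
  move=> k0; have kR : k%:R != 0 :> R by rewrite pnatr_eq0 -lt0n.
  have sR : s%:R != 0 :> R by rewrite pnatr_eq0 -lt0n.
  have := congr1 (@complex.Re R) (ce k).
  rewrite raddf_sum /= => E.
  transitivity ((s * k)%:R^-1 * \sum_(i < k.+1) complex.Re ((T i k)%:C%C * (I ^+ i * c k (s * i)%N)));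
    last by rewrite E mulr0.
  rewrite mulr_sumr; apply: eq_bigr => i _; rewrite Re_realM /y.
  have -> : I ^+ i * c k (s * i)%N
      = ((s * (k - i))%:R)%:C%C * (I ^+ i * ucoef P (s * i)) - I ^+ i * ucoef q (s * i).
    by rewrite /c -mulnBr (rmorph_nat (real_complex R)); ring.
  by rewrite cReD cReN Re_realM !natrM; field; rewrite kR sR.
have := tannery (addr_ge0 M0 M0) _ dom yl ys.
rewrite mulr_ge0 ?exprn_ge0 // => /(_ isT) l0.
have l1 : series l @ \oo --> (1 : R).
  rewrite -(cvg_shiftn 1); have -> : (fun n => series l (n + 1)%N) = (fun=> 1).
    apply/funext => n; rewrite addn1 /series /= big_nat_recl //= big1 => [|i _].
      by rewrite addr0 /l muln0 P0 !mulr0 subr0 expr0 !mul1r.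
    by rewrite /l /= !mul0r !mulr0 subrr.
  exact: cvg_cst.
have : (0 : R) = 1 by apply: cvg_unique l0 l1; exact: Rhausdorff.
by move/esym/eqP; rewrite oner_eq0.
Qed.

End Divergence.

(** * A convergent relation [f(W) = rho f] forces [cos (2 t) = 1] *)

Section Composition.
Variables (R : realType) (s : nat) (beta : R) (f : fps R[i] 1).
Local Notation C := R[i].
Local Notation I := ('i%C : R[i]).
Local Notation nc := (@Normc.normc R).
Local Notation w := (fpsX C (ord0 : 'I_1)).
Hypotheses (s_gt0 : (0 < s)%N)
  (sigma_neq0 : forall j, (s * j)%:R * (s * j.+1)%:R - beta != 0).
Hypotheses (f0 : ucoef f 0 = 1) (fE : linear_ode s beta%:C%C (2 * I) f).
Local Notation T := (aquot s beta).

Lemma ucoef_subst1 (h : fps C 1) N :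
  ucoef (fps_subst (fun=> h) f) N = \sum_(j < N.+1) ucoef f j * ucoef (h ^+ j) N.
Proof.
have {1}-> : f = useries (ucoef f) by apply: ucoef_inj => k; rewrite ucoef_useries.
by rewrite -fps_compE /ucoef /fps_comp /= mdeg_ord1 ffunE.
Qed.

Lemma ucoef_pow1D (eta : fps C 1) M l i : (forall r, (i < r)%N -> ucoef (eta ^+ r) l = 0) ->
  ucoef ((1 + eta) ^+ M) l = \sum_(r < i.+1) 'C(M, r)%:R * ucoef (eta ^+ r) l.
Proof.
move=> e0; rewrite exprDn ucoef_sum.
pose F r := 'C(M, r)%:R * ucoef (eta ^+ r) l.
rewrite -(@sum_ord_widen0 _ F i.+1 (maxn M.+1 i.+1)) ?leq_maxr // => [|r ir]; last first.
  by rewrite /F e0 ?mulr0.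
rewrite (@sum_ord_widen0 _ F M.+1) ?leq_maxl // => [|r ir]; last first.
  by rewrite /F bin_small ?mul0r.
apply: eq_bigr => r _; rewrite expr1n mul1r /F /ucoef.
by elim: 'C(M, r) => [|n IH]; rewrite ?mulr0n ?mul0r // mulrSr fpsDE IH -natr1 mulrDl mul1r.
Qed.

Variables (W rho eta : fps C 1) (t M B : R).
Hypotheses (M0 : 0 <= M) (B1 : 1 <= B).
Hypotheses (WE : W = w * (1 + eta)) (eta_low : forall j, (j < s)%N -> ucoef eta j = 0)
  (eta_s : ucoef eta s = t%:C%C).
Hypotheses (etaB : forall j, nc (ucoef eta j) <= M * B ^+ j)
  (rhoB : forall j, nc (ucoef rho j) <= M * B ^+ j).
Hypotheses (rho0 : ucoef rho 0 = 1) (fW : fps_subst (fun=> W) f = rho * f).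

Let e r i := ucoef (eta ^+ r) (s * i).

(** The coefficient of [w^(s k)] in [f(W) = rho f], divided by that of [f]. As [eta] starts at
    [w^s], powers [eta^r] with [r > i] do not reach degree [s i]. *)
Lemma composition_sum k :
  \sum_(i < k.+1) (T i k)%:C%C * (I ^+ i *
     (\sum_(r < i.+1) 'C(s * (k - i), r)%:R * e r i - ucoef rho (s * i))) = 0.
Proof.
set N := (s * k)%N.
have Z : \sum_(l < N.+1) (ucoef ((1 + eta) ^+ (N - l)) l - ucoef rho l) * ucoef f (N - l) = 0.
  have := congr1 (fun p => ucoef p N) fW; rewrite ucoef_subst1 ucoefM => /eqP.
  rewrite (reindex_inj rev_ord_inj) -subr_eq0 -sumrB => /eqP Z; rewrite -[RHS]Z.
  apply: eq_bigr => l _; rewrite mulrBl /= subSS WE exprMn ucoefXnM leq_subr subKn -1?ltnS //.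
  by rewrite [ucoef f _ * _]mulrC.
have := quotient_sum s_gt0 sigma_neq0 f0 fE
  (c := fun l => ucoef ((1 + eta) ^+ (N - l)) l - ucoef rho l) Z.
move=> Z'; rewrite -[RHS]Z'; apply: eq_bigr => i _; rewrite /N -mulnBr.
rewrite (@ucoef_pow1D _ _ _ i) // => r ir.
by rewrite (fps_pow_order s_gt0 eta_low eta_s (ltnW ir)) ltn_eqF.
Qed.

(** As [k] grows, only [r = i] survives in the inner sum and contributes [t^i 2^i / i!], while [rho]
    contributes its constant term 1. The real part of the limit relation is the cosine series of
    [2 t] minus 1. *)
Theorem cos_eq1_of_convergent : cos (2 * t) = 1.
Proof.
have B0 : 0 <= B := le_trans ler01 B1.
have [D D0 DP] := aratio_bound s_gt0 sigma_neq0.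
(* [H / 2 = (M + 1) B] converts the bound [M B^j] into [(H / 2)^j] for [j > 0], as [fps_pow_bound]
   requires. *)
pose H := 2 * ((M + 1) * B).
have H0 : 0 <= H by rewrite !mulr_ge0 ?addr_ge0.
have eH r i : nc (e r i) <= H ^+ s ^+ i.
  rewrite -exprM; apply: fps_pow_bound => // [|j j0]; first exact: eta_low.
  apply: le_trans (etaB j) _; rewrite /H mulrAC mulfV // mul1r exprMn.
  apply: ler_wpM2r; first exact: exprn_ge0.
  apply: (@le_trans _ _ (M + 1)); first by rewrite lerDl.
  by case: j j0 => // j _; rewrite exprS ler_peMr ?addr_ge0 // exprn_ege1 // lerDr.
pose y i k := \sum_(r < i.+1) complex.Re (I ^+ i * e r i) * (T i k * 'C(s * (k - i), r)%:R)
  - complex.Re (I ^+ i * ucoef rho (s * i)) * T i k.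
pose l i := \sum_(r < i.+1) complex.Re (I ^+ i * e r i)
    * (if r == i :> nat then 2 ^+ i / i`!%:R else 0)
  - complex.Re (I ^+ i * ucoef rho (s * i)) * (i == 0%N)%:R.
have lE i : l i = cos_coeff (2 * t) i - (i == 0%N)%:R.
  rewrite /l; congr (_ - _); last first.
    by case: i => [|i]; rewrite ?mulr0 // muln0 rho0 expr0 mul1r mulr1.
  rewrite big_ord_recr /= eqxx big1 ?add0r => [|r _]; last by rewrite ltn_eqF // mulr0.
  by rewrite cos_coeff_Re /e (fps_pow_order s_gt0 eta_low eta_s (leqnn i)) eqxx.
pose E1 := H ^+ s * (D * s%:R * expR 1); pose E2 := B ^+ s * D.
have E10 : 0 <= E1 by rewrite !mulr_ge0 ?exprn_ge0 ?expR_ge0.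
have E20 : 0 <= E2 by rewrite !mulr_ge0 ?exprn_ge0.
have dom i k : (i <= k)%N -> `|y i k| <= (1 + M) * exp_coeff (E1 + E2) i.
  move=> ik; apply: le_trans (ler_normB _ _) _; rewrite mulrDl mul1r; apply: lerD.
    apply: (@le_trans _ _ (exp_coeff E1 i)); last by apply: exp_coeff_le; rewrite ?lerDl.
    rewrite -exp_coeffM; apply: le_trans (ler_norm_sum _ _ _) _.
    apply: (@le_trans _ _ (H ^+ s ^+ i * (`|T i k| * \sum_(r < i.+1) 'C(s * (k - i), r)%:R))).
      rewrite !mulr_sumr; apply: ler_sum => r _; rewrite normrM; apply: ler_pM => //.
        exact: le_trans (Re_IX _ _) (eH r i).
      by rewrite normrM (ger0_norm (ler0n R _)).
    by apply: ler_wpM2l; [rewrite !exprn_ge0|apply: aquot_bin_exp].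
  apply: (@le_trans _ _ (M * exp_coeff E2 i)); last first.
    by apply: ler_wpM2l => //; apply: exp_coeff_le; rewrite ?lerDr.
  rewrite -exp_coeffM -exprM mulrA normrM; apply: ler_pM => //.
    exact: le_trans (Re_IX _ _) (rhoB _).
  exact: (aquot_exp DP ik).
have yl i : y i k @[k --> \oo] --> l i.
  apply: cvgB; last by apply: cvgM; [exact: cvg_cst|exact: aquot_cvg0].
  apply: cvgn_sum => r; apply: cvgM; first exact: cvg_cst.
  by apply: aquot_bin_cvg => //; rewrite -ltnS.
have ys k : (0 < k)%N -> \sum_(i < k.+1) y i k = 0.
  move=> _; have := congr1 (@complex.Re R) (composition_sum k).
  rewrite raddf_sum /= => E; rewrite -[RHS]E; apply: eq_bigr => i _.
  rewrite Re_realM mulrBr cReD cReN mulr_sumr raddf_sum /y mulrBr; congr (_ - _); last first.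
    by rewrite mulrC.
  rewrite mulr_sumr; apply: eq_bigr => r _.
  have -> : I ^+ i * ('C(s * (k - i), r)%:R * e r i) = ('C(s * (k - i), r)%:R)%:C%C * (I ^+ i * e r i).
    by rewrite (rmorph_nat (real_complex R)); ring.
  by rewrite -[RHS]/(T i k * complex.Re _) Re_realM; ring.
have l0 := tannery (addr_ge0 ler01 M0) (addr_ge0 E10 E20) dom yl ys.
have c1 : series l @ \oo --> (cos (2 * t) - 1 : R).
  have cc : series (cos_coeff (2 * t)) @ \oo --> cos (2 * t).
    by rewrite cos.unlock; exact: is_cvg_series_cos_coeff.
  rewrite -(cvg_shiftn 1); have -> : (fun n => series l (n + 1)%N)
      = (fun n => series (cos_coeff (2 * t)) (n + 1)%N - 1).
    apply/funext => n; rewrite /series /= addn1 (eq_bigr _ (fun i _ => lE i)) sumrB; congr (_ - _).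
    by rewrite big_nat_recl //= big1 ?addr0 // => i _.
  apply: cvgB; last exact: cvg_cst.
  by rewrite (cvg_shiftn 1 (series (cos_coeff (2 * t)))).
have : (cos (2 * t) - 1 : R) = 0 by apply: cvg_unique c1 l0; exact: Rhausdorff.
by move/eqP; rewrite subr_eq0 => /eqP.
Qed.

End Composition.

(** * The lowest-order term of the flow *)

Section FlowOrder.
Variables (R : realType) (n : nat) (L : formal_field R n) (F : R[i] -> formal_map R n).
Hypothesis FP : formal_flow L F.
Variable N : nat.
Hypothesis LN : forall i, vanish N.+2 (L i).

(** Applying the field to its own components raises the order beyond [N.+2], so up to this degree
    the velocity is constant and the flow is linear in [t]. *)
Lemma real_flow_order t i a : (mdeg a <= N.+2)%N ->
  real_flow F t i a = fpsX R[i] i a + t%:C%C * L i a.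
Proof.
move=> aN; have F0 := real_flow_const FP; have Fid := real_flow_id FP.
have FD := real_flowD FP; have dF := real_flow_deriv0 FP.
have LE u : fps_subst (real_flow F u) (L i) a = L i a.
  rewrite -[in RHS](flow_subst0 Fid (L i)).
  apply: (rderiv0_cst (y := fun u => fps_subst (real_flow F u) (L i) a)) => v.
  have := flow_deriv F0 Fid FD dF (L i) a v.
  have lv : vanish (N.+2 + 1) (lie L (L i)).
    apply: vanish_sum => j _; apply: vanishM => //.
    by apply/fps_deriv_vanish/vanishW/LN.
  by rewrite (fps_subst_vanish (F0 v) lv) // addn1 ltnS.
have E : real_flow F t i a + t%:C%C * - L i a = real_flow F 0 i a + 0%:C%C * - L i a.
  apply: (rderiv0_cst (y := fun u => real_flow F u i a + u%:C%C * - L i a)) => u.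
  rewrite -(subrr (L i a)); apply: rderivD (rderiv_line _ _).
  by have := flow_coef_deriv F0 Fid FD dF i a u; rewrite LE.
by move: E; rewrite Fid mul0r addr0 mulrN => /eqP; rewrite subr_eq => /eqP.
Qed.

End FlowOrder.

(** * Restriction to [z = 0] and geometric coefficient bounds *)

Section Line0.
Variable R : realType.
Local Notation C := R[i].
Local Notation nc := (@Normc.normc R).
Local Notation l0 := (@line R 0).
Local Notation w2 := (fpsX C (lift ord0 ord0 : 'I_2)).
Local Notation at_w := (fps_subst (fun _ : 'I_1 => w2)).
Implicit Types p : fps C 2.

Lemma line0_coef p k : ucoef (fps_subst l0 p) k = p (mexp2 0 k).
Proof.
rewrite line_coef big_ord_recl big1 ?addr0 => [|i _]; first by rewrite expr0 mulr1 subn0.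
by rewrite lift0 expr0n mulr0.
Qed.

Lemma line0_z : fps_subst l0 (fpsX C ord0) = 0.
Proof. by rewrite (fps_substX (line_const 0)) /line /pair_of eqxx fpsC0 mul0r. Qed.

Lemma line0_at_w (q : fps C 1) : fps_subst l0 (at_w q) = q.
Proof.
rewrite fps_substA; [|by move=> i; exact: fpsX_const|exact: line_const].
rewrite (eq_fps_subst (h' := fun i => fpsX C i)) ?fps_subst_id // => i.
by rewrite (fps_substX (line_const 0)) (ord1 i).
Qed.

Lemma deriv_z_at_w (q : fps C 1) : fps_deriv ord0 (at_w q) = 0.
Proof.
rewrite fps_deriv_subst; last by move=> i; exact: fpsX_const.
by rewrite big1 // => i _; rewrite fps_derivX mulr0.
Qed.

Lemma deriv_w_at_w (q : fps C 1) :
  fps_deriv (lift ord0 ord0) (at_w q) = at_w (fps_deriv ord0 q).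
Proof.
rewrite fps_deriv_subst; last by move=> i; exact: fpsX_const.
by rewrite big_ord1 fps_derivX eqxx mulr1.
Qed.

Definition geometric_bound (c : nat -> C) :=
  exists M B : R, [/\ 0 <= M, 1 <= B & forall k, nc (c k) <= M * B ^+ k].

Lemma convergent_line0 p : convergent p -> geometric_bound (ucoef (fps_subst l0 p)).
Proof.
move=> /convergent_bound[M [B [M0 B1 pB]]]; exists M, B; split=> // [|k]; first exact: ltW.
by rewrite line0_coef; have := pB (mexp2 0 k); rewrite mdeg_mexp2.
Qed.

Lemma convergent_line0_deriv p : convergent p ->
  geometric_bound (ucoef (fps_subst l0 (fps_deriv ord0 p))).
Proof.
move=> /convergent_bound[M [B [M0 B1 pB]]]; exists (M * B), B; split=> // [|k].
  exact: mulr_ge0 (ltW M0) (le_trans ler01 B1).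
rewrite line0_coef fps_derivE mexp2_0 mul1r; apply: le_trans (pB _) _.
by rewrite mdegD mdeg1 mdeg_mexp2 addn1 exprS mulrA.
Qed.

Lemma geometric_bound_shift c d : geometric_bound c -> geometric_bound (fun k => c (k + d)%N).
Proof.
move=> [M [B [M0 B1 cB]]]; exists (M * B ^+ d), B; split=> // [|k].
  exact: mulr_ge0 M0 (exprn_ge0 d (le_trans ler01 B1)).
by apply: le_trans (cB _) _; rewrite addnC exprD mulrA.
Qed.

Lemma geometric_bound2 c d : geometric_bound c -> geometric_bound d ->
  exists M B : R, [/\ 0 <= M, 1 <= B, forall k, nc (c k) <= M * B ^+ k
    & forall k, nc (d k) <= M * B ^+ k].
Proof.
move=> [M [B [M0 B1 cB]]] [M' [B' [M0' B1' dB]]].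
have B0 := le_trans ler01 B1; have B0' := le_trans ler01 B1'.
exists (M + M'), (B + B'); split; first exact: addr_ge0.
- by apply: le_trans B1 _; rewrite lerDl.
- move=> k; apply: le_trans (cB k) _; apply: ler_pM; rewrite ?exprn_ge0 ?lerDl //.
  by rewrite lerXn2r ?nnegrE ?addr_ge0 // lerDl.
- move=> k; apply: le_trans (dB k) _; apply: ler_pM; rewrite ?exprn_ge0 ?lerDr //.
  by rewrite lerXn2r ?nnegrE ?addr_ge0 // lerDr.
Qed.

End Line0.

Lemma mul_inverses (A : comPzRingType) (a b c d x y : A) :
  a * b = 1 -> d * c = 1 -> b * x = c * y -> x * d = y * a.
Proof.
move=> ab dc bx; transitivity (a * (b * x) * d); first by rewrite mulrA ab mul1r.
by rewrite bx; transitivity (y * a * (d * c)); [ring|rewrite dc mulr1].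
Qed.

(** * Divergence of the field and of its flow *)

Section Field.
Variables (R : realType) (s : nat) (beta : R) (f : fps R[i] 1).
Local Notation C := R[i].
Local Notation I := ('i%C : R[i]).
Local Notation D := (fps_deriv (ord0 : 'I_1)).
Local Notation l0 := (@line R 0).
Local Notation z2 := (fpsX C (ord0 : 'I_2)).
Local Notation w2 := (fpsX C (lift ord0 ord0 : 'I_2)).
Local Notation at_w := (fps_subst (fun _ : 'I_1 => w2)).
Local Notation conjf := (fps_map (@conjc R)).
Hypotheses (s_gt0 : (0 < s)%N)
  (sigma_neq0 : forall j, (s * j)%:R * (s * j.+1)%:R - beta != 0).
Hypotheses (f0 : ucoef f 0 = 1) (fE : linear_ode s beta%:C%C (2 * I) f).
Let L : formal_field R 2 := pair_of (at_w (Ufield s f) * z2) (at_w (Vfield s f)).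
Let w2c (i : 'I_1) : (fun=> w2) i (mexp0 2) = 0. Proof. exact: fpsX_const. Qed.
Let Lz : L ord0 = at_w (Ufield s f) * z2. Proof. by []. Qed.
Let Lw : L (lift ord0 ord0) = at_w (Vfield s f). Proof. by []. Qed.

Let UV_vanish (p : fps C 1) : vanish s.+1 (fpsX C ord0 ^+ s.+1 * p).
Proof. by apply/vanish_ucoef => k ks; rewrite ucoefXnM leqNgt ks. Qed.

Lemma Lfield_vanish i : vanish s.+1 (L i).
Proof.
rewrite /L /pair_of; case: ifP => _; [apply: vanishMr|];
  by apply: (fps_subst_vanish w2c); apply: UV_vanish.
Qed.

Let conj0 : ucoef (conjf f) 0 = 1.
Proof. by rewrite /ucoef /fps_map /= -/(ucoef f 0) f0 rmorph1. Qed.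

Lemma Vfield_lead : ucoef (Vfield s f) s.+1 = 1.
Proof.
rewrite ucoefXnM leqnn subnn ucoef_const fps_const_mul -!ucoef_const f0 conj0.
by rewrite mulr1.
Qed.

Lemma Lw_coef k : L (lift ord0 ord0) (mexp2 0 k) = ucoef (Vfield s f) k.
Proof. by rewrite Lw -line0_coef line0_at_w. Qed.

Lemma Lfield_order : vanishing_order L s.+1.
Proof.
split=> [i a am|]; first exact: Lfield_vanish.
exists (lift ord0 ord0), (mexp2 0 s.+1); split; first by rewrite mdeg_mexp2.
by rewrite Lw_coef Vfield_lead; apply/eqP; rewrite oner_eq0.
Qed.

Lemma divergentP (G : 'I_2 -> fps C 2) :
  (convergent (G ord0) -> convergent (G (lift ord0 ord0)) -> False) -> divergent G.
Proof.
move=> H; apply: contrapT => nd; apply: H; apply: contrapT => nc; apply: nd.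
  by exists ord0.
by exists (lift ord0 ord0).
Qed.

(** If both components converge, then so do [w^m f fb] and, differentiating in [z] at [z = 0],
    [w^m f' fb]. Hence [P = f fb] and [Q = f' fb] are bounded geometrically and satisfy
    [P f' = Q f]. *)
Lemma Lfield_divergent : divergent L.
Proof.
apply: divergentP => /convergent_line0_deriv cz /convergent_line0 cw.
move: cz cw; rewrite Lz Lw fps_derivM deriv_z_at_w mul0r add0r fps_derivX eqxx mulr1.
rewrite !line0_at_w => /(geometric_bound_shift s.+1) cz /(geometric_bound_shift s.+1) cw.
have [M [B [M0 B1 cB dB]]] := geometric_bound2 cw cz.
apply: (@no_convergent_log_derivative _ _ _ f s_gt0 sigma_neq0 f0 fE
  (f * conjf f) (D f * conjf f) M B M0 B1).
- by move=> l; move: (cB l); cbv beta; rewrite ucoefXnM leq_addl addnK.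
- by move=> l; move: (dB l); cbv beta; rewrite ucoefXnM leq_addl addnK.
- by rewrite ucoef_const fps_const_mul -!ucoef_const f0 conj0 mulr1.
by rewrite mulrC [f * _]mulrC mulrA.
Qed.

Variable F : C -> formal_map R 2.
Hypothesis FP : formal_flow L F.
Variable t : R.
Local Notation Ft := (real_flow F t).

(** [z / f(w)] is a first integral of the field, because [U / V = f' / f]. *)
Lemma flow_semiconjugacy : Ft ord0 * at_w f = z2 * fps_subst (fun=> Ft (lift ord0 ord0)) f.
Proof.
have F0 := real_flow_const FP t.
have W0 (i : 'I_1) : (fun=> Ft (lift ord0 ord0)) i (mexp0 2) = 0 by apply: F0.
have fn : f (mexp0 1) != 0 by rewrite -ucoef_const f0 oner_neq0.
have fV := fps_mulV fn; set chi := fps_inv f in fV.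
have HH : lie L (at_w chi * z2) = 0.
  rewrite /lie !big_ord_recl big_ord0 addr0 !fps_derivM deriv_z_at_w deriv_w_at_w !fps_derivX.
  rewrite eqxx (_ : (lift ord0 ord0 == ord0 :> 'I_2) = false) // Lz Lw.
  have -> : true%:R = 1 :> fps C 2 by [].
  have -> : false%:R = 0 :> fps C 2 by [].
  rewrite mul0r add0r mulr1 mulr0 addr0.
  transitivity (at_w (Ufield s f * chi + Vfield s f * D chi) * z2).
    by rewrite (fps_substD w2c) (fps_substM w2c) (fps_substM w2c _ (D chi)); ring.
  have -> : Ufield s f * chi + Vfield s f * D chi
      = fpsX C ord0 ^+ s.+1 * conjf f * (D f * chi + f * D chi).
    by rewrite /Ufield /Vfield; ring.
  by rewrite -fps_derivM fV fps_deriv1 mulr0 fps_subst0 mul0r.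
have H : fps_subst Ft (at_w chi * z2) = at_w chi * z2.
  exact: (flow_invariant (real_flow_const FP) (real_flow_id FP) (real_flowD FP)
    (real_flow_deriv0 FP) t HH).
move: H; rewrite (fps_substM F0) (fps_substX F0) (fps_substA _ w2c F0) => H.
have E : fps_subst (fun=> Ft (lift ord0 ord0)) chi * Ft ord0 = at_w chi * z2.
  rewrite -H; congr (_ * _); apply: eq_fps_subst => i; exact/esym/(fps_substX F0).
have E1 : fps_subst (fun=> Ft (lift ord0 ord0)) f * fps_subst (fun=> Ft (lift ord0 ord0)) chi = 1.
  by rewrite -(fps_substM W0) fV fps_subst1.
have E2 : at_w f * at_w chi = 1 by rewrite -(fps_substM w2c) fV fps_subst1.
exact: mul_inverses E1 E2 E.
Qed.

(** Differentiating [flow_semiconjugacy] in [z] at [z = 0] gives [f(W) = rho f] with both [W] and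
    [rho] convergent. Since [V] starts with [w^m], the flow starts with [W = w + t w^m], so the
    coefficient of [w^s] in [eta] is [t]. *)
Lemma flow_divergent : cos (2 * t) <> 1 -> divergent Ft.
Proof.
move=> ct; apply: divergentP => cz cw; apply: ct.
have F0 := real_flow_const FP t; have lc := @line_const R 0.
pose W := fps_subst l0 (Ft (lift ord0 ord0)).
pose rho := fps_subst l0 (fps_deriv ord0 (Ft ord0)).
have Fcoef i a : (mdeg a <= s.+1)%N -> Ft i a = fpsX C i a + t%:C%C * L i a.
  case: s s_gt0 Lfield_vanish => // s' _ Lv; exact: (real_flow_order FP Lv).
have W0 (i : 'I_1) : (fun=> Ft (lift ord0 ord0)) i (mexp0 2) = 0 by apply: F0.
have fW : fps_subst (fun=> W) f = rho * f.
  have := congr1 (fun p => fps_subst l0 (fps_deriv ord0 p)) flow_semiconjugacy.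
  rewrite !fps_derivM deriv_z_at_w mulr0 addr0 fps_derivX eqxx.
  rewrite (fps_substM lc) line0_at_w (fps_substD lc) !(fps_substM lc) line0_z mul0r addr0.
  by rewrite (fps_subst1 lc) mul1r fps_substA // => ->.
have Wcoef k : (k <= s.+1)%N -> ucoef W k = (k == 1%N)%:R + t%:C%C * (k == s.+1)%:R.
  move=> ks; rewrite line0_coef Fcoef ?mdeg_mexp2 // Lw_coef; congr (_ + _ * _).
    rewrite /fpsX /=; congr (nat_of_bool _)%:R.
    apply/eqP/eqP => [/(congr1 (fun a : mexp 2 => a (lift ord0 ord0)))|->].
      by rewrite mexp2_1 ffunE eqxx.
    by apply/ffunP => -[[|[|j]] h] //; rewrite !ffunE.
  case: eqVneq => [->|kn]; first exact: Vfield_lead.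
  by rewrite ucoefXnM leqNgt ltn_neqAle kn ks.
pose eta := useries (fun k => ucoef W k.+1 - (k == 0%N)%:R).
have eta0 : ucoef eta 0 = 0.
  by rewrite ucoef_useries Wcoef // !eqxx eqSS eq_sym (gtn_eqF s_gt0) mulr0 addr0 subrr.
have WE : W = fpsX C ord0 * (1 + eta).
  apply: ucoef_inj => k; rewrite ucoefXM; case: k => [|k].
    by rewrite Wcoef // mulr0 addr0.
  by rewrite ucoefD -fpsC1 ucoefC ucoef_useries; case: k => [|k]; rewrite addrC ?subr0 ?addr0 //; exact/esym/(subrK 1).
have cW := geometric_bound_shift 1 (convergent_line0 cw).
have [M [B [M0 B1 WB rhoB]]] := geometric_bound2 cW (convergent_line0_deriv cz).
apply: (@cos_eq1_of_convergent _ _ _ f s_gt0 sigma_neq0 f0 fE W rho eta t M B M0 B1 WE) => //.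
- move=> [|j] js //; rewrite ucoef_useries Wcoef ?ltnS 1?ltnW //.
  by rewrite !eqSS (ltn_eqF js) mulr0 addr0 subr0.
- rewrite ucoef_useries Wcoef // eqxx mulr1 !eqSS.
  by rewrite (gtn_eqF s_gt0) add0r subr0.
- move=> [|j]; first by rewrite eta0 nc0 mulr_ge0 ?expr0.
  by rewrite ucoef_useries subr0 -addn1; exact: WB.
rewrite /rho line0_coef fps_derivE mexp2_0 mul1r Fcoef; last first.
  by rewrite mdegD mdeg1 mdeg_mexp2.
have aE : mexpD (mexp2 0 0) (mexp1 ord0) = mexp1 ord0.
  by apply/ffunP => i; rewrite !ffunE /pair_of; case: ifP.
by rewrite aE Lfield_vanish ?mdeg1 // mulr0 addr0 /fpsX /= eqxx.
Qed.

End Field.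

(* Assembly, with the exceptional times generated by [pi] *)
Local Close Scope classical_set_scope.

Theorem theorem5p1 (R : realType) (m : nat) (beta : R)
    (hm : (2 <= m)%N)
    (hbeta : forall l : int, beta <> (l * (l - m%:Z + 1))%:~R)
    (f g : fps R[i] 1) (hf : is_f m beta f) (hg : is_g m beta g)
    (psi : fps R[i] 2) (hpsi : is_psi m beta psi) :
  [/\ infinitesimal_automorphism (theta m psi) (Lfield m f g),
      divergent (Lfield m f g),
      vanishing_order (Lfield m f g) m
    & forall F : R[i] -> formal_map R 2, formal_flow (Lfield m f g) F ->
        exists c : R, forall t : R, (forall k : int, t <> c *~ k) ->
          formal_automorphism (theta m psi) (F (t%:C)%C) /\
          divergent (F (t%:C)%C)].
Proof.
case: m hm hbeta hf hg hpsi => // s s_gt0 hbeta hf hg hpsi; rewrite ltnS in s_gt0.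
have sigma j : (s * j)%:R * (s * j.+1)%:R - beta != 0.
  (* The excluded value at [l = - s j] is [s j (s j + s)], which is where the recursion of [f] would
     break. *)
  rewrite subr_eq0; apply/eqP => E; apply: (hbeta (- (s * j)%:Z)); rewrite -E.
  have -> : - (s * j)%:Z * (- (s * j)%:Z - s.+1%:Z + 1) = (s * j)%:Z * (s * j.+1)%:Z by nia.
  by rewrite intrM.
have [f0 fE] := is_f_ode s_gt0 hf; have LE := LfieldE s_gt0 hf hg.
have [_ psi0 psi1 _] := hpsi.
have Linf := Lfield_infinitesimal s_gt0 psi0 psi1 (is_psi_ode hpsi) f0 fE LE.
rewrite LE in Linf *; split=> //; first exact: (Lfield_divergent s_gt0 sigma f0 fE).
  exact: Lfield_order.
(* Divergence can fail only when [cos (2 t) = 1], that is, at integer multiples of [pi]. *)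
move=> F FP; exists pi => t tpi; split.
  apply: (flow_formal_automorphism FP (wgraph_const s psi) (wgraph_free s psi0) _ Linf) => i.
  exact: vanishW (_ : (2 <= s.+1)%N) (Lfield_vanish _ _).
apply: (flow_divergent s_gt0 sigma f0 fE FP) => /cos2_eq1_pi[k tk].
exact: tpi tk.
Qed.
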